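(* Let $R\in\mathbb{R}$ and let $u(x),\rho(x)\in C_b([R,\infty))$ (bounded continuous functions) with $\rho(x)>0$. Assume that $u(x)$ is decreasing (i.e. $u(x)\ge u(y)$ for $x<y$), and let $\rho_0>0$ and $u_0\in\mathbb{R}$. Take a partition $\{Y_i\}_{i\in\mathbb{N}_0}$ of $[R,\infty)$ with $Y_0=R$ and $C\sqrt[3]{\varepsilon}\ge Y_i-Y_{i-1}\ge\sqrt[3]{\varepsilon}$, $i=1,2,\ldots$, $C\ge 1$. For $\varepsilon>0$ small enough there exists an admissible global solution $U^\varepsilon=(\rho^\varepsilon,u^\varepsilon)$ (in the approximated sense, produced by the shadow wave tracking procedure) to the pressureless gas system with initial data $(\rho,u)(x,0)=(\rho_0,u_0)$ for $x\le R$ and $(\rho,u)(x,0)=(\rho(x),u(x))$ for $x>R$.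
   Context: System: $\partial_t\rho+\partial_x(\rho u)=0$, $\partial_t(\rho u)+\partial_x(\rho u^2)=0$, $\rho\ge 0$. The letters $\rho,u$ denote both the initial functions of $x$ and the solution. Approximate initial data: given the partition $\{Y_i\}$ (depending on $\varepsilon$), set $(\rho_i,u_i)=(\rho(Y_i),u(Y_i))$ for $i\ge1$; $U^\varepsilon(x,0)=(\rho_{i+1},u_{i+1})$ for $x\in(Y_i,Y_{i+1}]$, $i\in\mathbb{N}_0$, and $U^\varepsilon(x,0)=(\rho_0,u_0)$ for $x\le R$. Riemann problems. At each $(Y_i,0)$, with left state $(\rho_i,u_i)$ and right state $(\rho_{i+1},u_{i+1})$: if $u_i=u_{i+1}$, a contact discontinuity $x=Y_i+u_it$; if $u_i<u_{i+1}$, two contact discontinuities $x=Y_i+u_it$ and $x=Y_i+u_{i+1}t$ separated by a vacuum region $\mathrm{Vac}_{i,i+1}$, in which $\rho=0$ and the velocity is a continuous function equal to $u_i$ and $u_{i+1}$ on the two bounding lines; if $u_i>u_{i+1}$, a simple shadow wave with constant speed $y_{i,i+1}=\frac{\sqrt{\rho_i}u_i+\sqrt{\rho_{i+1}}u_{i+1}}{\sqrt{\rho_i}+\sqrt{\rho_{i+1}}}$ and strength $\sqrt{\rho_i\rho_{i+1}}(u_i-u_{i+1})t$. Shadow waves. A shadow wave starting at $(X,T)$ with adjacent states $(\rho_l,u_l)$, $(\rho_r,u_r)$ has central line $x=c(t)$, $c(T)=X$, speed $c'(t)=u_s(t)$ and strength $\xi(t)$ solving $\xi'=(\rho_r-\rho_l)u_s-(\rho_ru_r-\rho_lu_l)$,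 $(\xi u_s)'=(\rho_ru_r-\rho_lu_l)u_s-(\rho_ru_r^2-\rho_lu_l^2)$ for $t>T$. In $U^\varepsilon$ it is represented by an intermediate state $(\rho_\varepsilon(t),u_\varepsilon(t))$ on $|x-c(t)|<\frac{\varepsilon}{2}(t-T)+x_\varepsilon$, where $x_\varepsilon\sim\varepsilon$ ($x_\varepsilon=0$ if $T=0$), $\rho_\varepsilon\sim\varepsilon^{-1}$, $u_\varepsilon(t)\to u_s(t)$ and $(\varepsilon(t-T)+2x_\varepsilon)\rho_\varepsilon(t)\to\xi(t)$ as $\varepsilon\to0$. If the left (right) neighbouring region is a vacuum $\mathrm{Vac}_{l-1,l}$ ($\mathrm{Vac}_{r,r+1}$), then one takes $\rho_l=0$ with velocity $u_l$ ($\rho_r=0$ with velocity $u_r$). Interactions (tracking procedure). Waves propagate until the (central) lines of two or more of them meet at some $(X,T)$. The interacting waves are replaced by a single shadow wave starting at $(X,T)$, whose left state is the left state of the leftmost and whose right state is the right state of the rightmost incoming wave, with $\xi(T)$ the sum of incoming strengths and $\xi(T)u_s(T)$ the sum of (strength times speed) of incoming waves (contact discontinuities have strength zero); $x_\varepsilon$ is chosen so that the mass is continuous at $t=T$. The overlap areas of order $\varepsilon^2$ near interaction points are neglected. The procedure is repeated. Solution in the approximated sense: for every $\varphi\in C_0^\infty(\mathbb{R}\times[0,\infty))$, as $\varepsilon\to0$, $\int_0^\infty\int_{\mathbb{R}}(\rho^\varepsilon\partial_t\varphi+\rho^\varepsilon u^\varepsilon\partial_x\varphi)\,dx\,dt+\int_{\mathbb{R}}(\rho^\varepsilon\varphi)(x,0)\,dx\to0$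 and $\int_0^\infty\int_{\mathbb{R}}(\rho^\varepsilon u^\varepsilon\partial_t\varphi+\rho^\varepsilon (u^\varepsilon)^2\partial_x\varphi)\,dx\,dt+\int_{\mathbb{R}}(\rho^\varepsilon u^\varepsilon\varphi)(x,0)\,dx\to0$, and $\rho^\varepsilon(\cdot,0)$, $u^\varepsilon(\cdot,0)$ converge to the initial data in the sense of distributions. $a_\varepsilon\sim b_\varepsilon$ means $a_\varepsilon/b_\varepsilon$ tends to a positive constant. Admissibility: every wave in the solution is either a classical contact discontinuity or an overcompressive shadow wave, i.e. $u_l\ge u_s(t)\ge u_r$ for its adjacent velocities as long as it exists. *)

(* Defs.v *)
From HB Require Import structures.
From mathcomp Require Import all_boot all_order all_algebra.
From mathcomp Require Import all_classical all_reals all_analysis.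

Set Implicit Arguments.
Unset Strict Implicit.
Unset Printing Implicit Defensive.

Import Order.TTheory GRing.Theory Num.Theory.
Import numFieldNormedType.Exports.

Local Open Scope classical_set_scope.
Local Open Scope ring_scope.

(** * Piecewise constant data *)

Record data (R : realType) := Data {
  posd : nat -> R;  (* Y_i *)
  rhod : nat -> R;  (* rho_i *)
  veld : nat -> R   (* u_i *)
}.

(* The state with index 0 is the one on x <= Y_0; for i >= 1 the functions are
   sampled at Y_i. *)
Definition sampled_data (R : realType) (Y : nat -> R) (rho0 u0 : R)
    (rho u : R -> R) : data R :=
  {| posd := Y;
     rhod := fun i => if i is 0 then rho0 else rho (Y i);
     veld := fun i => if i is 0 then u0 else u (Y i) |}.

(* The limit initial datum: the constant z0 for x <= r and z(x) for x > r. *)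
Definition glued_data (R : realType) (r z0 : R) (z : R -> R) (x : R) : R :=
  if x <= r then z0 else z x.

(** * Regions and waves *)

(* [Cst i] is the region occupied by the state (rho_i, u_i); [Vac i] is the
   vacuum Vac_{i,i+1}. [rank] orders the regions from left to right. *)
Inductive region := Cst of nat | Vac of nat.

Definition rank (g : region) : nat :=
  match g with Cst i => i.*2 | Vac i => i.*2.+1 end.

Definition density (R : realType) (d : data R) (g : region) : R :=
  match g with Cst i => rhod d i | Vac _ => 0 end.

(* Velocity of [g] seen by a wave having [g] on its left: for Vac_{l-1,l} this
   is u_l. *)
Definition lvel (R : realType) (d : data R) (g : region) : R :=
  match g with Cst i => veld d i | Vac i => veld d i.+1 end.

(* Velocity of [g] seen by a wave having [g] on its right: for Vac_{r,r+1} this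
   is u_r. *)
Definition rvel (R : realType) (d : data R) (g : region) : R :=
  match g with Cst i => veld d i | Vac i => veld d i end.

(* A contact discontinuity ([shadow w = false]) or a shadow wave
   ([shadow w = true]), together with its intermediate state. All functions of
   time are meaningful on [lives w] only. *)
Record wave (R : realType) := Wave {
  shadow : bool;
  lreg : region;
  rreg : region;
  birth : R;            (* T *)
  death : \bar R;       (* time of the next interaction, +oo if none *)
  center : R -> R;      (* c(t) *)
  speed : R -> R;       (* u_s(t) *)
  strength : R -> R;    (* xi(t) *)
  xeps : R;             (* x_eps *)
  rhoeps : R -> R;      (* rho_eps(t) *)
  ueps : R -> R         (* u_eps(t) *)
}.

(* [lives] includes the time of the terminating interaction, [alive] does not. *)
Definition lives (R : realType) (w : wave R) : set R :=
  [set t | birth w <= t /\ (t%:E <= death w)%E].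

Definition alive (R : realType) (w : wave R) : set R :=
  [set t | birth w <= t /\ (t%:E < death w)%E].

Definition halfwidth (R : realType) (e : R) (w : wave R) (t : R) : R :=
  e / 2 * (t - birth w) + xeps w.

Definition in_strip (R : realType) (e : R) (w : wave R) (x t : R) : Prop :=
  [/\ shadow w, alive w t & `|x - center w t| < halfwidth e w t].

Definition strip_mass (R : realType) (e : R) (w : wave R) (t : R) : R :=
  if shadow w then (e * (t - birth w) + 2 * xeps w) * rhoeps w t else 0.

Definition shadow_wave (R : realType) (d : data R) (w : wave R) : Prop :=
  let rl := density d (lreg w) in let rr := density d (rreg w) in
  let ul := lvel d (lreg w) in let ur := rvel d (rreg w) in
  [/\ {within lives w, continuous (center w)},
      {within lives w, continuous (speed w)},
      {within lives w, continuous (strength w)} &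
      forall t : R, birth w < t -> (t%:E < death w)%E ->
      [/\ is_derive t (1 : R) (center w) (speed w t),
          is_derive t (1 : R) (strength w)
            ((rr - rl) * speed w t - (rr * ur - rl * ul)) &
          is_derive t (1 : R) (fun s => strength w s * speed w s)
            ((rr * ur - rl * ul) * speed w t
             - (rr * ur ^+ 2 - rl * ul ^+ 2))]].

(** * Riemann problems *)

Definition initial_contact (R : realType) (d : data R) (i : nat)
    (gl gr : region) (v : R) (w : wave R) : Prop :=
  [/\ shadow w = false, birth w = 0, lreg w = gl, rreg w = gr &
      forall t, lives w t ->
      [/\ center w t = posd d i + v * t, speed w t = v & strength w t = 0]].

Definition simple_speed (R : realType) (d : data R) (i : nat) : R :=
  (Num.sqrt (rhod d i) * veld d i + Num.sqrt (rhod d i.+1) * veld d i.+1)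
  / (Num.sqrt (rhod d i) + Num.sqrt (rhod d i.+1)).

Definition initial_shadow (R : realType) (d : data R) (i : nat)
    (w : wave R) : Prop :=
  [/\ shadow w, birth w = 0 & lreg w = Cst i] /\
  [/\ rreg w = Cst i.+1, xeps w = 0 &
      forall t, lives w t ->
      [/\ center w t = posd d i + simple_speed d i * t,
          speed w t = simple_speed d i &
          strength w t = Num.sqrt (rhod d i * rhod d i.+1)
                         * (veld d i - veld d i.+1) * t]].

Definition riemann_wave (R : realType) (d : data R) (i : nat)
    (w : wave R) : Prop :=
  [\/ veld d i = veld d i.+1
        /\ initial_contact d i (Cst i) (Cst i.+1) (veld d i) w,
      veld d i < veld d i.+1
        /\ initial_contact d i (Cst i) (Vac i) (veld d i) w,
      veld d i < veld d i.+1
        /\ initial_contact d i (Vac i) (Cst i.+1) (veld d i.+1) w |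
      veld d i.+1 < veld d i /\ initial_shadow d i w].

Definition riemann_solved (R : realType) (d : data R) (W : set (wave R))
    (i : nat) : Prop :=
  [/\ veld d i = veld d i.+1 ->
        exists2 w, W w & initial_contact d i (Cst i) (Cst i.+1) (veld d i) w,
      veld d i < veld d i.+1 ->
        (exists2 w, W w & initial_contact d i (Cst i) (Vac i) (veld d i) w) /\
        (exists2 w, W w &
           initial_contact d i (Vac i) (Cst i.+1) (veld d i.+1) w) &
      veld d i.+1 < veld d i -> exists2 w, W w & initial_shadow d i w].

(** * Interactions *)

Definition incoming (R : realType) (W : set (wave R)) (X T : R) : set (wave R) :=
  [set v | [/\ W v, death v = T%:E & center v T = X]].

(* [w] is the outcome of the interaction, at its starting point, of the waves
   s 0, ..., s n.-1 listed from left to right. The last clause is the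
   continuity of mass that determines [xeps w]. *)
Definition interaction_wave (R : realType) (e : R) (W : set (wave R))
    (w : wave R) : Prop :=
  let T := birth w in
  shadow w /\
  exists n (s : nat -> wave R),
    [/\ (1 < n)%N, set_inj `I_n s,
        s @` `I_n = incoming W (center w T) T &
        forall k, (k.+1 < n)%N -> rreg (s k) = lreg (s k.+1)] /\
    [/\ lreg w = lreg (s 0%N), rreg w = rreg (s n.-1),
        strength w T = \sum_(k < n) strength (s k) T,
        strength w T * speed w T
          = \sum_(k < n) strength (s k) T * speed (s k) T &
        strip_mass e w T = \sum_(k < n) strip_mass e (s k) T].

(* The waves of the whole (global in time) tracking for the data [d]. Waves
   are only terminated by interactions, and two waves whose lines meet at a
   positive time are terminated there, since two distinct waves never occupy
   the same point while alive. (At t = 0 the two contact discontinuities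
   bounding a vacuum do start from the same point.) *)
Definition tracking_waves (R : realType) (e : R) (d : data R)
    (W : set (wave R)) : Prop :=
  [/\ forall w, W w ->
        [/\ 0 <= birth w, ((birth w)%:E < death w)%E &
            shadow w -> shadow_wave d w],
      (forall i, riemann_solved d W i) /\
      (forall w, W w -> birth w = 0 -> exists i, riemann_wave d i w),
      forall w, W w -> 0 < birth w -> interaction_wave e W w,
      forall w (T : R), W w -> death w = T%:E ->
        exists w', [/\ W w', birth w' = T & center w' T = center w T] &
      forall w w' (t : R), W w -> W w' -> 0 < t -> alive w t -> alive w' t ->
        center w t = center w' t -> w = w'].

(** * The approximate solution *)

(* The half-open convention (c_left, c_right] agrees with the one for the
   initial data. A region already absorbed by a wave has no points. *)
Definition in_region (R : realType) (W : set (wave R)) (g : region)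
    (x t : R) : Prop :=
  forall w, W w -> alive w t ->
    ((rank (rreg w) <= rank g)%N /\ center w t < x) \/
    ((rank g <= rank (lreg w))%N /\ x <= center w t).

(* [nu i] is the velocity inside Vac_{i,i+1}. The vacuum is bounded by the
   lines of the waves adjacent to it, which may be shadow waves after an
   interaction. *)
Definition vacuum_velocity (R : realType) (d : data R) (W : set (wave R))
    (nu : nat -> R * R -> R) : Prop :=
  forall i, veld d i < veld d i.+1 ->
  let bounded_by (wl wr : wave R) (t : R) :=
    [/\ W wl, alive wl t & rreg wl = Vac i] /\
    [/\ W wr, alive wr t & lreg wr = Vac i] in
  {within [set p : R * R | 0 < p.2 /\ exists wl wr,
             bounded_by wl wr p.2 /\
             center wl p.2 <= p.1 <= center wr p.2],
   continuous (nu i)} /\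
  forall wl wr t, 0 < t -> bounded_by wl wr t ->
    nu i (center wl t, t) = veld d i /\ nu i (center wr t, t) = veld d i.+1.

Definition velocity (R : realType) (d : data R) (nu : nat -> R * R -> R)
    (g : region) (x t : R) : R :=
  match g with Cst i => veld d i | Vac i => nu i (x, t) end.

(* [(rhoU, uU)] is the function represented by the waves [W]. Where several
   strips overlap, which happens on areas of order e^2 near the interaction
   points, densities and momenta are superposed. *)
Definition represents (R : realType) (e : R) (d : data R) (W : set (wave R))
    (rhoU uU : R -> R -> R) : Prop :=
  exists2 nu, vacuum_velocity d W nu &
  forall x t, 0 <= t ->
  let S := [set w | W w /\ in_strip e w x t] in
  [/\ finite_set S /\ 0 <= rhoU x t,
      S = set0 -> exists2 g, in_region W g x t &
        rhoU x t = density d g /\ uU x t = velocity d nu g x t,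
      forall w, S = [set w] -> rhoU x t = rhoeps w t /\ uU x t = ueps w t &
      forall n (s : nat -> wave R), (1 < n)%N -> set_inj `I_n s ->
        s @` `I_n = S ->
        rhoU x t = \sum_(k < n) rhoeps (s k) t /\
        uU x t = (\sum_(k < n) rhoeps (s k) t * ueps (s k) t)
                 / \sum_(k < n) rhoeps (s k) t].

Definition admissible (R : realType) (d : data R) (W : set (wave R)) : Prop :=
  forall w, W w -> shadow w -> forall t, lives w t ->
    rvel d (rreg w) <= speed w t <= lvel d (lreg w).

(* Asymptotics of the intermediate states as e -> 0. As the waves change with
   e, the limits are taken locally uniformly over all waves. Since strengths of
   single waves may vanish with e, the strip mass is compared with the strength
   relatively; as the strip has width e * ((t - T) + 2 * (x_e / e)), this gives
   rho_e(t) = xi(t) / ((t - T) + 2 * (x_e / e)) * e^-1 * (1 + o(1)), which is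
   the requirement rho_e ~ e^-1. *)
Definition shadow_asymptotics (R : realType) (W : R -> set (wave R)) : Prop :=
  exists2 kappa : R, 0 < kappa &
  forall K eta : R, 0 < eta ->
  \forall e \near (0 : R)^'+, forall w, W e w -> shadow w ->
  forall t, lives w t -> t <= K -> `|center w t| <= K ->
  [/\ 0 < birth w -> `|xeps w / e - kappa| <= eta,
      `|ueps w t - speed w t| <= eta &
      `|strip_mass e w t - strength w t| <= eta * strength w t].

(** * Solutions in the approximated sense *)

Definition iterated_derive (R : realType) (V : normedModType R) (vs : seq V)
    (f : V -> R) : V -> R :=
  foldr (fun v g p => 'D_v g p) f vs.

Definition smooth (R : realType) (V : normedModType R) (f : V -> R) : Prop :=
  forall vs : seq V,
    continuous (iterated_derive vs f) /\
    forall p v, derivable (iterated_derive vs f) p v.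

(* C_0^oo(V). The space C_0^oo(R x [0,+oo)), whose elements need not vanish at
   t = 0, consists of the restrictions of the elements of C_0^oo(R^2). *)
Definition test_function (R : realType) (V : normedModType R)
    (f : V -> R) : Prop :=
  smooth f /\ compact (closure [set p | f p != 0]).

Definition locally_integrable (R : realType) (f : R -> R -> R) : Prop :=
  forall K : R,
    (@lebesgue_measure R \x @lebesgue_measure R)%E.-integrable
      [set p : R * R | `|p.1| <= K /\ 0 <= p.2 <= K]
      (fun p => (f p.1 p.2)%:E).

(* Defect of d_t f + d_x g = 0 with initial value f(x,0). *)
Definition weak_defect (R : realType) (f g : R -> R -> R)
    (phi : R * R -> R) : R :=
  \int[@lebesgue_measure R]_(t in `[0, +oo[)
    (\int[@lebesgue_measure R]_(x in setT)
       (f x t * 'D_((0, 1) : R * R) phi (x, t)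
        + g x t * 'D_((1, 0) : R * R) phi (x, t)))
  + \int[@lebesgue_measure R]_(x in setT) (f x 0 * phi (x, 0)).

Definition distribution_cvg (R : realType) (f : R -> R -> R) (g : R -> R) :
    Prop :=
  forall psi : R -> R, test_function psi ->
    (fun e => \int[@lebesgue_measure R]_(x in setT) (f e x * psi x))
      @ (0 : R)^'+ -->
    (\int[@lebesgue_measure R]_(x in setT) (g x * psi x) : R).

(* Local integrability makes the integrals of the definition meaningful. *)
Definition approximate_solution (R : realType) (rhoU uU : R -> R -> R -> R)
    (rho_in u_in : R -> R) : Prop :=
  let mom e x t := rhoU e x t * uU e x t in
  let flux e x t := rhoU e x t * uU e x t ^+ 2 in
  [/\ \forall e \near (0 : R)^'+,
        [/\ locally_integrable (rhoU e), locally_integrable (mom e) &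
            locally_integrable (flux e)],
      forall phi : R * R -> R, test_function phi ->
        (fun e => weak_defect (rhoU e) (mom e) phi) @ (0 : R)^'+ --> (0 : R),
      forall phi : R * R -> R, test_function phi ->
        (fun e => weak_defect (mom e) (flux e) phi) @ (0 : R)^'+ --> (0 : R),
      distribution_cvg (fun e x => rhoU e x 0) rho_in &
      distribution_cvg (fun e x => uU e x 0) u_in].

(* Main.v *)
(* The generalized variational principle gives the tracking in closed form. The
   particles arriving at (x, t) start from the minimizers of [action x t], and
   the lines between the regions are the fronts [front k], t |-> the last x with
   a minimizer on the left of the k-th discontinuity. Fronts are Lipschitz, and
   two fronts that have met stay together, so that the waves are the classes of
   coinciding fronts. The strength and the momentum of a class are the jumps of
   the mass and momentum transported by the free flow of the two neighbouring
   regions; since the two potentials agree along the front, these jumps satisfy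
   the ordinary differential equations of a shadow wave.

   For the weak form, the ideal solution carrying point charges on the fronts is
   exact off finitely many times. Spreading the N = O(e^(-1/3)) charges over
   strips of width at most w = O(e) costs O(N w), and superposing overlapping
   strips costs the variance of their velocities. Behind the first region the
   velocities decrease from left to right, so two overlapping strips cost at most
   the speed at which their fronts approach each other while closer than w, and
   this integrates in time to O(w). The defect is O(N^2 w) = O(e^(1/3)). *)
Require Import Defs.
From HB Require Import structures.
From mathcomp Require Import all_boot all_order all_algebra.
From mathcomp Require Import all_classical all_reals all_analysis.
From mathcomp Require Import measurable_realfun.
From mathcomp Require Import ring lra zify.
Import Order.TTheory GRing.Theory Num.Theory.
Import numFieldNormedType.Exports.
Local Open Scope classical_set_scope.
Local Open Scope ring_scope.

Set Implicit Arguments.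
Unset Strict Implicit.
Unset Printing Implicit Defensive.

(** The partition is infinite, so the interactions do not come as a sequence that could be processed
    one by one. The closed form needs no induction over them: every front exists for all times under
    a fixed index, and sums over fronts stay continuous through interactions.

    The obstacle is the state left of Y_0. Velocities decrease only from index 1 on ([veld_decr]),
    while u_0 is arbitrary. Hence Vac_{0,1} is the only possible vacuum, and cell 0 and front 0 need
    separate arguments. Front speeds are monotone only for positive indices. This suffices because a
    class ending with front 0 is a contact, so that every shadow wave can be represented by its last
    front.

    The variance of two velocities is reduced to their closing speed by |v - v'|^2 <= 2 M |v - v'|.
    To integrate the closing speed while gap < w, the condition is replaced by the weight 4 w^2 /
    (gap + w)^2, which is at least 1 there and has an explicit primitive in the gap.

    The bounds M and B do not depend on e. Only [del], the minimal distance of the nodes, does. *)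

Record regular_data (R : realType) (d : data R) (M B del : R) : Prop := {
  gap_gt0 : 0 < del;
  posd_gap : forall i, posd d i + del <= posd d i.+1;
  rhod_gt0 : forall i, 0 < rhod d i;
  rhod_le : forall i, rhod d i <= B;
  veld_le : forall i, `|veld d i| <= M;
  veld_decr : forall i, veld d i.+2 <= veld d i.+1
}.

(** * Primitives of piecewise affine functions *)

Section Primitive.
Context {R : realType} (d : data R).
Local Notation Y := (posd d).

(** Cells are closed and share their nodes, so that the formula of either neighbour may be used at a
    node. Cell 0 is the half line left of Y_0. *)
Definition cell (j : nat) (y : R) : Prop :=
  y <= Y j /\ (if j is i.+1 then Y i <= y else true).

Definition cell_index (y : R) : nat :=
  xget 0%N [set j | y <= Y j /\ forall i, (i < j)%N -> Y i < y].

Fixpoint prim_node (a b : nat -> R) (j : nat) : R :=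
  if j is i.+1 then
    prim_node a b i + (Y j - Y i) * (a j * ((Y j + Y i) / 2) + b j)
  else 0.

(* The primitive, vanishing at Y_0, of the function a_j eta + b_j of eta on the
   j-th cell. *)
Definition prim (a b : nat -> R) (y : R) : R :=
  let j := cell_index y in
  prim_node a b j + (y - Y j) * (a j * ((y + Y j) / 2) + b j).

Context {M B del : R} (H : regular_data d M B del).

Lemma posd_ltS i : Y i < Y i.+1.
Proof. have := posd_gap H i; have := gap_gt0 H; lra. Qed.

Lemma posd_lt i j : (i < j)%N -> Y i < Y j.
Proof. by apply: (homo_ltn lt_trans posd_ltS). Qed.

Lemma posd_le i j : (i <= j)%N -> Y i <= Y j.
Proof. by rewrite leq_eqVlt => /predU1P[->//|/posd_lt/ltW]. Qed.

Lemma posd_ge i : Y 0 + i%:R * del <= Y i.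
Proof.
elim: i => [|i IH]; first by rewrite mul0r addr0.
by have := posd_gap H i; rewrite -natr1; lra.
Qed.

Lemma posd_unbounded y : exists j, y < Y j.
Proof.
have d0 := gap_gt0 H.
exists (Num.truncn ((y - Y 0) / del)).+1.
apply: lt_le_trans (posd_ge _).
have := truncnS_gt ((y - Y 0) / del).
by rewrite ltr_pdivrMr //; lra.
Qed.

Lemma cell_indexP y :
  y <= Y (cell_index y) /\ forall i, (i < cell_index y)%N -> Y i < y.
Proof.
rewrite /cell_index; case: xgetP => [j -> //|/= nex]; exfalso.
have [j0 yj0] := posd_unbounded y.
have ex : exists j, y <= Y j by exists j0; exact: ltW.
case: (ex_minnP ex) => j yj jmin.
apply: (nex j); split => // i ij; rewrite ltNge; apply/negP => /jmin.
by rewrite leqNgt ij.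
Qed.

Lemma cell_indexE y : cell (cell_index y) y.
Proof.
have [h1 h2] := cell_indexP y; split => //.
by case: (cell_index y) h2 => // i h2; apply/ltW/h2.
Qed.

(** The definition of [prim] uses the first cell containing y. Any other one is the next cell, with
    y the common node, and there the recursion [prim_node] makes both formulas agree. *)
Lemma prim_cell a b j y : cell j y ->
  prim a b y = prim_node a b j + (y - Y j) * (a j * ((y + Y j) / 2) + b j).
Proof.
move=> [yj yi]; rewrite /prim; have [h1 h2] := cell_indexP y.
have jle : (cell_index y <= j)%N.
  by rewrite leqNgt; apply/negP => /h2; rewrite ltNge yj.
move: jle; rewrite leq_eqVlt => /predU1P[->//|jlt].
case: j jlt yj yi => // j; rewrite ltnS => jj yj yi.
have yE : y = Y j.
  by apply/eqP; rewrite eq_le yi andbT (le_trans h1) // posd_le.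
have -> : cell_index y = j.
  apply/eqP; rewrite eqn_leq jj leqNgt; apply/negP => /posd_lt.
  by rewrite ltNge -yE h1.
rewrite /= yE; ring.
Qed.

Lemma prim_lin c1 c2 a1 b1 a2 b2 y :
  prim (fun j => c1 * a1 j + c2 * a2 j) (fun j => c1 * b1 j + c2 * b2 j) y
  = c1 * prim a1 b1 y + c2 * prim a2 b2 y.
Proof.
rewrite /prim; move: (cell_index y) => j.
suff -> : prim_node (fun j => c1 * a1 j + c2 * a2 j)
    (fun j => c1 * b1 j + c2 * b2 j) j
    = c1 * prim_node a1 b1 j + c2 * prim_node a2 b2 j by ring.
by elim: j => [|j /= ->]; [rewrite /= !mulr0 addr0|ring].
Qed.

Lemma prim_id y : prim (fun=> 0) (fun=> 1) y = y - Y 0.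
Proof.
rewrite /prim; move: (cell_index y) => j.
suff -> : prim_node (fun=> 0) (fun=> 1) j = Y j - Y 0 by ring.
by elim: j => [|j /= ->]; [rewrite /= subrr|ring].
Qed.

Lemma prim_same_cell a b j y z : cell j y -> cell j z ->
  prim a b z - prim a b y = (z - y) / 2 * ((a j * y + b j) + (a j * z + b j)).
Proof. move=> cy cz; rewrite (prim_cell _ _ cy) (prim_cell _ _ cz); lra. Qed.

Lemma cell_node j : cell j (Y j).
Proof. by split => //; case: j => // j; apply/ltW/posd_ltS. Qed.

Lemma cell_nodeS j : cell j.+1 (Y j).
Proof. by split => //; apply/ltW/posd_ltS. Qed.

Lemma cell_index_le y z : y <= z -> (cell_index y <= cell_index z)%N.
Proof.
move=> yz; rewrite leqNgt; apply/negP => lt.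
have [_ /(_ _ lt) h] := cell_indexP y; have [h2 _] := cell_indexP z.
by move: (lt_le_trans h yz); rewrite ltNge h2.
Qed.

(** Induction on the number of cells crossed, cutting at the right end of the cell of y. On one cell
    the trapezoidal rule is exact ([prim_same_cell]). *)
Lemma prim_le a b y z : y <= z ->
  (forall j v, cell j v -> y <= v <= z -> 0 <= a j * v + b j) ->
  prim a b y <= prim a b z.
Proof.
move=> yz; have := cell_index_le yz.
have := cell_indexE y; have := cell_indexE z.
move: (cell_index y) (cell_index z) => j k cz cy jk.
rewrite -(subnKC jk) in cz; move: (k - j)%N cz => n {k jk}.
elim: n j y yz cy => [|n IH] j y yz cy cz w.
  rewrite addn0 in cz; rewrite -subr_ge0 (prim_same_cell _ _ cy cz).
  have := w _ _ cy; have := w _ _ cz; rewrite !lexx yz => /(_ isT) w1 /(_ isT) w2.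
  by apply: mulr_ge0; lra.
have jz : Y j <= z.
  have [_] := cz; rewrite addnS; apply: le_trans; apply: posd_le; lia.
have yj : y <= Y j by case: cy.
apply: (@le_trans _ _ (prim a b (Y j))).
  rewrite -subr_ge0 (prim_same_cell _ _ cy (cell_node j)).
  have := w _ _ cy; have := w _ _ (cell_node j).
  rewrite !lexx yj jz yz => /(_ isT) w1 /(_ isT) w2.
  by apply: mulr_ge0; lra.
apply: (IH j.+1) => //; first exact: cell_nodeS.
  by rewrite addSn -addnS.
by move=> i v ci /andP[jv vz]; apply: w => //; rewrite vz (le_trans yj).
Qed.

(** The sign is only weak at the ends because the weight may vanish there, as at the edge of the
    cone in [action_gt_right]. *)
Lemma prim_lt a b y z : y < z ->
  (forall j v, cell j v -> y <= v <= z -> 0 <= a j * v + b j) ->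
  (forall j v, cell j v -> y < v < z -> 0 < a j * v + b j) ->
  prim a b y < prim a b z.
Proof.
move=> yz; have := cell_index_le (ltW yz).
have := cell_indexE y; have := cell_indexE z.
move: (cell_index y) (cell_index z) => j k cz cy jk.
have same i y' z' : y' < z' -> cell i y' -> cell i z' ->
    (forall j v, cell j v -> y' < v < z' -> 0 < a j * v + b j) ->
    prim a b y' < prim a b z'.
  move=> yz' cy' cz' w.
  rewrite -subr_gt0 (prim_same_cell _ _ cy' cz').
  (* The mean of an affine function is its value at the midpoint, an interior point. *)
  have cm : cell i ((y' + z') / 2).
    case: cy' cz' => [g1 h1] [g2 h2]; split; first lra.
    by case: i {g1 g2} h1 h2 => // i h1 h2; lra.
  have := w _ _ cm; have -> : (y' < (y' + z') / 2 < z') by lra.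
  by move=> /(_ isT) w1; apply: mulr_gt0; lra.
rewrite -(subnKC jk) in cz; move: (k - j)%N cz => n {k jk}.
elim: n j y yz cy => [|n IH] j y yz cy cz w ws.
  by rewrite addn0 in cz; exact: (same j).
have jz : Y j <= z.
  have [_] := cz; rewrite addnS; apply: le_trans; apply: posd_le; lia.
have yj : y <= Y j by case: cy.
move: yj; rewrite le_eqVlt => /predU1P[yj|yj].
  apply: (IH j.+1) => //; first by rewrite yj; exact: cell_nodeS.
  by rewrite addSn -addnS.
apply: (@lt_le_trans _ _ (prim a b (Y j))).
  apply: (same j) => //; first exact: cell_node.
  by move=> i v ci /andP[jv vz]; apply: ws => //; rewrite jv (lt_le_trans vz).
apply: prim_le => // i v ci /andP[jv vz]; apply: w => //.
by rewrite vz (le_trans (ltW yj)).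
Qed.

End Primitive.

(** * The generalized variational principle *)

Section Minimizers.
Context {R : realType} (d : data R).
Local Notation Y := (posd d).
Local Notation u := (veld d).
Local Notation rh := (rhod d).

(* The potential of the generalized variational principle:
   its increments in y are the integrals of rho(eta) (eta + t u(eta) - x). *)
Definition action (x t : R) : R -> R := prim d rh (fun j => rh j * (t * u j - x)).

(** Mass, first moment and momentum of the initial data, counted from Y_0. They are the coefficients
    of [action] as an affine function of x and t, which allows actions at different (x, t) to be
    combined linearly. *)
Definition mass_upto : R -> R := prim d (fun=> 0) rh.
Definition moment_upto : R -> R := prim d rh (fun=> 0).
Definition impulse_upto : R -> R := prim d (fun=> 0) (fun j => rh j * u j).

Definition minimizer (x t y : R) : Prop := forall z, action x t y <= action x t z.

(** Metric projection onto cell j. On a cell the action is a parabola centred at x - t u_j, so the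
    projection of this centre minimizes it there. *)
Definition cell_proj (j : nat) (s : R) : R :=
  Num.min (Y j) (if j is i.+1 then Num.max (Y i) s else s).

(* The position at time t of the particle that starts at Y_i. *)
Definition particle (i : nat) (t : R) : R :=
  sup [set x | exists2 y, minimizer x t y & y <= Y i].

Context {M B del : R} (H : regular_data d M B del).

Lemma actionE x t y :
  action x t y = moment_upto y + t * impulse_upto y - x * mass_upto y.
Proof.
have -> : action x t y = prim d (fun j => 1 * rh j + 1 * 0)
    (fun j => 1 * 0 + 1 * (t * (rh j * u j) + (- x) * rh j)) y.
  by congr prim; apply/funext => j; ring.
have E := prim_lin d 1 1 rh (fun=> 0) (fun=> 0)
  (fun j => t * (rh j * u j) + (- x) * rh j) y.
rewrite E.
have -> : prim d (fun=> 0) (fun j => t * (rh j * u j) + (- x) * rh j) y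
  = prim d (fun j => t * 0 + (- x) * 0)
      (fun j => t * (rh j * u j) + (- x) * rh j) y.
  by congr prim; apply/funext => j; ring.
rewrite (prim_lin d t (- x) (fun=> 0) (fun j => rh j * u j)).
rewrite /moment_upto /impulse_upto /mass_upto; ring.
Qed.

Lemma veld_bounds j : - M <= u j <= M.
Proof. by rewrite -ler_norml (veld_le H). Qed.

Lemma M_ge0 : 0 <= M.
Proof. by apply: le_trans (veld_le H 0); exact: normr_ge0. Qed.

(* Every comparison below is between values of [action] at two points, for one
   or several (x, t); it reduces to the sign of one affine weight. *)
Lemma comb_le c1 c2 c3 y z : y <= z ->
  (forall j v, cell d j v -> y <= v <= z -> 0 <= c1 * v + c2 * u j + c3) ->
  c1 * moment_upto y + c2 * impulse_upto y + c3 * mass_upto y <=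
  c1 * moment_upto z + c2 * impulse_upto z + c3 * mass_upto z.
Proof.
move=> yz w.
have E v : c1 * moment_upto v + c2 * impulse_upto v + c3 * mass_upto v =
    prim d (fun j => c1 * rh j + 1 * (c2 * 0 + c3 * 0))
     (fun j => c1 * 0 + 1 * (c2 * (rh j * u j) + c3 * rh j)) v.
  by rewrite (prim_lin d c1 1 rh) (prim_lin d c2 c3 (fun=> 0)) mul1r addrA.
rewrite !E; apply: (prim_le H) => // j v cv yvz.
have -> : (c1 * rh j + 1 * (c2 * 0 + c3 * 0)) * v +
  (c1 * 0 + 1 * (c2 * (rh j * u j) + c3 * rh j)) =
  rh j * (c1 * v + c2 * u j + c3) by ring.
by apply: mulr_ge0; [exact: ltW (rhod_gt0 H j)|exact: w].
Qed.

Lemma comb_lt c1 c2 c3 y z : y < z ->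
  (forall j v, cell d j v -> y <= v <= z -> 0 <= c1 * v + c2 * u j + c3) ->
  (forall j v, cell d j v -> y < v < z -> 0 < c1 * v + c2 * u j + c3) ->
  c1 * moment_upto y + c2 * impulse_upto y + c3 * mass_upto y <
  c1 * moment_upto z + c2 * impulse_upto z + c3 * mass_upto z.
Proof.
move=> yz w ws.
have E v : c1 * moment_upto v + c2 * impulse_upto v + c3 * mass_upto v =
    prim d (fun j => c1 * rh j + 1 * (c2 * 0 + c3 * 0))
     (fun j => c1 * 0 + 1 * (c2 * (rh j * u j) + c3 * rh j)) v.
  by rewrite (prim_lin d c1 1 rh) (prim_lin d c2 c3 (fun=> 0)) mul1r addrA.
have E2 j v : (c1 * rh j + 1 * (c2 * 0 + c3 * 0)) * v +
  (c1 * 0 + 1 * (c2 * (rh j * u j) + c3 * rh j)) =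
  rh j * (c1 * v + c2 * u j + c3) by ring.
rewrite !E; apply: (prim_lt H) => // j v cv yvz; rewrite E2.
  by apply: mulr_ge0; [exact: ltW (rhod_gt0 H j)|exact: w].
by apply: mulr_gt0; [exact: rhod_gt0 H j|exact: ws].
Qed.

Lemma mass_lt y z : y < z -> mass_upto y < mass_upto z.
Proof.
move=> yz; have := @comb_lt 0 0 1 y z yz.
by rewrite !mul0r !add0r !mul1r; apply => j v _ _; lra.
Qed.

Lemma mass_le y z : y <= z -> mass_upto y <= mass_upto z.
Proof. by rewrite le_eqVlt => /predU1P[->//|/mass_lt/ltW]. Qed.

Lemma mass_lipschitz y z : y <= z -> mass_upto z - mass_upto y <= B * (z - y).
Proof.
move=> yz.
have E v : prim d (fun j => B * 0 + (-1) * 0) (fun j => B * 1 + (-1) * rh j) v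
    = B * (v - Y 0) - mass_upto v.
  by rewrite (prim_lin d B (-1) (fun=> 0)) prim_id /mass_upto; ring.
suff : B * (y - Y 0) - mass_upto y <= B * (z - Y 0) - mass_upto z by lra.
rewrite -!E; apply: (prim_le H) => // j v _ _.
by have := rhod_le H j; lra.
Qed.

(** Finite speed of propagation: beyond x + t M the weight eta + t u - x is positive because |u| <=
    M. With its mirror image this confines the minimizers. *)
Lemma action_gt_right x t y z : 0 <= t -> x + t * M <= y -> y < z ->
  action x t y < action x t z.
Proof.
move=> t0 xy yz; have := @comb_lt 1 t (- x) y z yz.
rewrite !actionE !mul1r !mulNr; apply => j v _ hv;
  have /andP[h1 h2] := veld_bounds j;
  have h : t * (- M) <= t * u j by apply: ler_wpM2l.
  all: nra.
Qed.

Lemma action_gt_left x t y z : 0 <= t -> y <= x - t * M -> z < y ->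
  action x t y < action x t z.
Proof.
move=> t0 xy yz; have := @comb_lt (-1) (-t) x z y yz.
rewrite !actionE => h.
suff : -1 * moment_upto z + - t * impulse_upto z + x * mass_upto z <
   -1 * moment_upto y + - t * impulse_upto y + x * mass_upto y by lra.
apply: h => j v _ hv; have /andP[h1 h2] := veld_bounds j;
  have h : t * u j <= t * M by apply: ler_wpM2l.
  all: nra.
Qed.

Lemma minimizer_bound x t y : 0 <= t -> minimizer x t y ->
  x - t * M <= y <= x + t * M.
Proof.
move=> t0 my; apply/andP; split; rewrite leNgt; apply/negP => lt.
- have := my (x - t * M); rewrite leNgt => /negP; apply.
  exact: action_gt_left.
- have := my (x + t * M); rewrite leNgt => /negP; apply.
  exact: action_gt_right.
Qed.

Lemma action_cell x t j y z : cell d j y -> cell d j z ->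
  action x t z - action x t y =
  rh j / 2 * ((z - (x - t * u j)) ^+ 2 - (y - (x - t * u j)) ^+ 2).
Proof. by move=> cy cz; rewrite /action (prim_same_cell H _ _ cy cz); field. Qed.

Lemma cell_projP j s : cell d j (cell_proj j s) /\
  forall y, cell d j y -> `|cell_proj j s - s| <= `|y - s|.
Proof.
rewrite /cell_proj; split.
  split; first by rewrite ge_min lexx.
  case: j => // j; rewrite le_min le_max lexx /= andbT.
  exact/ltW/(posd_ltS H).
move=> y [yj]; case: j yj => [|j] yj; first by move=> _; case: (lerP (Y 0)) => h;
  [rewrite !ler0_norm; lra|rewrite subrr normr0].
move=> yj'; have := posd_ltS H j => jj.
case: (lerP (Y j) s) => h1; case: (lerP (Y j.+1)) => h2.
- rewrite !ler0_norm; lra.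
- by rewrite subrr normr0.
- lra.
- rewrite !ger0_norm; lra.
Qed.

Lemma cell_proj_min x t j y : cell d j y ->
  action x t (cell_proj j (x - t * u j)) <= action x t y.
Proof.
move=> cy; have [c1 c2] := cell_projP j (x - t * u j).
rewrite -subr_ge0 (action_cell _ _ c1 cy).
apply: mulr_ge0; first by have := rhod_gt0 H j; lra.
rewrite subr_ge0 -(real_normK (num_real (cell_proj _ _ - _))).
by rewrite -(real_normK (num_real (y - _))) ler_sqr ?nnegrE ?normr_ge0 ?c2.
Qed.

(** Beyond a node Y_n > x + t M the action increases. The cells 0, ..., n each have a minimizer, the
    projected centre, and the best of these finitely many candidates is global. *)
Lemma minimizer_exists x t : 0 <= t -> exists y, minimizer x t y.
Proof.
move=> t0.
have [n hn] := posd_unbounded H (x + t * M).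
pose p (i : nat) := cell_proj i (x - t * u i).
pose k := [arg min_(i < ord0 : 'I_n.+1) action x t (p i)]%O.
have kmin (i : 'I_n.+1) : action x t (p k) <= action x t (p i).
  by rewrite /k; case: arg_minP => //= i0 _ h; exact: h.
exists (p k) => z.
have [zn|nz] := leP z (Y n).
  have cz := cell_indexE H z.
  have jn : (cell_index d z < n.+1)%N.
    rewrite ltnS leqNgt; apply/negP => lt.
    by have [_ /(_ _ lt)] := cell_indexP H z; rewrite ltNge zn.
  exact: le_trans (kmin (Ordinal jn)) (cell_proj_min _ _ cz).
apply: le_trans (kmin ord_max) _.
apply: le_trans (cell_proj_min _ _ (cell_node H n)) _.
by apply/ltW/action_gt_right => //; exact: ltW.
Qed.

Lemma minimizer_nearest x t j y z : minimizer x t y -> cell d j y -> cell d j z ->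
  (y - (x - t * u j)) ^+ 2 <= (z - (x - t * u j)) ^+ 2.
Proof.
move=> my cy cz; have := my z; rewrite -subr_ge0 (action_cell _ _ cy cz).
rewrite pmulr_rge0; first by rewrite subr_ge0.
by have := rhod_gt0 H j; lra.
Qed.

(** The right derivative rho_j (y - (x - t u_j)) of the action cannot be negative at a minimizer.
    The competitor is the centre of the parabola, cut off at Y_j. [minimizer_left] is the mirror
    image. *)
Lemma minimizer_right x t j y : minimizer x t y -> cell d j y -> y < Y j ->
  x - t * u j <= y.
Proof.
move=> my cy yj; rewrite leNgt; apply/negP => lt.
pose z := Num.min (x - t * u j) (Y j).
have [yz zs] : y < z /\ z <= x - t * u j by rewrite lt_min lt yj ge_min lexx.
have cz : cell d j z.
  split; first by rewrite /z ge_min lexx orbT.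
  by case: j {yj lt} cy @z yz zs => // j [_ h] z yz _; apply/ltW/(le_lt_trans h).
by have := minimizer_nearest my cy cz; rewrite !expr2; nra.
Qed.

Lemma minimizer_left x t j y : minimizer x t y -> cell d j y ->
  (if j is i.+1 then Y i < y else true) -> y <= x - t * u j.
Proof.
move=> my cy yj; rewrite leNgt; apply/negP => lt.
pose z := cell_proj j (x - t * u j).
have [cz zmin] := cell_projP j (x - t * u j).
have := minimizer_nearest my cy cz.
suff : z < y /\ x - t * u j <= z by rewrite -/z !expr2; nra.
rewrite /z /cell_proj; case: cy => yj1 _; case: j yj yj1 lt {z cz zmin} => [|j] yj yj1 lt.
  by rewrite gt_min lt orbT le_min lexx andbT; split => //; lra.
rewrite gt_min gt_max lt yj /= orbT le_min le_max lexx orbT andbT; split => //; lra.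
Qed.

(** Adding the two minimality inequalities cancels the moments. What is left is the integral of rho
    ((t - t') u + x' - x) between the minimizers, whose weight has a fixed sign outside the cone of
    slope M. This gives both the monotonicity of minimizers and the Lipschitz bound of particles. *)
Lemma minimizer_shift x x' t t' y y' : 0 <= t <= t' ->
  minimizer x t y -> minimizer x' t' y' ->
  (M * (t' - t) < x' - x -> y <= y') /\ (x' - x < - (M * (t' - t)) -> y' <= y).
Proof.
move=> /andP[t0 tt'] my my'.
have h1 := my y'; have h2 := my' y; rewrite !actionE in h1 h2.
split=> lt; rewrite leNgt; apply/negP => yy.
- have := @comb_lt 0 (t - t') (x' - x) y' y yy.
  suff w j : 0 < 0 + (t - t') * u j + (x' - x).
    rewrite !mul0r => h; suff : 0 < 0 :> R by rewrite ltxx.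
    apply: (@lt_le_trans _ _ ((0 + (t - t') * impulse_upto y + (x' - x) * mass_upto y) -
      (0 + (t - t') * impulse_upto y' + (x' - x) * mass_upto y'))).
      by rewrite subr_gt0; apply: h => j v _ _; rewrite mul0r; [apply: ltW|]; exact: w.
    lra.
  have /andP[g1 g2] := veld_bounds j.
  have : (t' - t) * u j <= (t' - t) * M by apply: ler_wpM2l; lra.
  lra.
- have := @comb_lt 0 (t' - t) (x - x') y y' yy.
  suff w j : 0 < 0 + (t' - t) * u j + (x - x').
    rewrite !mul0r => h; suff : 0 < 0 :> R by rewrite ltxx.
    apply: (@lt_le_trans _ _ ((0 + (t' - t) * impulse_upto y' + (x - x') * mass_upto y') -
      (0 + (t' - t) * impulse_upto y + (x - x') * mass_upto y))).
      by rewrite subr_gt0; apply: h => j v _ _; rewrite mul0r; [apply: ltW|]; exact: w.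
    lra.
  have /andP[g1 g2] := veld_bounds j.
  have : (t' - t) * (- M) <= (t' - t) * u j by apply: ler_wpM2l; lra.
  lra.
Qed.

Lemma minimizer_mono x x' t y y' : 0 <= t -> x < x' ->
  minimizer x t y -> minimizer x' t y' -> y <= y'.
Proof.
move=> t0 xx my my'; have tt : 0 <= t <= t by rewrite t0 lexx.
by have [h _] := minimizer_shift tt my my'; apply: h; lra.
Qed.

Lemma particle_has_sup i t : 0 <= t ->
  has_sup [set x | exists2 y, minimizer x t y & y <= Y i].
Proof.
move=> t0; split.
  have [y my] := minimizer_exists (Y i - t * M) t0.
  exists (Y i - t * M); exists y => //.
  by have /andP[_] := minimizer_bound t0 my; lra.
exists (Y i + t * M) => x [y my yi].
by have /andP[h _] := minimizer_bound t0 my; lra.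
Qed.

Lemma particle_lt i t x y : 0 <= t -> x < particle i t -> minimizer x t y ->
  y <= Y i.
Proof.
move=> t0 xp my.
have xp' : 0 < particle i t - x by rewrite subr_gt0.
have [x' [y' my' yi]] := sup_adherent xp' (particle_has_sup i t0).
rewrite -/(particle i t) subKr => xx'.
exact: le_trans (minimizer_mono t0 xx' my my') yi.
Qed.

Lemma particle_gt i t x y : 0 <= t -> particle i t < x -> minimizer x t y ->
  Y i < y.
Proof.
move=> t0 xp my; rewrite ltNge; apply/negP => yi.
move: xp; rewrite ltNge => /negP; apply.
by apply: sup_upper_bound; [exact: particle_has_sup|exists y].
Qed.

Lemma particle_ge i t x y : 0 <= t -> minimizer x t y -> y <= Y i ->
  x <= particle i t.
Proof.
move=> t0 my yi; rewrite leNgt; apply/negP => xp.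
by have := particle_gt t0 xp my; rewrite ltNge yi.
Qed.

Lemma particle_le i t x y : 0 <= t -> minimizer x t y -> Y i < y ->
  particle i t <= x.
Proof.
move=> t0 my yi; rewrite leNgt; apply/negP => xp.
by have := particle_lt t0 xp my; rewrite leNgt yi.
Qed.

Lemma particle_bound i t : 0 <= t -> `|particle i t - Y i| <= t * M.
Proof.
move=> t0; rewrite ler_distl; apply/andP; split.
  have [y my] := minimizer_exists (Y i - t * M) t0.
  apply: (particle_ge t0 my).
  by have /andP[_] := minimizer_bound t0 my; lra.
apply/ler_addgt0Pr => e e0.
have [y my] := minimizer_exists (Y i + t * M + e) t0.
apply: (particle_le t0 my).
by have /andP[+ _] := minimizer_bound t0 my; lra.
Qed.

Lemma particle0 i : particle i 0 = Y i.
Proof.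
have := particle_bound i (lexx 0); rewrite mul0r normr_le0 subr_eq0.
by move/eqP.
Qed.

Lemma particle_mono i j t : 0 <= t -> (i <= j)%N -> particle i t <= particle j t.
Proof.
move=> t0 ij; rewrite leNgt; apply/negP => lt.
have [x1 x2] := midf_lt lt; have [y my] := minimizer_exists ((particle j t + particle i t) / 2) t0.
have := particle_gt t0 x1 my; rewrite ltNge => /negP; apply.
exact: le_trans (particle_lt t0 x2 my) (posd_le H ij).
Qed.

Lemma particle_lipschitz i t t' : 0 <= t <= t' ->
  `|particle i t' - particle i t| <= M * (t' - t).
Proof.
move=> tt; have /andP[t0 tt'] := tt; have t0' := le_trans t0 tt'.
rewrite ler_distl; apply/andP; split.
- rewrite lerBlDr; apply/ler_addgt0Pr => e e0.
  (* The shifts e and e / 2 differ, so that the two test points are more than M (t' - t) apart, as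
     [minimizer_shift] asks. *)
  have [y' my'] := minimizer_exists (particle i t - M * (t' - t) - e) t0'.
  have [y my] := minimizer_exists (particle i t - e / 2) t0.
  have [_ /(_ ltac:(lra)) h] := minimizer_shift tt my my'.
  have lt : particle i t - e / 2 < particle i t by lra.
  by have := particle_ge t0' my' (le_trans h (particle_lt t0 lt my)); lra.
- apply/ler_addgt0Pr => e e0.
  have [y' my'] := minimizer_exists (particle i t + M * (t' - t) + e) t0'.
  have [y my] := minimizer_exists (particle i t + e / 2) t0.
  have [/(_ ltac:(lra)) h _] := minimizer_shift tt my my'.
  have lt : particle i t < particle i t + e / 2 by lra.
  exact: particle_le t0' my' (lt_le_trans (particle_gt t0 lt my) h).
Qed.

(* With A_t = action x t and A_t' = action x' t', the function t A_t' - t' A_t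
   has the increments of (t - t') eta + (x t' - x' t), a weight that decreases
   in eta; hence a gap between two minimizers never receives a minimizer again. *)
Lemma minimizer_sticky x x' t t' y z : 0 < t <= t' ->
  minimizer x t z -> minimizer x' t' y ->
  (y < z -> (x' - y) * t <= (x - y) * t') /\
  (z < y -> (x - y) * t' <= (x' - y) * t).
Proof.
move=> /andP[t0 tt'] mz my; have t0' := lt_le_trans t0 tt'.
have hz : t' * action x t z <= t' * action x t y by rewrite ler_pM2l.
have hy : t * action x' t' y <= t * action x' t' z by rewrite ler_pM2l.
rewrite !actionE in hz hy.
split=> yz; rewrite leNgt; apply/negP => lt.
- have := @comb_lt (t' - t) 0 (x' * t - x * t') y z yz.
  have w v : y <= v -> 0 < (t' - t) * v + 0 + (x' * t - x * t').
    move=> yv; have : (t' - t) * y <= (t' - t) * v by apply: ler_wpM2l; lra.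
    lra.
  rewrite !mul0r !addr0 => h.
  have {}h := h (fun j v _ hv => ltac:(rewrite mul0r; apply/ltW/w; case/andP: hv => //)).
  have {}h := h (fun j v _ hv => ltac:(rewrite mul0r; apply/w; case/andP: hv => [/ltW //])).
  lra.
- have := @comb_lt (t - t') 0 (x * t' - x' * t) z y yz.
  have w v : v <= y -> 0 < (t - t') * v + 0 + (x * t' - x' * t).
    move=> yv; have : (t' - t) * v <= (t' - t) * y by apply: ler_wpM2l; lra.
    lra.
  rewrite !mul0r !addr0 => h.
  have {}h := h (fun j v _ hv => ltac:(rewrite mul0r; apply/ltW/w; case/andP: hv => //)).
  have {}h := h (fun j v _ hv => ltac:(rewrite mul0r; apply/w; case/andP: hv => [_ /ltW //])).
  lra.
Qed.

(** Here the decrease of the velocities enters. If y is the right node of its cell, the condition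
    from the next cell gives x - t u_{i+2} <= y, and u_{i+2} <= u_{i+1} turns it into the inequality
    that is missing. *)
Lemma minimizer_cellS x t i y : 0 <= t -> minimizer x t y -> Y i < y <= Y i.+1 ->
  y = x - t * u i.+1.
Proof.
move=> t0 my /andP[iy yi].
have cy : cell d i.+1 y by split => //; exact: ltW.
apply/eqP; rewrite eq_le (minimizer_left my cy iy) /=.
move: yi; rewrite [y <= Y _]le_eqVlt => /predU1P[yi|yi]; last first.
  exact: minimizer_right my cy yi.
have cy2 : cell d i.+2 y by rewrite yi; exact: cell_nodeS H _.
have yi2 : y < Y i.+2 by rewrite yi; exact: posd_ltS H _.
apply: le_trans (minimizer_right my cy2 yi2).
by rewrite lerD2l lerN2; apply: ler_wpM2l => //; exact: veld_decr H _.
Qed.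

(** At Y_0 itself only an inequality holds: u_1 may exceed u_0, and then Y_0 is the minimizer for
    all points of the vacuum. *)
Lemma minimizer_cell0 x t y : 0 <= t -> minimizer x t y -> y <= Y 0 ->
  y <= x - t * u 0 /\ (y < Y 0 -> y = x - t * u 0).
Proof.
move=> t0 my yi; have cy : cell d 0 y by [].
have yl := minimizer_left my cy isT; split => // y0.
by apply/eqP; rewrite eq_le yl; exact: minimizer_right my cy y0.
Qed.

(** If the two particles separated again, a point between them at time t' would start from some y in
    (Y_i, Y_{i+1}] with velocity u_{i+1}. At time t, between the common position and the trajectory
    of y, every minimizer lies on the wrong side of y, against [minimizer_sticky]. *)
Lemma particle_sticky i t t' : 0 < t <= t' ->
  particle i t = particle i.+1 t -> particle i t' = particle i.+1 t'.
Proof.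
move=> tt; have /andP[t0 tt'] := tt.
have t0' := ltW (lt_le_trans t0 tt'); have tw := ltW t0.
move=> pp; apply/eqP; rewrite eq_le particle_mono // leNgt; apply/negP => lt.
pose v := u i.+1.
(* Two points of the gap have distinct parallel trajectories, at most one of which passes through
   the common position at time t. The other one is kept. *)
have [x' [y [/andP[x1 x2] my ny]]] : exists x' y, [/\
    particle i t' < x' < particle i.+1 t', minimizer x' t' y &
    particle i t != y + t * v].
  have [xa1 xa2] := midf_lt lt; set xa := _ / _ in xa1 xa2.
  have [xb1 xb2] := midf_lt xa2; set xb := _ / _ in xb1 xb2.
  have [ya mya] := minimizer_exists xa t0'.
  have [yb myb] := minimizer_exists xb t0'.
  have xb3 := lt_trans xa1 xb1.
  have ea : ya = xa - t' * v.
    by apply: minimizer_cellS => //; rewrite (particle_gt t0' xa1) ?(particle_lt t0' xa2).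
  have eb : yb = xb - t' * v.
    by apply: minimizer_cellS => //; rewrite (particle_gt t0' xb3) ?(particle_lt t0' xb2).
  have [e|ne] := eqVneq (particle i t) (ya + t * v).
    exists xb, yb; split; rewrite ?xb3 ?xb2 //.
    by apply/eqP => e2; move: xb1; rewrite e ea eb in e2; lra.
  by exists xa, ya; split; rewrite ?xa1 ?xa2.
have iy : Y i < y by exact: particle_gt t0' x1 my.
have yi : y <= Y i.+1 by exact: particle_lt t0' x2 my.
have yE : y = x' - t' * v by apply: minimizer_cellS => //; rewrite iy yi.
move: ny; rewrite neq_lt => /orP[ny|ny].
- have [xx1 xx2] := midf_lt ny; set x := _ / _ in xx1 xx2.
  have [z mz] := minimizer_exists x tw.
  have yz : y < z by apply: le_lt_trans yi (particle_gt tw _ mz); rewrite -pp.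
  have [/(_ yz) h _] := minimizer_sticky tt mz my.
  have : (x - y) * t' < t * v * t' by rewrite ltr_pM2r; lra.
  by rewrite yE in h *; nra.
- have [xx1 xx2] := midf_lt ny; set x := _ / _ in xx1 xx2.
  have [z mz] := minimizer_exists x tw.
  have yz : z < y by apply: le_lt_trans iy; exact: (particle_lt tw _ mz).
  have [_ /(_ yz) h] := minimizer_sticky tt mz my.
  have : t * v * t' < (x - y) * t' by rewrite ltr_pM2r; lra.
  by rewrite yE in h *; nra.
Qed.

(** The argument of [particle_sticky] for the vacuum, whose points all have the minimizer Y_0. *)
Lemma particle0_sticky t t' : 0 < t <= t' ->
  particle 0 t <= Y 0 + t * u 0 -> particle 0 t' <= Y 0 + t' * u 0.
Proof.
move=> tt; have /andP[t0 tt'] := tt; have t0'' := lt_le_trans t0 tt'.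
have t0' := ltW t0''; have tw := ltW t0.
move=> pp; rewrite leNgt; apply/negP => lt.
have [x1 x2] := midf_lt lt; set x' := _ / _ in x1 x2.
have [y my] := minimizer_exists x' t0'.
have yi := particle_lt t0' x2 my.
have [y1 y2] := minimizer_cell0 t0' my yi.
have yE : y = Y 0.
  apply/eqP; rewrite eq_le yi leNgt; apply/negP => h.
  by have := y2 h; lra.
(* The point at time t on the segment from (Y_0, 0) to (x', t'). Its slope exceeds u_0, so it lies
   right of [particle 0 t]. *)
pose q := Y 0 + t * (x' - Y 0) / t'.
have pq : particle 0 t < q.
  apply: (le_lt_trans pp); rewrite ltrD2l ltr_pdivlMr // -mulrA ltr_pM2l //; lra.
have [xx1 xx2] := midf_lt pq; set x := _ / _ in xx1 xx2.
have [z mz] := minimizer_exists x tw.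
have yz : y < z by rewrite yE; exact: particle_gt tw xx1 mz.
have [/(_ yz) h _] := minimizer_sticky tt mz my.
have : (x - Y 0) * t' < (q - Y 0) * t' by rewrite ltr_pM2r; lra.
rewrite [(q - _) * _](_ : _ = t * (x' - Y 0)); last by rewrite /q; field; exact: lt0r_neq0.
rewrite yE in h; lra.
Qed.

End Minimizers.

(** * Fronts *)

Section Fronts.
Context {R : realType} (d : data R).
Local Notation Y := (posd d).
Local Notation u := (veld d).
Local Notation rh := (rhod d).

(* The discontinuities are numbered so that the k-th one separates the regions
   [region_of k] and [region_of k.+1]. The vacuum Vac_{0,1} is always listed: if
   u_0 >= u_1 it is empty, and the fronts 0 and 1 coincide. *)
Definition region_of (j : nat) : region :=
  match j with 0 => Cst 0 | 1 => Vac 0 | i.+2 => Cst i.+1 end.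

(** Left of [particle 0] the minimizer is x - t u_0 if this is below Y_0, and Y_0 otherwise. The ray
    Y_0 + t u_0 therefore separates the left state from the vacuum until the two fronts meet. *)
Definition front_nneg (k : nat) (t : R) : R :=
  if k is i.+1 then particle d i t else Num.min (Y 0 + t * u 0) (particle d 0 t).

(* Constant for t <= 0, which makes it continuous on the whole line. *)
Definition front (k : nat) (t : R) : R := front_nneg k (Num.max 0 t).

Definition region_node (g : region) : nat :=
  match g with Cst i => i | Vac i => i end.

(** The starting point of the free trajectory through (x, t) in the region g. In a vacuum all of
    them issue from the node. *)
Definition foot (g : region) (x t : R) : R :=
  match g with Cst i => x - t * u i | Vac i => Y i end.

Definition is_foot (g : region) (x t : R) : Prop :=
  cell d (region_node g) (foot g x t) /\ minimizer d x t (foot g x t).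

(* Mass, momentum and action transported to (x, t) by the free flow of the
   region g, extended polynomially to all (x, t). *)
Definition mass (g : region) (x t : R) : R :=
  let i := region_node g in
  mass_upto d (Y i) + density d g * (x - t * u i - Y i).

Definition momentum (g : region) (x t : R) : R :=
  let i := region_node g in
  impulse_upto d (Y i) + density d g * u i * (x - t * u i - Y i).

Definition potential (g : region) (x t : R) : R :=
  let i := region_node g in
  action d x t (Y i) - density d g / 2 * (x - t * u i - Y i) ^+ 2.

Context {M B del : R} (H : regular_data d M B del).

Lemma front_ge0 k t : 0 <= t -> front k t = front_nneg k t.
Proof. by move=> t0; rewrite /front max_r. Qed.

Lemma front_S k t : 0 <= t -> front k.+1 t = particle d k t.
Proof. by move=> t0; rewrite front_ge0. Qed.

Lemma front_0 t : 0 <= t ->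
  front 0 t = Num.min (Y 0 + t * u 0) (particle d 0 t).
Proof. by move=> t0; rewrite front_ge0. Qed.

Lemma front_initial k : front k 0 = Y k.-1.
Proof.
case: k => [|k]; last by rewrite front_S // (particle0 H).
by rewrite front_0 // (particle0 H) mul0r addr0 minxx.
Qed.

Lemma front_mono j k t : (j <= k)%N -> front j t <= front k t.
Proof.
move=> jk; have t0 : 0 <= Num.max 0 t by rewrite le_max lexx.
rewrite /front; move: (Num.max 0 t) t0 => {}t t0.
case: j k jk => [|j] [|k] //= jk.
  by rewrite ge_min (particle_mono H t0 (leq0n k)) orbT.
exact: (particle_mono H).
Qed.

Lemma front_lipschitz k t t' : `|front k t' - front k t| <= M * `|t' - t|.
Proof.
have M0 := M_ge0 H.
have nneg a b : 0 <= a <= b -> `|front_nneg k b - front_nneg k a| <= M * (b - a).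
  move=> ab; case: k => [|k]; last exact: (particle_lipschitz H).
  have := particle_lipschitz H 0 ab; case/andP: ab => a0 ab.
  have /andP[v1 v2] := veld_bounds H 0.
  have w1 : (b - a) * u 0 <= (b - a) * M by apply: ler_wpM2l; lra.
  have w2 : (b - a) * (- M) <= (b - a) * u 0 by apply: ler_wpM2l; lra.
  rewrite /front_nneg !ler_distl => /andP[p1 p2].
  by case: (lerP (Y 0 + b * u 0)); case: (lerP (Y 0 + a * u 0)) => h1 h2; lra.
wlog tt : t t' / t <= t'.
  move=> W; have [/W//|/ltW/W] := leP t t'.
  by rewrite distrC (distrC t t').
have h : 0 <= Num.max 0 t <= Num.max 0 t'.
  by rewrite !le_max !ge_max lexx /=; case: (leP 0 t') => //=; rewrite ?tt //; lra.
apply: le_trans (nneg _ _ h) _.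
rewrite ger0_norm ?subr_ge0 //; apply: ler_wpM2l => //.
by case: (leP 0 t); case: (leP 0 t'); lra.
Qed.

Lemma front_bound k t : 0 <= t -> `|front k t - Y k.-1| <= M * t.
Proof.
move=> t0; rewrite -(front_initial k); apply: le_trans (front_lipschitz _ _ _) _.
by rewrite subr0 ger0_norm.
Qed.

Lemma front_continuous k : continuous (front k).
Proof.
move=> t; apply/cvgrPdist_le => e e0.
have M0 := M_ge0 H.
near=> s.
rewrite distrC; apply: le_trans (front_lipschitz _ _ _) _.
have : `|s - t| <= e / (M + 1).
  rewrite distrC; near: s; apply: cvgr_dist_le => //.
  by apply: divr_gt0 => //; lra.
rewrite ler_pdivlMr; last lra.
have := normr_ge0 (s - t); lra.
Unshelve. all: by end_near.
Qed.

Lemma front_sticky k t t' : 0 < t <= t' ->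
  front k t = front k.+1 t -> front k t' = front k.+1 t'.
Proof.
move=> tt; have /andP[t0 tt'] := tt.
have t0' := lt_le_trans t0 tt'.
case: k => [|k]; last first.
  by rewrite !front_S ?ltW //; exact: (particle_sticky H).
rewrite !front_0 ?front_S ?ltW // => /min_idPr h.
by apply/min_idPr; exact: (particle0_sticky H tt).
Qed.

(** The one-sided conditions at Y_0 from cells 1 and 0. For t > 0 they put the slope (x - Y_0) / t
    of the ray between u_0 and u_1. *)
Lemma foot_vac_bounds x t : 0 <= t -> is_foot (Vac 0) x t ->
  x - t * u 1 <= Y 0 <= x - t * u 0.
Proof.
move=> t0 [_ /= m]; have y01 := posd_ltS H 0.
rewrite (minimizer_right H m (cell_nodeS H 0) y01) /=.
by have [] := minimizer_cell0 H t0 m (lexx _).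
Qed.

Lemma foot_lvel j x t : 0 <= t -> is_foot (region_of j) x t ->
  x - t * lvel d (region_of j) <= foot (region_of j) x t.
Proof. by move=> t0; case: j => [|[|j]] //= /(foot_vac_bounds t0)/andP[]. Qed.

Lemma foot_rvel j x t : 0 <= t -> is_foot (region_of j) x t ->
  foot (region_of j) x t <= x - t * rvel d (region_of j).
Proof. by move=> t0; case: j => [|[|j]] //= /(foot_vac_bounds t0)/andP[]. Qed.

Lemma foot_le j x t : is_foot (region_of j) x t ->
  foot (region_of j) x t <= Y j.-1.
Proof. by case: j => [|[|j]] //= [[]]. Qed.

Lemma foot_ge j x t : is_foot (region_of j.+1) x t ->
  Y j.-1 <= foot (region_of j.+1) x t.
Proof. by case: j => [|[|j]] //= [[]]. Qed.

Lemma mass_foot g x t : is_foot g x t -> mass g x t = mass_upto d (foot g x t).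
Proof.
case: g => i [] /=; rewrite /mass /=; last by rewrite mul0r addr0.
move=> c _; rewrite /mass_upto.
have /eqP := prim_same_cell H (fun=> 0) rh (cell_node H i) c.
by rewrite subr_eq => /eqP ->; field.
Qed.

Lemma momentum_foot g x t : is_foot g x t ->
  momentum g x t = impulse_upto d (foot g x t).
Proof.
case: g => i [] /=; rewrite /momentum /=; last by rewrite !mul0r addr0.
move=> c _; rewrite /impulse_upto.
have /eqP := prim_same_cell H (fun=> 0) (fun j => rh j * u j) (cell_node H i) c.
by rewrite subr_eq => /eqP ->; field.
Qed.

Lemma potential_cell g x t : cell d (region_node g) (foot g x t) ->
  potential g x t = action d x t (foot g x t).
Proof.
case: g => i /=; rewrite /potential /=; last by rewrite !mul0r subr0.
move=> c; have /eqP := action_cell H x t (cell_node H i) c.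
by rewrite subr_eq => /eqP ->; field.
Qed.

Lemma is_foot_potential g g' x t : is_foot g x t -> is_foot g' x t ->
  potential g x t = potential g' x t.
Proof.
move=> [c m] [c' m']; rewrite !potential_cell //.
by apply/eqP; rewrite eq_le m m'.
Qed.

Lemma le_left_limit (D : R -> R) t : 0 < t -> {for t, continuous D} ->
  (forall s, 0 < s < t -> 0 <= D s) -> 0 <= D t.
Proof.
move=> t0 cD h; rewrite leNgt; apply/negP => lt.
have /cvgrPdist_lt/(_ (- D t)) := cD; rewrite oppr_gt0 => /(_ lt).
move/nbhs_ballP => [r /= r0 hr].
pose s := Num.max (t / 2) (t - r / 2).
have [s1 s2] : 0 < s < t /\ `|t - s| < r.
  rewrite /s ltr_distl; case: (leP (t / 2)); lra.
have := hr s s2; have := h s s1; rewrite /= ltr_distl => a /andP[]; lra.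
Qed.

(** Cell membership and minimality are closed conditions, and [potential] is continuous in (x, t).
    The limit serves at times when a region closes and has no interior points left. *)
Lemma is_foot_left_limit g (x : R -> R) t : 0 < t -> {for t, continuous x} ->
  (forall s, 0 < s < t -> is_foot g (x s) s) -> is_foot g (x t) t.
Proof.
move=> t0 cx h.
have cf : {for t, continuous (fun s => foot g (x s) s)}.
  case: g {h} => i /=; last exact: cvg_cst.
  apply: cvgB => //; apply: cvgM; [exact: cvg_id|exact: cvg_cst].
have c : cell d (region_node g) (foot g (x t) t).
  split.
    rewrite -subr_ge0; apply: (le_left_limit (D := fun s => Y _ - foot g (x s) s)) => //.
      by apply: cvgB => //; exact: cvg_cst.
    by move=> s /h[[]]; rewrite subr_ge0.
  have : forall s, 0 < s < t -> (if region_node g is i.+1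
      then Y i <= foot g (x s) s else true : Prop) by move=> s /h[[_ h1] _]; exact: h1.
  case: (region_node g) => // i hi.
  rewrite -subr_ge0; apply: (le_left_limit (D := fun s => foot g (x s) s - Y i)) => //.
    by apply: cvgB => //; exact: cvg_cst.
  by move=> s /hi; rewrite subr_ge0.
split => // z; rewrite -potential_cell // -subr_ge0.
apply: (le_left_limit (D := fun s => action d (x s) s z - potential g (x s) s)) => //.
  have ca v : {for t, continuous (fun s => action d (x s) s v)}.
    rewrite (_ : (fun s => _) = (fun s => moment_upto d v + s * impulse_upto d v
      - x s * mass_upto d v)); last by apply/funext => s; rewrite actionE.
    apply: cvgB; last by apply: cvgM => //; exact: cvg_cst.
    apply: cvgD; first exact: cvg_cst.
    by apply: cvgM; [exact: cvg_id|exact: cvg_cst].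
  apply: cvgB; first exact: ca.
  apply: cvgB; first exact: ca.
  apply: cvgM; first exact: cvg_cst.
  have ce : {for t, continuous (fun s => x s - s * u (region_node g) - Y (region_node g))}.
    apply: cvgB; last exact: cvg_cst.
    apply: cvgB => //; apply: cvgM; [exact: cvg_id|exact: cvg_cst].
  by rewrite /continuous_at expr2; apply: cvgM; exact: ce.
by move=> s /h[cs ms]; rewrite potential_cell // subr_ge0.
Qed.

Lemma is_foot_inside j x t : 0 <= t -> (if j is k.+1 then front k t < x else true) ->
  x < front j t -> is_foot (region_of j) x t.
Proof.
move=> t0; case: j => [_|[|j]].
- rewrite front_0 // lt_min => /andP[h1 h2].
  have [y my] := minimizer_exists H x t0.
  have yi := particle_lt H t0 h2 my.
  have [y1 y2] := minimizer_cell0 H t0 my yi.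
  have lt : y < Y 0 by lra.
  by rewrite /is_foot /= -(y2 lt).
- rewrite front_0 // front_S // => + h2; rewrite gt_min => /orP[h1|]; last lra.
  have [y my] := minimizer_exists H x t0.
  have yi := particle_lt H t0 h2 my.
  have [y1 y2] := minimizer_cell0 H t0 my yi.
  have yE : y = Y 0.
    apply/eqP; rewrite eq_le yi leNgt; apply/negP => h.
    by have := y2 h; lra.
  by rewrite /is_foot /= -yE; split => //; rewrite yE; exact: cell_node H 0.
- rewrite !front_S // => h1 h2.
  have [y my] := minimizer_exists H x t0.
  have iy := particle_gt H t0 h1 my; have yi := particle_lt H t0 h2 my.
  have yE : y = x - t * u j.+1 by apply: (minimizer_cellS H) => //; rewrite iy yi.
  by rewrite /is_foot /= -yE; split => //; split => //; exact: ltW.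
Qed.

(** Only positive times count, since fronts 0 and 1 always coincide at t = 0. The value is +oo if
    the fronts never meet. *)
Definition merge (k : nat) : \bar R :=
  ereal_inf [set t%:E | t in [set t | 0 < t /\ front k t = front k.+1 t]].

Lemma merge_ge0 k : (0 <= merge k)%E.
Proof. by apply: le_ereal_inf_tmp => _ [t [t0 _] <-]; rewrite lee_fin ltW. Qed.

(** The infimum is attained: a positive gap shrinks at a rate of at most 2 M, so it survives for a
    time [dl], and by stickiness no meeting can precede t + [dl]. *)
Lemma mergeP k t : 0 < t -> (front k t = front k.+1 t) <-> (merge k <= t%:E)%E.
Proof.
move=> t0; split=> [e|].
  by apply: ereal_inf_lbound; exists t.
move=> le; apply/eqP; rewrite eq_le front_mono // leNgt; apply/negP => lt.
have M0 := M_ge0 H.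
pose dl := (front k.+1 t - front k t) / (4 * M + 4).
have dl0 : 0 < dl by apply: divr_gt0; lra.
suff : ((t + dl)%:E <= merge k)%E.
  by move=> /le_trans/(_ le); rewrite lee_fin; lra.
apply: le_ereal_inf_tmp => _ [s [s0 es] <-]; rewrite lee_fin leNgt; apply/negP => lts.
have ss : 0 < s <= t + dl by rewrite s0 ltW.
have := front_sticky ss es.
have := front_lipschitz k t (t + dl); have := front_lipschitz k.+1 t (t + dl).
rewrite [t + dl - t]addrC addKr (ger0_norm (ltW dl0)) !ler_distl.
move=> /andP[g1 g2] /andP[g3 g4] e.
have : dl * (4 * M + 4) = front k.+1 t - front k t by rewrite /dl divfK //; apply: lt0r_neq0; lra.
lra.
Qed.

Lemma merge_gt0 k t : 0 < t -> (forall s, 0 < s < t -> front k s != front k.+1 s) ->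
  (0 < merge k)%E.
Proof.
move=> t0 h; apply: (@lt_le_trans _ _ (t / 2)%:E); first by rewrite lte_fin; lra.
apply: le_ereal_inf_tmp => _ [s [s0 /eqP es] <-]; rewrite lee_fin leNgt; apply/negP => lts.
have /h : 0 < s < t by rewrite s0 /=; lra.
by rewrite es.
Qed.

(** These two fronts start from nodes at least [del] apart and approach each other at a speed of at
    most 2 M. *)
Lemma mergeS_gt0 k : (0 < merge k.+1)%E.
Proof.
have M0 := M_ge0 H; have d0 := gap_gt0 H.
apply: (@merge_gt0 _ (del / (2 * M + 1))); first by apply: divr_gt0; lra.
move=> s /andP[s0]; rewrite ltr_pdivlMr; last lra.
move=> h; have := front_bound k.+1 (ltW s0); have := front_bound k.+2 (ltW s0).
rewrite !ler_distl => /andP[g1 g2] /andP[g3 g4].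
have := posd_gap H k => /= gk; apply/eqP => e.
rewrite /= in g1 g4; rewrite -e in g1; lra.
Qed.

(** Both fronts start at Y_0. For small s a minimizer just right of Y_0 lies in cell 1, so its point
    is right of Y_0 + s u_1, while the ray of speed u_0 is strictly left of it. *)
Lemma merge0_gt0 : u 0 < u 1 -> (0 < merge 0)%E.
Proof.
move=> uu; have M0 := M_ge0 H; have d0 := gap_gt0 H.
apply: (@merge_gt0 _ (del / (2 * M + 1))); first by apply: divr_gt0; lra.
move=> s /andP[s0]; rewrite ltr_pdivlMr; last lra.
move=> h; have sw := ltW s0.
have su : s * u 0 < s * u 1 by rewrite ltr_pM2l.
suff : Y 0 + s * u 1 <= particle d 0 s.
  move=> hh; rewrite front_0 // front_S // min_l; last lra.
  by apply/eqP => e; lra.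
rewrite leNgt; apply/negP => lt.
have [x1 x2] := midf_lt lt; set x := _ / _ in x1 x2.
have [y my] := minimizer_exists H x sw.
have y0 := particle_gt H sw x1 my.
have /andP[_ yb] := minimizer_bound H sw my.
have /andP[_ v2] := veld_bounds H 1.
have : s * u 1 <= s * M by rewrite ler_pM2l.
have gk := posd_gap H 0.
move=> sM; have y1 : y <= Y 1 by lra.
have yE : y = x - s * u 1 by apply: (minimizer_cellS H) => //; rewrite y0 y1.
lra.
Qed.

(** A point inside the vacuum would have the minimizer Y_0, and the condition from cell 1 then puts
    it left of Y_0 + e u_1 <= Y_0 + e u_0. *)
Lemma merge0_eq0 : u 1 <= u 0 -> merge 0 = 0%E.
Proof.
move=> uu; apply/eqP; rewrite eq_le merge_ge0 andbT.
apply/lee_addgt0Pr => e e0; rewrite add0e.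
apply/mergeP => //; have ew := ltW e0.
rewrite front_0 // front_S //; apply/min_idPr.
rewrite leNgt; apply/negP => lt.
have [x1 x2] := midf_lt lt; set x := _ / _ in x1 x2.
have [y my] := minimizer_exists H x ew.
have yi := particle_lt H ew x2 my.
have [y1 y2] := minimizer_cell0 H ew my yi.
have yE : y = Y 0.
  apply/eqP; rewrite eq_le yi leNgt; apply/negP => h.
  by have := y2 h; lra.
have c1 : cell d 1 y by rewrite yE; exact: cell_nodeS H 0.
have lt1 : y < Y 1 by rewrite yE; exact: posd_ltS H 0.
have := minimizer_right H my c1 lt1; rewrite yE.
have : e * u 1 <= e * u 0 by rewrite ler_pM2l.
lra.
Qed.

Lemma merge_front k t : 0 <= t -> (merge k <= t%:E)%E -> front k t = front k.+1 t.
Proof.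
rewrite le_eqVlt => /predU1P[<-|t0 /mergeP]; last exact.
case: k => [_|k]; first by rewrite !front_initial.
by rewrite leNgt mergeS_gt0.
Qed.

Lemma is_foot0 j k : (k.-1 = j.-1) \/ (j = k.+1) -> is_foot (region_of j) (front k 0) 0.
Proof.
move=> jk; rewrite front_initial.
have m x : minimizer d x 0 x.
  have [y my] := minimizer_exists H x (lexx 0).
  have := minimizer_bound H (lexx 0) my.
  by rewrite !mul0r subr0 addr0 -eq_le => /eqP xy; rewrite {2}xy.
have mm : minimizer d (Y k.-1) 0 (foot (region_of j) (Y k.-1) 0).
  case: jk => [kj|->]; first case: j kj => [|[|j]] /= kj; rewrite ?kj ?mul0r ?subr0 //.
  case: k => [|k] /=; rewrite ?mul0r ?subr0 //.
split => //; case: jk {mm} => [kj|->].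
  by case: j kj => [|[|j]] /= kj; rewrite ?kj ?mul0r ?subr0; exact: cell_node H _.
by case: k => [|k] /=; rewrite ?mul0r ?subr0; [exact: cell_node H _|exact: cell_nodeS H _].
Qed.

(** At the time [merge k] the region has just closed. Its foot is obtained as a limit along a curve
    that runs inside the region before t. *)
Lemma is_foot_left j t : 0 <= t ->
  (if j is k.+1 then (t%:E <= merge k)%E else true) ->
  is_foot (region_of j) (front j t) t.
Proof.
rewrite le_eqVlt => /predU1P[<- _|t0 h]; first by apply: is_foot0; left.
pose L s := if j is k.+1 then front k s else front j s - 1.
have cL : {for t, continuous L}.
  rewrite /L; case: (j) => [|k]; last exact: front_continuous.
  by apply: cvgB; [exact: front_continuous|exact: cvg_cst].
(* The fraction (t - s) / (2 t) lies in (0, 1) for 0 < s < t and vanishes at t. For region 0,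
   unbounded on the left, L is any curve left of the front. *)
pose x s := front j s - (t - s) / (2 * t) * (front j s - L s).
have -> : front j t = x t by rewrite /x subrr mul0r mul0r subr0.
apply: is_foot_left_limit => //.
  apply: cvgB; first exact: front_continuous.
  apply: cvgM; last by apply: cvgB => //; exact: front_continuous.
  apply: cvgM; last exact: cvg_cst.
  by apply: cvgB; [exact: cvg_cst|exact: cvg_id].
move=> s /andP[s0 st].
have lt : L s < front j s.
  rewrite /L; case: j h {cL L x} => [|k] h; first lra.
  rewrite lt_neqAle front_mono // andbT; apply/eqP => /mergeP - /(_ s0).
  by rewrite leNgt (lt_le_trans _ h) // lte_fin.
pose q := (t - s) / (2 * t).
have [q0 q1] : 0 < q /\ q < 1.
  split; first by apply: divr_gt0; lra.
  by rewrite /q ltr_pdivrMr; lra.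
apply: is_foot_inside; first exact: ltW.
  move: lt; rewrite /x -/q /L; case: j {h cL L x} => // k lt; nra.
by rewrite /x -/q; nra.
Qed.

Lemma is_foot_right k t : 0 <= t -> (t%:E <= merge k)%E ->
  is_foot (region_of k.+1) (front k t) t.
Proof.
rewrite le_eqVlt => /predU1P[<- _|t0 h]; first by apply: is_foot0; right.
pose x s := front k s + (t - s) / (2 * t) * (front k.+1 s - front k s).
have -> : front k t = x t by rewrite /x subrr mul0r mul0r addr0.
apply: is_foot_left_limit => //.
  apply: cvgD; first exact: front_continuous.
  apply: cvgM; last by apply: cvgB; exact: front_continuous.
  apply: cvgM; last exact: cvg_cst.
  by apply: cvgB; [exact: cvg_cst|exact: cvg_id].
move=> s /andP[s0 st].
have lt : front k s < front k.+1 s.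
  rewrite lt_neqAle front_mono // andbT; apply/eqP => /mergeP - /(_ s0).
  by rewrite leNgt (lt_le_trans _ h) // lte_fin.
pose q := (t - s) / (2 * t).
have [q0 q1] : 0 < q /\ q < 1.
  split; first by apply: divr_gt0; lra.
  by rewrite /q ltr_pdivrMr; lra.
by apply: is_foot_inside; [exact: ltW| |]; rewrite /x -/q; nra.
Qed.

End Fronts.

(** * Waves as classes of coinciding fronts *)

Section Classes.
Context {R : realType} (d : data R).
Local Notation Y := (posd d).
Local Notation u := (veld d).
Local Notation rh := (rhod d).
Local Notation front := (front d).
Local Notation merge := (merge d).

(* A class is a maximal interval a..b of fronts that coincide on a time
   interval; the waves of the tracking correspond to the classes. *)
Definition merge_before (a : nat) : \bar R := if a is k.+1 then merge k else +oo%E.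

Definition class_death (a b : nat) : \bar R := Order.min (merge_before a) (merge b).

Definition class_birth (a b : nat) : R :=
  \big[Num.max/0]_(k < b | (a <= k)%N) fine (merge k).

Definition is_class (a b : nat) : Prop :=
  [/\ (a <= b)%N, (0 < class_death a b)%E &
      forall k, (a <= k < b)%N -> (merge k < class_death a b)%E].

Definition is_class_at (a b : nat) (t : R) : Prop :=
  [/\ (a <= b)%N, forall k, (a <= k < b)%N -> (merge k <= t%:E)%E &
      (t%:E < class_death a b)%E].

(** The jump is the initial mass between the two feet ([class_massE]), that is, the mass absorbed so
    far. The formula makes sense at all times, which gives continuity on the whole line. *)
Definition class_mass (a b : nat) (t : R) : R :=
  mass d (region_of b.+1) (front a t) t - mass d (region_of a) (front a t) t.

Definition class_momentum (a b : nat) (t : R) : R :=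
  momentum d (region_of b.+1) (front a t) t
  - momentum d (region_of a) (front a t) t.

(** The classes born at t = 0. The pair 0, 1 is the single discontinuity at Y_0 in the case u_1 <=
    u_0, where the listed vacuum is empty. *)
Definition is_initial (a b : nat) : bool := (a == b) || (a == 0%N) && (b == 1%N).

Definition is_shadow (a b : nat) : bool :=
  rvel d (region_of b.+1) < lvel d (region_of a).

Definition initial_speed (a b : nat) : R :=
  if is_shadow a b then simple_speed d b.-1 else lvel d (region_of a).

(** For an initial class the quotient is 0 / 0 at t = 0, and for a contact at all times of its life.
    The constant speed of the Riemann problem is used instead. *)
Definition class_speed (a b : nat) (t : R) : R :=
  if is_initial a b then initial_speed a b
  else class_momentum a b t / class_mass a b t.

(** All waves born in interactions get the same x_eps = e. Continuity of mass is achieved by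
    [rhoeps], the strength divided by the width of the strip, so that the strip mass equals the
    strength exactly. *)
Definition class_xeps (e : R) (a b : nat) : R := if is_initial a b then 0 else e.

Definition class_strength (a b : nat) (t : R) : R :=
  if is_shadow a b then class_mass a b t else 0.

Definition class_width (e : R) (a b : nat) (t : R) : R :=
  e * (t - class_birth a b) + 2 * class_xeps e a b.

Definition class_wave (e : R) (a b : nat) : wave R := {|
  shadow := is_shadow a b;
  lreg := region_of a;
  rreg := region_of b.+1;
  birth := class_birth a b;
  death := class_death a b;
  Defs.center := front a;
  speed := class_speed a b;
  strength := class_strength a b;
  xeps := class_xeps e a b;
  rhoeps := fun t => class_strength a b t / class_width e a b t;
  ueps := class_speed a b |}.

Definition class_waves (e : R) : set (wave R) :=
  [set w | exists a b, is_class a b /\ w = class_wave e a b].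

Context {M B del : R} (H : regular_data d M B del).

Lemma is_class_fin a b k : is_class a b -> (a <= k < b)%N -> (merge k \is a fin_num)%E.
Proof.
move=> [_ _ h] /h lt; rewrite fin_numE.
have := merge_ge0 d k; case: (merge k) lt => [x| |] //.
by rewrite ltNge leey.
Qed.

Lemma class_birth_ge0 a b : 0 <= class_birth a b.
Proof. exact: bigmax_ge_id. Qed.

Lemma class_birth_le a b t : is_class a b ->
  (class_birth a b <= t) <-> (0 <= t /\ forall k, (a <= k < b)%N -> (merge k <= t%:E)%E).
Proof.
move=> C; split=> [/bigmax_leP[t0 h]|[t0 h]].
  split=> // k kab; have /andP[ak kb] := kab.
  by rewrite -(fineK (is_class_fin C kab)) lee_fin; exact: (h (Ordinal kb)).
apply/bigmax_leP; split => // k ak; have kab : (a <= k < b)%N by rewrite ak ltn_ord.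
by rewrite -lee_fin (fineK (is_class_fin C kab)); exact: h.
Qed.

Lemma class_birth_lt_death a b : is_class a b -> ((class_birth a b)%:E < class_death a b)%E.
Proof.
move=> C; have [_ d0 h] := C; rewrite /class_birth.
elim/big_ind : _ => // [x y hx hy|k ak].
  by rewrite /Num.max; case: ifP.
have kab : (a <= k < b)%N by rewrite ak ltn_ord.
by rewrite (fineK (is_class_fin C kab)) h.
Qed.

Lemma is_class_atP a b t : 0 <= t -> is_class_at a b t <->
  [/\ is_class a b, class_birth a b <= t & (t%:E < class_death a b)%E].
Proof.
move=> t0; split=> [[ab h td]|[C ht td]].
  have C : is_class a b.
    split => //; first by apply: le_lt_trans td; rewrite lee_fin.
    by move=> k /h; move/le_lt_trans; apply.
  by split=> //; apply/class_birth_le.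
have [ab _ _] := C; split => //.
by have /(class_birth_le _ C)[] := ht.
Qed.

Lemma front_class a b k t : 0 <= t -> (forall k, (a <= k < b)%N -> (merge k <= t%:E)%E) ->
  (a <= k <= b)%N -> front k t = front a t.
Proof.
move=> t0 h /andP[ak kb].
rewrite -(subnKC ak); have : (a + (k - a) <= b)%N by rewrite subnKC.
elim: (k - a)%N => [|n IH] nb; first by rewrite addn0.
rewrite addnS -(merge_front H) //; last by apply: h; rewrite leq_addr /= -addnS.
by apply: IH; apply: leq_trans nb; rewrite addnS.
Qed.

(** Otherwise front k would coincide at time t with all later fronts, which start arbitrarily far to
    the right and move at a speed of at most M. *)
Lemma exists_merge_gt k t : 0 <= t -> exists2 b, (k <= b)%N & (t%:E < merge b)%E.
Proof.
move=> t0; have [E|E] := pselect (exists2 b, (k <= b)%N & (t%:E < merge b)%E) => //.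
have h b : (k <= b)%N -> (merge b <= t%:E)%E.
  by move=> kb; rewrite leNgt; apply/negP => lt; apply: E; exists b.
have [j hj] := posd_unbounded H (front k t + M * t).
have fe : front (maxn k j.+1) t = front k t.
  apply: (@front_class k (maxn k j.+1)) => //; last by rewrite leq_maxl leqnn.
  by move=> l /andP[/h].
have := front_mono H t (leq_maxr k j.+1); rewrite fe.
have := front_bound H j.+1 t0; rewrite ler_distl /= => /andP[g1 g2]; lra.
Qed.

Lemma exists_class_at k t : 0 <= t -> exists a b, is_class_at a b t /\ (a <= k <= b)%N.
Proof.
move=> t0.
have exb : exists b, (k <= b)%N && (t%:E < merge b)%E.
  by have [b kb tb] := exists_merge_gt k t0; exists b; rewrite kb.
case: (ex_minnP exb) => b /andP[kb tb] bmin.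
(* The minimal n with this property gives the largest possible left end k - n. The choice n = k
   always qualifies, as [merge_before 0] is +oo. *)
have exa : exists a, (a <= k)%N && (t%:E < merge_before (k - a))%E.
  by exists k; rewrite leqnn subnn /= ltry.
case: (ex_minnP exa) => n /andP[nk tn] nmin.
exists (k - n)%N, b; split; last by rewrite leq_subr.
split; first exact: leq_trans (leq_subr _ _) kb.
  move=> l /andP[nl lb]; rewrite leNgt; apply/negP => tl.
  have [kl|lk] := leqP k l.
    by have := bmin l; rewrite kl tl => /(_ isT); rewrite leqNgt lb.
  have := nmin (k - l.+1)%N; rewrite leq_subr subKn // tl => /(_ isT); lia.
by rewrite /class_death lt_min tn tb.
Qed.

Lemma is_class_at_unique a b a' b' k t : is_class_at a b t -> is_class_at a' b' t ->
  (a <= k <= b)%N -> (a' <= k <= b')%N -> a = a' /\ b = b'.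
Proof.
move=> [_ h td] [_ h' td'] /andP[ak kb] /andP[ak' kb'].
move: td td'; rewrite /class_death !lt_min => /andP[ta tb] /andP[ta' tb'].
split; apply/eqP; rewrite eqn_leq; apply/andP; split; rewrite leqNgt; apply/negP => lt.
- case: a ak ta lt {h} => // a ak /= ta lt.
  by have /h' : (a' <= a < b')%N; [lia|rewrite leNgt ta].
- case: a' ak' ta' lt {h'} => // a' ak' /= ta' lt.
  by have /h : (a <= a' < b)%N; [lia|rewrite leNgt ta'].
- by have /h : (a <= b' < b)%N; [lia|rewrite leNgt tb'].
- by have /h' : (a' <= b < b')%N; [lia|rewrite leNgt tb].
Qed.

Lemma is_class_at_front a b k t : 0 < t -> is_class_at a b t ->
  front k t = front a t -> (a <= k <= b)%N.
Proof.
move=> t0 [ab h td] e; move: td; rewrite /class_death lt_min => /andP[ta tb].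
apply/andP; split; rewrite leqNgt; apply/negP => lt.
- case: a ab h ta e lt => // a ab h ta e lt.
  have e2 : front a t = front a.+1 t.
    apply/eqP; rewrite eq_le (front_mono H) // -e; apply: (front_mono H).
    by rewrite -ltnS.
  by move: ta; rewrite ltNge /=; move/negP; apply; apply/(mergeP H).
- have fb : front b t = front a t by apply: (front_class (ltW t0) h); rewrite ab leqnn.
  have e2 : front b t = front b.+1 t.
    by apply/eqP; rewrite eq_le (front_mono H) // fb -e; apply: (front_mono H).
  by move: tb; rewrite ltNge; move/negP; apply; apply/(mergeP H).
Qed.

Section Lives.
Context (a b : nat) (t : R) (C : is_class a b).
Hypothesis (bt : class_birth a b <= t) (td : (t%:E <= class_death a b)%E).

Lemma lives_ge0 : 0 <= t.
Proof. exact: le_trans (class_birth_ge0 _ _) bt. Qed.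
Let t0 := lives_ge0.

Lemma lives_front k : (a <= k <= b)%N -> front k t = front a t.
Proof. by apply: front_class => //; have /(class_birth_le _ C)[] := bt. Qed.

Lemma lives_footl : is_foot d (region_of a) (front a t) t.
Proof.
apply: (is_foot_left H t0); move: td; rewrite /class_death le_min => /andP[+ _].
by case: a.
Qed.

Lemma lives_footr : is_foot d (region_of b.+1) (front a t) t.
Proof.
have [ab _ _] := C.
rewrite -(@lives_front b) ?ab ?leqnn //; apply: (is_foot_right H t0).
by move: td; rewrite /class_death le_min => /andP[_].
Qed.

Local Notation yl := (foot d (region_of a) (front a t) t).
Local Notation yr := (foot d (region_of b.+1) (front a t) t).

(** The sign facts about a class come from this chain: its inner part separates the feet by the
    nodes of the first and last front, its ends compare the feet with the adjacent velocities. *)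
Lemma lives_foot_le : [/\ front a t - t * lvel d (region_of a) <= yl,
  yl <= Y a.-1, Y a.-1 <= Y b.-1, Y b.-1 <= yr &
  yr <= front a t - t * rvel d (region_of b.+1)].
Proof.
split.
- exact: (foot_lvel H t0) lives_footl.
- exact: (foot_le lives_footl).
- by apply: (posd_le H); have [ab _ _] := C; lia.
- exact: (foot_ge lives_footr).
- exact: (foot_rvel H t0) lives_footr.
Qed.

Lemma class_massE : class_mass a b t = mass_upto d yr - mass_upto d yl.
Proof.
by rewrite /class_mass (mass_foot H lives_footl) (mass_foot H lives_footr).
Qed.

Lemma class_momentumE : class_momentum a b t = impulse_upto d yr - impulse_upto d yl.
Proof.
by rewrite /class_momentum (momentum_foot H lives_footl) (momentum_foot H lives_footr).
Qed.

(** The equality of the actions at the two feet, expanded. It says that the absorbed particles,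
    moved freely up to time t, have their barycentre on the front. *)
Lemma class_balance : moment_upto d yr - moment_upto d yl =
  front a t * class_mass a b t - t * class_momentum a b t.
Proof.
have := is_foot_potential H lives_footl lives_footr.
have [c1 _] := lives_footl; have [c2 _] := lives_footr.
rewrite !(potential_cell H) // !actionE class_massE class_momentumE; lra.
Qed.

Lemma class_mass_ge0 : 0 <= class_mass a b t.
Proof.
rewrite class_massE subr_ge0; apply: (mass_le H).
by have [_ h1 h2 h3 _] := lives_foot_le; lra.
Qed.

Lemma class_mass_le : class_mass a b t <= B * (2 * M * t).
Proof.
have [h0 h1 h2 h3 h4] := lives_foot_le.
have yy : yl <= yr by lra.
rewrite class_massE; apply: le_trans (mass_lipschitz H yy) _.
apply: ler_wpM2l; first by apply: le_trans (ltW (rhod_gt0 H 0)) (rhod_le H 0).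
have : `|lvel d (region_of a)| <= M.
  by case: (region_of a) => i; exact: (veld_le H).
have : `|rvel d (region_of b.+1)| <= M.
  by case: (region_of b.+1) => i; exact: (veld_le H).
rewrite !ler_norml => /andP[g1 g2] /andP[g3 g4].
have := ler_wpM2l t0 g4; have := ler_wpM2l t0 g1; lra.
Qed.

(** Either the class joins discontinuities from different nodes, which already separate the feet, or
    it is a single initial discontinuity and the velocity jump separates them. *)
Lemma class_mass_gt0 : 0 < t -> is_shadow a b -> 0 < class_mass a b t.
Proof.
move=> tp; rewrite /is_shadow => sh.
have [h0 h1 h2 h3 h4] := lives_foot_le; have [ab _ _] := C.
rewrite class_massE subr_gt0; apply: (mass_lt H).
have [lt|] := ltnP a.-1 b.-1; first by have := posd_lt H lt; lra.
move=> ba; have : (a == b) || (a == 0%N) && (b == 1%N) by lia.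
have tl : t * rvel d (region_of b.+1) < t * lvel d (region_of a) by rewrite ltr_pM2l.
case/orP => [/eqP ab'|/andP[/eqP a0 /eqP b1]].
  by move: sh tl; rewrite -ab'; case: (a) => [|[|k]] /=; rewrite ?ltxx //; lra.
by move: sh tl; rewrite a0 b1 /=; lra.
Qed.

(** If the left velocity does not exceed the right one, the ends of the chain [lives_foot_le] are in
    reverse order, so that all its terms agree and only one node is involved. *)
Lemma class_contact : ~~ is_shadow a b ->
  [/\ is_initial a b, front a t = Y b.-1 + t * lvel d (region_of a),
     class_mass a b t = 0, class_momentum a b t = 0 &
     0 < t -> lvel d (region_of a) = rvel d (region_of b.+1)].
Proof.
rewrite /is_shadow -leNgt => sh.
have [h0 h1 h2 h3 h4] := lives_foot_le; have [ab _ _] := C.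
have tl := ler_wpM2l t0 sh.
have yy : yr = yl by lra.
split.
- rewrite /is_initial; have : ~ (a.-1 < b.-1)%N by move=> /(posd_lt H); lra.
  lia.
- lra.
- by rewrite class_massE yy subrr.
- by rewrite class_momentumE yy subrr.
- move=> tp; apply/eqP; rewrite eq_le sh /= -(ler_pM2l tp); lra.
Qed.

(** The initial barycentre of the absorbed particles lies between the feet, and by [class_balance]
    it differs from the front by t times their mean velocity. The ends of [lives_foot_le] then
    enclose this mean: the wave is overcompressive. *)
Lemma class_speed_bounds : 0 < t ->
  class_mass a b t * rvel d (region_of b.+1) <= class_momentum a b t
    <= class_mass a b t * lvel d (region_of a).
Proof.
move=> tp; have [h0 h1 h2 h3 h4] := lives_foot_le.
have yy : yl <= yr by lra.
have m0 := class_mass_ge0; have bal := class_balance.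
apply/andP; split; rewrite -(ler_pM2l tp).
- have := @comb_le _ _ _ _ _ H (-1) 0 yr yl yr yy.
  rewrite !mul0r !addr0 => h.
  have {}h : -1 * moment_upto d yl + yr * mass_upto d yl <=
      -1 * moment_upto d yr + yr * mass_upto d yr.
    by apply: h => j v _ /andP[_ hv]; rewrite mul0r; lra.
  have : class_mass a b t * yr <= class_mass a b t * (front a t - t * rvel d (region_of b.+1)).
    by apply: ler_wpM2l.
  rewrite class_massE in bal m0 *; lra.
- have := @comb_le _ _ _ _ _ H 1 0 (- yl) yl yr yy.
  rewrite !mul0r !addr0 => h.
  have {}h : 1 * moment_upto d yl + (- yl) * mass_upto d yl <=
      1 * moment_upto d yr + (- yl) * mass_upto d yr.
    by apply: h => j v _ /andP[hv _]; rewrite mul0r; lra.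
  have : class_mass a b t * (front a t - t * lvel d (region_of a)) <= class_mass a b t * yl.
    by apply: ler_wpM2l.
  rewrite class_massE in bal m0 *; lra.
Qed.

(** With a single node Y_i the equality of actions reads rho_i (Y_i - y_l)^2 = rho_{i+1} (y_r -
    Y_i)^2. Square roots make it linear in the position of the front, which explains the weights of
    [simple_speed]. *)
Lemma initial_shadowE : is_initial a b -> is_shadow a b ->
  let i := b.-1 in
  [/\ region_of a = Cst i, region_of b.+1 = Cst i.+1,
      front a t = Y i + simple_speed d i * t,
      class_mass a b t = Num.sqrt (rh i * rh i.+1) * (u i - u i.+1) * t &
      class_momentum a b t = simple_speed d i * class_mass a b t].
Proof.
move=> ini sh i.
have [ra rb] : region_of a = Cst i /\ region_of b.+1 = Cst i.+1.
  move: ini sh; rewrite /is_initial /is_shadow => /orP[/eqP ->|/andP[/eqP -> /eqP e]].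
    by rewrite /i; case: (b) => [|[|k]] //=; rewrite ltxx.
  by rewrite /i e.
have ul : u i.+1 < u i by move: sh; rewrite /is_shadow ra rb.
have mE := class_massE; have pE := class_momentumE.
have fl := lives_footl; have fr := lives_footr.
move: fl fr mE pE; rewrite ra rb.
set c := front a t => -[/= cl ml] [/= cr mr] mE pE.
have [r0 r1] := (rhod_gt0 H i, rhod_gt0 H i.+1).
have s0 : 0 < Num.sqrt (rh i) by rewrite sqrtr_gt0.
have s1 : 0 < Num.sqrt (rh i.+1) by rewrite sqrtr_gt0.
have q0 : Num.sqrt (rh i) ^+ 2 = rh i by rewrite sqr_sqrtr ?ltW.
have q1 : Num.sqrt (rh i.+1) ^+ 2 = rh i.+1 by rewrite sqr_sqrtr ?ltW.
rewrite sqrtrM ?ltW // /simple_speed.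
set p := Num.sqrt (rh i) in s0 q0 *; set q := Num.sqrt (rh i.+1) in s1 q1 *.
have eq1 : action d c t (c - t * u i) = action d c t (c - t * u i.+1).
  by apply/eqP; rewrite eq_le ml mr.
have el := action_cell H c t (cell_node H i) cl.
have er := action_cell H c t (cell_nodeS H i) cr.
have [_ yl1] : cell d i (c - t * u i) by [].
have yl2 : c - t * u i <= Y i by case: cl.
have yr2 : Y i <= c - t * u i.+1 by case: cr.
have key : p * (Y i - (c - t * u i)) = q * (c - t * u i.+1 - Y i).
  apply/eqP; rewrite -(@eqrXn2 _ 2) //; try by apply: mulr_ge0; lra.
  rewrite !exprMn q0 q1; apply/eqP.
  move: el er; rewrite -eq1 !subrr => -> /eqP; rewrite eq_sym => /eqP; rewrite !expr2 => hh.
  lra.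
have pq : p + q != 0 by apply: lt0r_neq0; lra.
have cE : c = Y i + (p * u i + q * u i.+1) / (p + q) * t.
  apply: (mulfI pq).
  have -> : (p + q) * (Y i + (p * u i + q * u i.+1) / (p + q) * t) =
    (p + q) * Y i + (p * u i + q * u i.+1) * t by field.
  lra.
have mi := prim_same_cell H (fun=> 0) rh (cell_node H i) cl.
have mi1 := prim_same_cell H (fun=> 0) rh (cell_nodeS H i) cr.
have vi := prim_same_cell H (fun=> 0) (fun j => rh j * u j) (cell_node H i) cl.
have vi1 := prim_same_cell H (fun=> 0) (fun j => rh j * u j) (cell_nodeS H i) cr.
rewrite -!/(mass_upto _ _) in mi mi1; rewrite -!/(impulse_upto _ _) in vi vi1.
have mE2 : class_mass a b t = p * q * (u i - u i.+1) * t.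
  rewrite mE (_ : _ - _ = rh i.+1 * (c - t * u i.+1 - Y i) + rh i * (Y i - (c - t * u i))); last by lra.
  by rewrite cE -q0 -q1; field.
split => //; rewrite mE2 pE.
rewrite (_ : _ - _ = rh i.+1 * u i.+1 * (c - t * u i.+1 - Y i) + rh i * u i * (Y i - (c - t * u i))); last by lra.
by rewrite cE -q0 -q1; field.
Qed.

End Lives.

Lemma class_speedE a b t : is_class a b -> class_birth a b <= t ->
  (t%:E <= class_death a b)%E -> 0 < t ->
  class_mass a b t * class_speed a b t = class_momentum a b t.
Proof.
move=> C bt td tp; have [sh|sh] := boolP (is_shadow a b); last first.
  by have [_ _ -> -> _] := class_contact C bt td sh; rewrite mul0r.
rewrite /class_speed /initial_speed sh; case: ifP => ini.
  by have [_ _ _ _ ->] := initial_shadowE C bt td ini sh; rewrite mulrC.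
rewrite mulrC divfK //; apply: lt0r_neq0; exact: class_mass_gt0 C bt td tp sh.
Qed.

(* The exact conservation law behind the shadow wave equations: the potentials
   of the two neighbouring regions are quadratic and agree along the front. *)
Lemma class_increment a b t t' : is_class a b ->
  class_birth a b <= t -> (t%:E <= class_death a b)%E ->
  class_birth a b <= t' -> (t'%:E <= class_death a b)%E ->
  (class_mass a b t + class_mass a b t') * (front a t' - front a t) =
  (class_momentum a b t + class_momentum a b t') * (t' - t).
Proof.
move=> C bt td bt' td'.
have := is_foot_potential H (lives_footl bt td) (lives_footr C bt td).
have := is_foot_potential H (lives_footl bt' td') (lives_footr C bt' td').
rewrite /class_mass /class_momentum /mass /momentum /potential !actionE => e1 e2.
lra.
Qed.

End Classes.

Lemma is_derive_near (R : realType) (f g : R -> R) (x : R) :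
  (\forall z \near x, f z - f x = g z * (z - x)) -> {for x, continuous g} ->
  is_derive x 1 f (g x).
Proof.
move=> fg cg; apply/is_derive1_caratheodory.
exists (fun z => if z == x then g x else (f z - f x) / (z - x)); split.
- move=> z; case: eqP => [->|/eqP]; first by rewrite !subrr mulr0.
  by rewrite -subr_eq0 => /divfK->.
- rewrite /prop_for /continuous_at /= eqxx; apply: cvg_trans cg; apply: near_eq_cvg.
  near=> z; case: eqP => [->//|/eqP]; rewrite -subr_eq0 => zx.
  suff -> : f z - f x = g z * (z - x) by rewrite mulfK.
  by near: z.
- by rewrite eqxx.
Unshelve. all: by end_near.
Qed.

Lemma near_lives (R : realType) (b t : R) (dd : \bar R) : b < t -> (t%:E < dd)%E ->
  \forall s \near t, b < s /\ (s%:E < dd)%E.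
Proof.
move=> bt td; apply: filterI; first exact: lt_nbhsr.
case: dd td => [x| |] //; last by move=> _; near=> s; rewrite ltry.
by rewrite lte_fin => tx; apply: filterS (lt_nbhsl tx) => s; rewrite lte_fin.
Unshelve. all: by end_near.
Qed.

(** * The shadow wave equations and the Riemann problems *)

Section Tracking.
Context {R : realType} (d : data R).
Local Notation Y := (posd d).
Local Notation u := (veld d).
Local Notation rh := (rhod d).
Local Notation front := (front d).
Local Notation merge := (merge d).
Context {M B del : R} (H : regular_data d M B del).

Lemma mass_continuous g k : continuous (fun t => mass d g (front k t) t).
Proof.
move=> t; rewrite /mass /continuous_at; apply: cvgD; first exact: cvg_cst.
apply: cvgM; first exact: cvg_cst.
apply: cvgB; last exact: cvg_cst.
apply: cvgB; first exact: (front_continuous H).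
by apply: cvgM; [exact: cvg_id|exact: cvg_cst].
Qed.

Lemma momentum_continuous g k : continuous (fun t => momentum d g (front k t) t).
Proof.
move=> t; rewrite /momentum /continuous_at; apply: cvgD; first exact: cvg_cst.
apply: cvgM; first exact: cvg_cst.
apply: cvgB; last exact: cvg_cst.
apply: cvgB; first exact: (front_continuous H).
by apply: cvgM; [exact: cvg_id|exact: cvg_cst].
Qed.

Lemma class_mass_continuous a b : continuous (class_mass d a b).
Proof. by move=> t; apply: cvgB; exact: mass_continuous. Qed.

Lemma class_momentum_continuous a b : continuous (class_momentum d a b).
Proof. by move=> t; apply: cvgB; exact: momentum_continuous. Qed.

Lemma class_birth_gt0 a b : is_class d a b -> ~~ is_initial a b -> 0 < class_birth d a b.
Proof.
move=> C; have [ab _ _] := C; rewrite /is_initial => ini.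
have kab : (a <= b.-1 < b)%N by lia.
have b1 : (0 < b.-1)%N by lia.
rewrite -lte_fin; apply: (@lt_le_trans _ _ (merge b.-1)).
  by rewrite -(prednK b1); exact: (mergeS_gt0 H).
have /(class_birth_le _ C)[_] := lexx (class_birth d a b); exact.
Qed.

Lemma class_time a b : is_class d a b ->
  exists t, [/\ 0 < t, class_birth d a b <= t & (t%:E < class_death d a b)%E].
Proof.
move=> C; have := class_birth_lt_death C; have := class_birth_ge0 d a b.
case: (class_death d a b) => [x| |] // b0.
  rewrite lte_fin => bx; exists ((class_birth d a b + x) / 2); rewrite lte_fin; split; lra.
by move=> _; exists (class_birth d a b + 1); rewrite ltry; split => //; lra.
Qed.

Lemma is_class01 : is_class d 0 1 -> u 1 <= u 0.
Proof.
move=> C; have [t [t0 bt td]] := class_time C.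
have [_ /= h1 _ h2 _] := lives_foot_le H C bt (ltW td).
by rewrite -(ler_pM2l t0); lra.
Qed.

Lemma initial_birth a b : is_class d a b -> is_initial a b -> class_birth d a b = 0.
Proof.
move=> C; rewrite /is_initial => /orP[/eqP <-|/andP[/eqP a0 /eqP b1]].
  by rewrite /class_birth big_pred0 // => k; rewrite leqNgt ltn_ord.
rewrite a0 b1 in C *.
apply/eqP; rewrite eq_le class_birth_ge0 andbT; apply/(class_birth_le _ C).
split=> // k; rewrite ltnS leqn0 => /eqP ->.
by rewrite (merge0_eq0 H) //; exact: is_class01.
Qed.

Lemma class_speed_continuous a b t : is_class d a b -> is_shadow d a b ->
  class_birth d a b <= t -> (t%:E <= class_death d a b)%E ->
  {for t, continuous (class_speed d a b)}.
Proof.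
move=> C sh bt td; have [ini|nini] := boolP (is_initial a b).
  rewrite (_ : class_speed d a b = fun=> initial_speed d a b); first exact: cvg_cst.
  by apply/funext => s; rewrite /class_speed ini.
rewrite (_ : class_speed d a b = fun s => class_momentum d a b s / class_mass d a b s);
  last by apply/funext => s; rewrite /class_speed (negbTE nini).
apply: cvgM; first exact: class_momentum_continuous.
apply: cvgV; last exact: class_mass_continuous.
have t0 : 0 < t by exact: lt_le_trans (class_birth_gt0 C nini) bt.
exact/lt0r_neq0/(class_mass_gt0 H C bt td t0 sh).
Qed.

(** A vacuum has density 0, so its fluxes may be computed with the velocity of the node in place of
    the adjacent velocity. *)
Lemma density_lvel j : density d (region_of j) * u (region_node (region_of j)) =
  density d (region_of j) * lvel d (region_of j).
Proof. by case: j => [|[|j]] //=; rewrite !mul0r. Qed.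

Lemma density_rvel j : density d (region_of j) * u (region_node (region_of j)) =
  density d (region_of j) * rvel d (region_of j).
Proof. by case: j => [|[|j]] //=; rewrite !mul0r. Qed.

(** [class_increment] divided by the sum of the masses expresses the difference quotient of the
    front as (P_t + P_s) / (m_t + m_s), which is continuous in s. A front known only to be Lipschitz
    is thereby differentiable. *)
Lemma shadow_strict a b : is_shadow d a b -> is_class d a b ->
  forall t : R, class_birth d a b < t -> (t%:E < class_death d a b)%E ->
  exists v : R -> R, [/\ {for t, continuous v}, v t = class_speed d a b t &
    \forall s \near t,
      [/\ front a s - front a t = v s * (s - t),
          class_birth d a b < s & (s%:E < class_death d a b)%E]].
Proof.
move=> sh C t bt td.
have t0 : 0 < t by exact: le_lt_trans (class_birth_ge0 _ _ _) bt.
have mt := class_mass_gt0 H C (ltW bt) (ltW td) t0 sh.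
exists (fun s => (class_momentum d a b t + class_momentum d a b s) /
  (class_mass d a b t + class_mass d a b s)); split.
- apply: cvgM.
    by apply: cvgD; [exact: cvg_cst|exact: class_momentum_continuous].
  apply: cvgV; first by apply: lt0r_neq0; lra.
  by apply: cvgD; [exact: cvg_cst|exact: class_mass_continuous].
- have e := class_speedE H C (ltW bt) (ltW td) t0.
  rewrite -e; field; apply: lt0r_neq0; lra.
- near=> s.
  have [bs sd] : class_birth d a b < s /\ (s%:E < class_death d a b)%E.
    by near: s; exact: near_lives.
  split => //.
  have ms := class_mass_ge0 H C (ltW bs) (ltW sd).
  have m0 : class_mass d a b t + class_mass d a b s != 0 by apply: lt0r_neq0; lra.
  apply: (mulfI m0); rewrite (class_increment H C (ltW bt) (ltW td) (ltW bs) (ltW sd)).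
  by rewrite mulrA [_ * (_ / _)]mulrC divfK.
Unshelve. all: by end_near.
Qed.

(** Mass and momentum are affine in position and time, so their difference quotients are affine in
    that of the front, and the right sides of the equations are the limits. *)
Lemma class_wave_shadow_wave e a b : is_class d a b -> is_shadow d a b ->
  shadow_wave d (class_wave d e a b).
Proof.
move=> C sh; split.
- by apply: continuous_subspaceT; exact: (front_continuous H).
- apply: continuous_in_subspaceT => t; rewrite inE => -[/= bt td].
  exact: class_speed_continuous.
- rewrite /= /class_strength sh.
  by apply: continuous_subspaceT; exact: class_mass_continuous.
move=> t /= bt td; have [v [cv vt nv]] := shadow_strict sh C bt td.
have t0 : 0 < t by exact: le_lt_trans (class_birth_ge0 _ _ _) bt.
split.
- rewrite -vt; apply: (is_derive_near (g := v)) => //.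
  by near=> s; have [] : [/\ front a s - front a t = v s * (s - t),
          class_birth d a b < s & (s%:E < class_death d a b)%E] by near: s.
- rewrite /= /class_strength sh -vt.
  pose g s := (density d (region_of b.+1) - density d (region_of a)) * v s
    - (density d (region_of b.+1) * rvel d (region_of b.+1)
       - density d (region_of a) * lvel d (region_of a)).
  apply: (is_derive_near (g := g)).
    near=> s; have [e1 _ _] : [/\ front a s - front a t = v s * (s - t),
          class_birth d a b < s & (s%:E < class_death d a b)%E] by near: s.
    rewrite /g /class_mass /mass -density_rvel -density_lvel.
    have -> : front a s = front a t + v s * (s - t) by rewrite -e1; ring.
    ring.
  apply: cvgB; last exact: cvg_cst.
  by apply: cvgM => //; exact: cvg_cst.
- rewrite /= -vt.
  pose g s := (density d (region_of b.+1) * rvel d (region_of b.+1)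
       - density d (region_of a) * lvel d (region_of a)) * v s
    - (density d (region_of b.+1) * rvel d (region_of b.+1) ^+ 2
       - density d (region_of a) * lvel d (region_of a) ^+ 2).
  have er : density d (region_of b.+1) * rvel d (region_of b.+1) ^+ 2 =
     density d (region_of b.+1) * u (region_node (region_of b.+1)) ^+ 2.
    by rewrite !expr2 !mulrA -!density_rvel mulrAC -density_rvel mulrAC.
  have el : density d (region_of a) * lvel d (region_of a) ^+ 2 =
     density d (region_of a) * u (region_node (region_of a)) ^+ 2.
    by rewrite !expr2 !mulrA -!density_lvel mulrAC -density_lvel mulrAC.
  have E s : class_birth d a b < s -> (s%:E < class_death d a b)%E ->
      class_strength d a b s * class_speed d a b s = class_momentum d a b s.
    move=> bs sd; rewrite /class_strength sh.
    apply: (class_speedE H C (ltW bs) (ltW sd)).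
    exact: le_lt_trans (class_birth_ge0 _ _ _) bs.
  apply: (is_derive_near (g := g)).
    near=> s; have [e1 bs sd] : [/\ front a s - front a t = v s * (s - t),
          class_birth d a b < s & (s%:E < class_death d a b)%E] by near: s.
    rewrite !E //.
    rewrite /g /class_momentum /momentum -density_rvel -density_lvel er el.
    have -> : front a s = front a t + v s * (s - t) by rewrite -e1; ring.
    ring.
  apply: cvgB; last exact: cvg_cst.
  by apply: cvgM => //; exact: cvg_cst.
Unshelve. all: by end_near.
Qed.

Lemma contact_wave e a b : is_class d a b -> is_initial a b -> ~~ is_shadow d a b ->
  initial_contact d b.-1 (region_of a) (region_of b.+1) (lvel d (region_of a))
    (class_wave d e a b).
Proof.
move=> C ini sh; split => //=; first exact/negbTE.
  exact: initial_birth.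
move=> t [/= bt td]; have [_ -> _ _ _] := class_contact H C bt td sh.
rewrite /class_strength (negbTE sh) /class_speed ini /initial_speed (negbTE sh).
by split => //; rewrite mulrC.
Qed.

Lemma initial_shadow_wave e a b : is_class d a b -> is_initial a b -> is_shadow d a b ->
  initial_shadow d b.-1 (class_wave d e a b).
Proof.
move=> C ini sh; have [t [t0 bt td]] := class_time C.
have [ra rb _ _ _] := initial_shadowE H C bt (ltW td) ini sh.
split; split => //=; first exact: initial_birth.
  by rewrite /class_xeps ini.
move=> {t t0 bt td} t [/= bt td].
have [_ _ -> cm _] := initial_shadowE H C bt td ini sh.
by rewrite /class_strength sh /class_speed ini /initial_speed sh cm.
Qed.

Lemma is_class_vac0 : u 0 < u 1 -> is_class d 0 0.
Proof.
move=> uu; split; [by []| |by move=> k /andP[_]; rewrite ltn0].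
by rewrite /class_death /= lt_min ltry (merge0_gt0 H).
Qed.

Lemma is_class_vac1 : u 0 < u 1 -> is_class d 1 1.
Proof.
move=> uu; split; [by []| |by move=> k /andP[k1 k2]; lia].
by rewrite /class_death /= lt_min (merge0_gt0 H uu) (mergeS_gt0 H).
Qed.

Lemma is_class_01 : u 1 <= u 0 -> is_class d 0 1.
Proof.
move=> uu.
have h : (0 < class_death d 0 1)%E by rewrite /class_death lt_min ltry (mergeS_gt0 H).
by split => // k /andP[_]; rewrite ltnS leqn0 => /eqP ->; rewrite (merge0_eq0 H).
Qed.

Lemma is_class_single k : is_class d k.+2 k.+2.
Proof.
split; [by []| |by move=> l /andP[k1 k2]; lia].
by rewrite /class_death /= lt_min !(mergeS_gt0 H).
Qed.

Lemma class_waves_riemann_solved e i : riemann_solved d (class_waves d e) i.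
Proof.
have W a b : is_class d a b -> class_waves d e (class_wave d e a b) by exists a, b.
case: i => [|i]; split.
- move=> uu; have C : is_class d 0 1 by apply: is_class_01; rewrite uu.
  exists (class_wave d e 0 1); first exact: W.
  by apply: (contact_wave e C) => //; rewrite /is_shadow /= uu ltxx.
- move=> uu; split.
    exists (class_wave d e 0 0); first exact/W/is_class_vac0.
    by apply: (contact_wave e (is_class_vac0 uu)) => //; rewrite /is_shadow /= ltxx.
  exists (class_wave d e 1 1); first exact/W/is_class_vac1.
  by apply: (contact_wave e (is_class_vac1 uu)) => //; rewrite /is_shadow /= ltxx.
- move=> uu; have C : is_class d 0 1 by apply: is_class_01; exact: ltW.
  exists (class_wave d e 0 1); first exact: W.
  exact: (initial_shadow_wave e C).
- move=> uu; have C := is_class_single i.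
  exists (class_wave d e i.+2 i.+2); first exact: W.
  have ini : is_initial i.+2 i.+2 by rewrite /is_initial eqxx.
  by apply: (contact_wave e C ini); rewrite /is_shadow /= uu ltxx.
- by rewrite ltNge (veld_decr H).
- move=> uu; have C := is_class_single i.
  exists (class_wave d e i.+2 i.+2); first exact: W.
  have ini : is_initial i.+2 i.+2 by rewrite /is_initial eqxx.
  exact: (initial_shadow_wave e C ini).
Qed.

Lemma class_wave_riemann e a b : is_class d a b -> is_initial a b ->
  riemann_wave d b.-1 (class_wave d e a b).
Proof.
move=> C ini; move: (ini); rewrite /is_initial.
move=> /orP[/eqP E|/andP[/eqP E1 /eqP E2]].
  rewrite -{}E in C ini *; case: a C ini => [|[|k]] C ini.
  - have uu : u 0 < u 1.
      rewrite ltNge; apply/negP => /(merge0_eq0 H) m0.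
      by have [_ + _] := C; rewrite /class_death lt_min m0 ltxx andbF.
    apply: Or42; split => //.
    by apply: (contact_wave e C) => //; rewrite /is_shadow /= ltxx.
  - have uu : u 0 < u 1.
      rewrite ltNge; apply/negP => /(merge0_eq0 H) m0.
      by have [_ + _] := C; rewrite /class_death lt_min /= m0 ltxx.
    apply: Or43; split => //.
    by apply: (contact_wave e C) => //; rewrite /is_shadow /= ltxx.
  - have [sh|sh] := boolP (is_shadow d k.+2 k.+2).
      by apply: Or44; split; [exact: sh|exact: initial_shadow_wave].
    apply: Or41; split; last exact: (contact_wave e C).
    apply/eqP; rewrite eq_le (veld_decr H) andbT.
    by move: sh; rewrite /is_shadow /= -leNgt.
rewrite E1 E2 in C ini *.
have [sh|sh] := boolP (is_shadow d 0 1).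
  by apply: Or44; split; [exact: sh|exact: initial_shadow_wave].
apply: Or41; split; last exact: (contact_wave e C).
apply/eqP; rewrite eq_le (is_class01 C) andbT.
by move: sh; rewrite /is_shadow /= -leNgt.
Qed.

Lemma not_initial_shadow a b : is_class d a b -> ~~ is_initial a b -> is_shadow d a b.
Proof.
move=> C; apply: contraNT => sh; have [t [t0 bt td]] := class_time C.
by have [] := class_contact H C bt (ltW td) sh.
Qed.

Lemma class_strengthE a b t : is_class d a b -> class_birth d a b <= t ->
  (t%:E <= class_death d a b)%E -> class_strength d a b t = class_mass d a b t.
Proof.
move=> C bt td; rewrite /class_strength; case: ifPn => // sh.
by have [_ _ ->] := class_contact H C bt td sh.
Qed.

Lemma class_width_gt0 e a b t : 0 < e -> is_class d a b -> class_birth d a b <= t ->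
  0 < t -> 0 < class_width d e a b t.
Proof.
move=> e0 C bt t0; rewrite /class_width /class_xeps.
have [ini|ini] := boolP (is_initial a b).
  by rewrite (initial_birth C ini) subr0 mulr0 addr0 mulr_gt0.
have : 0 <= e * (t - class_birth d a b) by rewrite mulr_ge0 ?subr_ge0 // ltW.
lra.
Qed.

Lemma class_strip_mass e a b t : 0 < e -> is_class d a b -> class_birth d a b <= t ->
  (t%:E <= class_death d a b)%E ->
  strip_mass e (class_wave d e a b) t = class_strength d a b t.
Proof.
move=> e0 C bt td; rewrite /strip_mass /=; case: ifPn => sh; last first.
  by rewrite /class_strength (negbTE sh).
rewrite -/(class_width d e a b t) mulrC.
have := lives_ge0 bt; rewrite le_eqVlt => /predU1P[t0|t0]; last first.
  by rewrite divfK // lt0r_neq0 // class_width_gt0.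
(* At t = 0 the width may vanish and the quotient takes its default value. The strength vanishes
   there, so both sides are 0. *)
suff -> : class_strength d a b t = 0 by rewrite !mul0r.
rewrite class_strengthE //; apply/eqP; rewrite eq_le (class_mass_ge0 H) // andbT.
by have := class_mass_le H C bt td; rewrite -t0 !mulr0.
Qed.

End Tracking.

(** * Interactions and admissibility *)

Section Interactions.
Context {R : realType} (d : data R).
Local Notation Y := (posd d).
Local Notation u := (veld d).
Local Notation front := (front d).
Local Notation merge := (merge d).
Context {M B del : R} (H : regular_data d M B del).

Lemma region_of_inj : injective region_of.
Proof. by move=> [|[|i]] [|[|j]] //= [->]. Qed.

Section Interaction.
Context (a b : nat) (C : is_class d a b).
Hypothesis b0 : 0 < class_birth d a b.
Let T := class_birth d a b.

(** The first fronts of the incoming classes: besides a, these are the fronts that meet their left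
    neighbour exactly at the birth time T of the new class. *)
Definition leaders : seq nat :=
  [seq k <- iota a (b - a).+1 | (k == a) || (merge k.-1 == T%:E)].

(** The default b+1 acts as a leader after the last one, so that the i-th incoming class always ends
    just before [leader i.+1]. *)
Definition leader (i : nat) : nat := nth b.+1 leaders i.

Let class_at : is_class_at d a b T.
Proof.
apply/(is_class_atP d _ _ (ltW b0)); split => //; exact: class_birth_lt_death.
Qed.

Let merge_leT k : (a <= k < b)%N -> (merge k <= T%:E)%E.
Proof. by have /(class_birth_le _ C)[_] := lexx T; exact. Qed.

Lemma mem_leaders k : k \in leaders =
  [&& (a <= k)%N, (k <= b)%N & (k == a) || (merge k.-1 == T%:E)].
Proof.
have [ab _ _] := C.
rewrite mem_filter mem_iota addnS ltnS subnKC // andbC -andbA; congr andb.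
Qed.

Lemma leaders_sorted : sorted ltn leaders.
Proof. by apply: sorted_filter; [exact: ltn_trans|exact: iota_ltn_sorted]. Qed.

Lemma leader_mem i : (i < size leaders)%N -> leader i \in leaders.
Proof. exact: mem_nth. Qed.

Lemma leader_size : leader (size leaders) = b.+1.
Proof. by rewrite /leader nth_default. Qed.

Lemma leader_lt i j : (i < j <= size leaders)%N -> (leader i < leader j)%N.
Proof.
move=> /andP[ij]; rewrite leq_eqVlt => /predU1P[js|js].
  rewrite js leader_size ltnS.
  have /leader_mem : (i < size leaders)%N by rewrite -js.
  by rewrite mem_leaders => /and3P[].
have := leaders_sorted; rewrite ltn_sorted_uniq_leq => /andP[un srt].
have := sorted_ltn_nth ltn_trans b.+1 leaders_sorted i j.
by rewrite !inE => /(_ (ltn_trans ij js) js ij).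
Qed.

Lemma leader_inj i j : (i <= size leaders)%N -> (j <= size leaders)%N ->
  leader i = leader j -> i = j.
Proof.
move=> si sj e; have [lt|lt|//] := ltngtP i j.
- by have := @leader_lt i j; rewrite lt sj e ltnn => /(_ isT).
- by have := @leader_lt j i; rewrite lt si e ltnn => /(_ isT).
Qed.

Lemma leader_between i k : (i < size leaders)%N ->
  (leader i < k < leader i.+1)%N -> (merge k.-1 < T%:E)%E.
Proof.
move=> si /andP[k1 k2].
have := leader_mem si; rewrite mem_leaders => /and3P[ai ib _].
have kb : (k <= b)%N.
  rewrite -ltnS; apply: leq_trans k2 _; rewrite -leader_size.
  have [lt|ge] := ltnP i.+1 (size leaders); first by apply/ltnW/leader_lt; rewrite lt /=.
  by rewrite (_ : i.+1 = size leaders) //; lia.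
have : k \notin leaders.
  apply/negP => kl; have := nth_index b.+1 kl.
  rewrite -/(leader _) => e; have := kl; rewrite -index_mem => sk.
  have ki : (i < index k leaders)%N.
    rewrite ltnNge; apply/negP => le; move: k1; rewrite -e ltnNge.
    move: le; rewrite leq_eqVlt => /predU1P[->|lt]; first by rewrite leqnn.
    by rewrite ltnW // leader_lt // lt ltnW.
  have : (leader i.+1 <= k)%N.
    rewrite -e; move: ki; rewrite leq_eqVlt => /predU1P[->//|lt].
    by apply/ltnW/leader_lt; rewrite lt ltnW.
  by rewrite leqNgt k2.
rewrite mem_leaders kb (_ : a <= k)%N /=; last by lia.
rewrite negb_or => /andP[ka kT].
by rewrite lt_neqAle kT merge_leT //; lia.
Qed.

Lemma leader0 : leader 0 = a.
Proof. by rewrite /leader /leaders /= eqxx. Qed.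

Lemma size_leaders_gt1 : (1 < size leaders)%N.
Proof.
have [k [kab kT]] : exists k, (a <= k < b)%N /\ merge k = T%:E.
  apply: contrapT => nex; have : class_birth d a b < T; last by rewrite ltxx.
  apply/bigmax_ltP; split=> // k ak; have kab : (a <= k < b)%N by rewrite ak ltn_ord.
  rewrite -lte_fin (fineK (is_class_fin C kab)) lt_neqAle merge_leT // andbT.
  by apply/eqP => e; apply: nex; exists k.
have aL : a \in leaders by rewrite mem_leaders eqxx leqnn; case: C => ->.
have kL : k.+1 \in leaders by rewrite mem_leaders /= kT eqxx orbT; lia.
have : (size [:: a; k.+1] <= size leaders)%N; last exact.
by apply: uniq_leq_size => [|x]; rewrite /= !inE; [lia|move=> /orP[] /eqP ->].
Qed.

Lemma leader_pred_le i : (i < size leaders)%N -> (leader i <= (leader i.+1).-1)%N.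
Proof. by move=> si; have := @leader_lt i i.+1; rewrite ltnSn si => /(_ isT); lia. Qed.

(** The first incoming class is stopped at T on its right, by the second leader, and every later one
    on its left, by its own leader. On the other side nothing merges before T. *)
Lemma leader_death i : (i < size leaders)%N ->
  class_death d (leader i) (leader i.+1).-1 = T%:E.
Proof.
move=> si; have [_ _] := class_at; rewrite /class_death lt_min => /andP[ta tb].
have := leader_mem si; rewrite mem_leaders => /and3P[ai ib il].
have h1 : (T%:E <= merge_before d (leader i))%E.
  case/orP: il => [/eqP ->|]; first exact: ltW.
  case: (leader i) => [|k] /=; first by rewrite leey.
  by move=> /eqP ->.
have h2 : (T%:E <= merge (leader i.+1).-1)%E.
  have [lt|ge] := ltnP i.+1 (size leaders); last first.
    by rewrite (_ : i.+1 = size leaders) ?leader_size /= ?ltW //; lia.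
  have := leader_mem lt; rewrite mem_leaders => /and3P[ai1 ib1 /orP[/eqP e|/eqP -> //]].
  by have := @leader_lt i i.+1; rewrite ltnSn si e => /(_ isT); lia.
case: i si ai ib il h1 h2 => [|i] si ai ib il h1 h2.
  have lt := size_leaders_gt1.
  have := leader_mem lt; rewrite mem_leaders => /and3P[ai1 ib1 /orP[/eqP e|/eqP ->]].
    by have := @leader_lt 0 1; rewrite si e leader0 ltnn => /(_ isT).
  exact: min_r.
have al : (a < leader i.+1)%N by rewrite -leader0; apply: leader_lt; rewrite /= ltnW.
have mE : merge_before d (leader i.+1) = T%:E.
  case/orP: il => [/eqP e|]; first by rewrite e ltnn in al.
  by case: (leader i.+1) al => //= k _ /eqP.
by rewrite mE min_l.
Qed.

Lemma leader_class i : (i < size leaders)%N ->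
  is_class d (leader i) (leader i.+1).-1.
Proof.
move=> si; split; first exact: leader_pred_le.
  by rewrite leader_death // lte_fin.
move=> k kl; rewrite leader_death //.
by apply: (@leader_between i k.+1) => //; lia.
Qed.

Lemma leader_birth i : (i < size leaders)%N ->
  class_birth d (leader i) (leader i.+1).-1 <= T.
Proof.
by move=> si; have := class_birth_lt_death (leader_class si); rewrite leader_death // lte_fin => /ltW.
Qed.

Lemma leader_front i : (i < size leaders)%N -> front (leader i) T = front a T.
Proof.
move=> si; have := leader_mem si; rewrite mem_leaders => /and3P[ai ib _].
by apply: (front_class H (ltW b0) merge_leT); rewrite ai.
Qed.

(** All incoming waves are at [front a T], so their jumps of mass and momentum telescope from region
    a to region b+1. Strip masses equal strengths, which yields the continuity of mass. *)
Lemma class_wave_interaction e : 0 < e -> interaction_wave e (class_waves d e) (class_wave d e a b).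
Proof.
move=> e0.
have nini : ~~ is_initial a b.
  by apply/negP => ini; move: b0; rewrite (initial_birth H C ini) ltxx.
have sh := not_initial_shadow H C nini.
split; first exact: sh.
exists (size leaders), (fun i => class_wave d e (leader i) (leader i.+1).-1).
have lS i : (i < size leaders)%N -> (leader i.+1).-1.+1 = leader i.+1.
  by move=> si; rewrite prednK //; have := @leader_lt i i.+1; rewrite ltnSn si => /(_ isT); lia.
have Td : (T%:E <= class_death d a b)%E by apply/ltW/class_birth_lt_death.
split; split.
- exact: size_leaders_gt1.
- move=> i j; rewrite !inE /= => si sj /(congr1 (@lreg R)) /= /region_of_inj ll.
  by apply: leader_inj => //; exact: ltnW.
- rewrite eqEsubset; split=> [_ [i /= si <-]|v [[c [d0 [Cc ->]]] /= dT fe]].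
    split; first by exists (leader i), (leader i.+1).-1; split=> //; exact: leader_class.
      by rewrite /= leader_death.
    by rewrite /= leader_front.
  have cab : (a <= c <= b)%N by exact: (is_class_at_front H b0 class_at fe).
  have [cd0 _ hm] := Cc.
  have bc : class_birth d c d0 <= T.
    by have := class_birth_lt_death Cc; rewrite dT lte_fin => /ltW.
  have mT : (T%:E <= merge_before d c)%E /\ (T%:E <= merge d0)%E.
    by split; rewrite -/T -dT /class_death ge_min lexx ?orbT.
  have cL : c \in leaders.
    move/andP: cab => [ac cb].
    rewrite mem_leaders ac cb /=; have [//|ca] := eqVneq c a.
    case: c ac cb ca mT {fe Cc cd0 hm bc dT} => [|c] ac cb ca [mT _]; first lia.
    by rewrite /= eq_le merge_leT //; lia.
  exists (index c leaders); first by rewrite /= index_mem.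
  have si : (index c leaders < size leaders)%N by rewrite index_mem.
  have ec : leader (index c leaders) = c by exact: nth_index.
  rewrite ec; congr class_wave.
  set i := index c leaders in si ec *.
  have d0ab : (a <= d0 <= b)%N.
    apply: (is_class_at_front H b0 class_at); rewrite -fe.
    by apply: (lives_front H Cc bc); rewrite cd0 leqnn.
  (* If the incoming class ended before the next leader, its right merge would precede T. If it
     ended later, it would contain a merge at T, its own death time. *)
  have [lt|lt|e1] := ltngtP d0.+1 (leader i.+1); last by rewrite -e1.
    have := @leader_between i d0.+1 si; rewrite ec ltnS cd0 lt => /(_ isT) /=.
    by rewrite ltNge; case: mT => _ ->.
  have i1 : (i.+1 < size leaders)%N.
    rewrite ltn_neqAle si andbT; apply/eqP => e1; move: lt; rewrite e1 leader_size; lia.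
  have := leader_mem i1; rewrite mem_leaders => /and3P[ai1 ib1 /orP[/eqP e1|/eqP e1]].
    by have := @leader_lt i i.+1; rewrite ltnSn si e1 ec => /(_ isT); lia.
  have := hm (leader i.+1).-1; rewrite dT e1 ltxx => hF.
  suff : false by []; apply: hF.
  by have := @leader_lt i i.+1; rewrite ltnSn si ec => /(_ isT); lia.
- move=> k ks; change (region_of (leader k.+1).-1.+1 = region_of (leader k.+1)).
  by rewrite lS // ltnW.
- by rewrite /= leader0.
- change (region_of b.+1 = region_of (leader (size leaders).-1.+1).-1.+1).
  by rewrite (_ : (size leaders).-1.+1 = size leaders) ?leader_size //; have := size_leaders_gt1; lia.
- rewrite /= (class_strengthE H) //.
  rewrite (eq_bigr (fun k : 'I_(size leaders) =>
     mass d (region_of (leader k.+1)) (front a T) T - mass d (region_of (leader k)) (front a T) T)).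
    rewrite -(big_mkord xpredT (fun k => mass d (region_of (leader k.+1)) (front a T) T
       - mass d (region_of (leader k)) (front a T) T)).
    by rewrite (telescope_sumr (fun k => mass d (region_of (leader k)) (front a T) T)) // leader0 leader_size.
  move=> k _; rewrite (class_strengthE H (leader_class _) (leader_birth _)) ?leader_death //.
  by rewrite /class_mass lS // leader_front.
- rewrite /= (class_strengthE H) // (class_speedE H C (lexx _) Td b0).
  rewrite (eq_bigr (fun k : 'I_(size leaders) =>
     momentum d (region_of (leader k.+1)) (front a T) T - momentum d (region_of (leader k)) (front a T) T)).
    rewrite -(big_mkord xpredT (fun k => momentum d (region_of (leader k.+1)) (front a T) T
       - momentum d (region_of (leader k)) (front a T) T)).
    by rewrite (telescope_sumr (fun k => momentum d (region_of (leader k)) (front a T) T)) // leader0 leader_size.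
  move=> k _; rewrite (class_strengthE H (leader_class _) (leader_birth _)) ?leader_death //.
  rewrite (class_speedE H (leader_class _) (leader_birth _)) ?leader_death //.
  by rewrite /class_momentum lS // leader_front.
- rewrite (class_strip_mass H e0 C (lexx _) Td).
  under eq_bigr => k _.
    rewrite (class_strip_mass H e0 (leader_class _) (leader_birth _)) ?leader_death //.
    over.
  rewrite /= (class_strengthE H) //.
  rewrite (eq_bigr (fun k : 'I_(size leaders) =>
     mass d (region_of (leader k.+1)) (front a T) T - mass d (region_of (leader k)) (front a T) T)).
    rewrite -(big_mkord xpredT (fun k => mass d (region_of (leader k.+1)) (front a T) T
       - mass d (region_of (leader k)) (front a T) T)).
    by rewrite (telescope_sumr (fun k => mass d (region_of (leader k)) (front a T) T)) // leader0 leader_size.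
  move=> k _; rewrite (class_strengthE H (leader_class _) (leader_birth _)) ?leader_death //.
  by rewrite /class_mass lS // leader_front.
Qed.

End Interaction.

(** The merge at T that ends the class is interior to the class containing front a at time T, whose
    birth is therefore exactly T. *)
Lemma class_death_next a b T : is_class d a b -> class_death d a b = T%:E ->
  exists a' b', [/\ is_class d a' b', class_birth d a' b' = T & front a' T = front a T].
Proof.
move=> C dT; have [ab d0 hm] := C.
have T0 : 0 < T by rewrite -lte_fin -dT.
have [a' [b' [C' aab]]] := exists_class_at H a (ltW T0).
have [C1 b1 d1] := (is_class_atP d _ _ (ltW T0)).1 C'.
exists a', b'; split=> //; last by rewrite (lives_front H C1 b1 aab).
have bT : class_birth d a b <= T.
  by have := class_birth_lt_death C; rewrite dT lte_fin => /ltW.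
have bab : (a' <= b <= b')%N.
  apply: (is_class_at_front H T0 C').
  by rewrite (lives_front H C bT) ?ab ?leqnn // (lives_front H C1 b1 aab).
apply/eqP; rewrite eq_le b1 /=.
have /(class_birth_le _ C1)[_ hb] := lexx (class_birth d a' b').
rewrite -lee_fin -dT; move: d1; rewrite /class_death lt_min => /andP[da db].
have := dT; rewrite /class_death /Order.min; case: ifP => _ e.
- case: a e aab {C dT hm bT ab d0} => // a e aab.
  apply: hb; apply/andP; split; last lia.
  rewrite leqNgt; apply/negP => lt.
  have ea : a' = a.+1 by lia.
  by move: da; rewrite ea e ltxx.
- rewrite e -e; apply: hb; apply/andP; split; first by case/andP: bab.
  rewrite ltn_neqAle; case/andP: bab => _ ->; rewrite andbT.
  by apply/eqP => bb; move: db; rewrite -bb e ltxx.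
Qed.

Lemma class_waves_tracking e : 0 < e -> tracking_waves e d (class_waves d e).
Proof.
move=> e0; split.
- move=> _ [a [b [C ->]]]; split => /=; first exact: class_birth_ge0.
    exact: class_birth_lt_death.
  by move=> sh; exact: (class_wave_shadow_wave H e C sh).
- split=> [i|_ [a [b [C ->]]] /= b0]; first exact: (class_waves_riemann_solved H).
  exists b.-1; apply: (class_wave_riemann H _ C); apply: contraT => ini.
  by have := class_birth_gt0 H C ini; rewrite b0 ltxx.
- by move=> _ [a [b [C ->]]] /= b0; exact: class_wave_interaction.
- move=> _ T [a [b [C ->]]] /= dT.
  have [a' [b' [C' bT fT]]] := class_death_next C dT.
  by exists (class_wave d e a' b'); split => //; exists a', b'.
- move=> _ _ t [a [b [C ->]]] [a' [b' [C' ->]]] t0 /= [bt td] [bt' td'] fe.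
  have A : is_class_at d a b t by apply/(is_class_atP d _ _ (ltW t0)).
  have A' : is_class_at d a' b' t by apply/(is_class_atP d _ _ (ltW t0)).
  have [ab _ _] := C; have [ab' _ _] := C'.
  have h := is_class_at_front H t0 A (esym fe).
  have h' : (a' <= a' <= b')%N by rewrite leqnn.
  by have [-> ->] := is_class_at_unique A A' h h'.
Qed.

Lemma class_waves_admissible e : admissible d (class_waves d e).
Proof.
move=> _ [a [b [C ->]]] /= sh t [/= bt td].
have pos s : class_birth d a b <= s -> (s%:E <= class_death d a b)%E -> 0 < s ->
    rvel d (region_of b.+1) <= class_speed d a b s <= lvel d (region_of a).
  move=> bs sd s0; have m0 := class_mass_gt0 H C bs sd s0 sh.
  have := class_speed_bounds H C bs sd s0.
  by rewrite -(class_speedE H C bs sd s0) !ler_pM2l.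
(* A class alive at t = 0 is initial and has constant speed, so any later time s of its life gives
   the bounds. *)
have := lives_ge0 bt; rewrite le_eqVlt => /predU1P[t0|]; last exact: pos.
have [s [s0 bs sd]] := class_time C.
have ini : is_initial a b.
  by apply: contraT => /(class_birth_gt0 H C); rewrite ltNge t0 bt.
by have := pos s bs (ltW sd) s0; rewrite /class_speed ini.
Qed.

End Interactions.

Lemma class_waves_asymptotics (R : realType) (D : R -> data R) (M B : R)
    (del : R -> R) :
  (forall e, 0 < e -> regular_data (D e) M B (del e)) ->
  shadow_asymptotics (fun e => class_waves (D e) e).
Proof.
move=> H; exists 1 => // K eta eta0.
near=> e; have e0 : 0 < e by near: e; exact: nbhs_right_gt.
move=> _ [a [b [C ->]]] sh t [/= bt td] _ _.
split.
- move=> b0; rewrite /= /class_xeps; case: ifPn => [ini|_].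
    by move: b0; rewrite (initial_birth (H e e0) C ini) ltxx.
  by rewrite divff ?lt0r_neq0 // subrr normr0 ltW.
- by rewrite subrr normr0 ltW.
- rewrite (class_strip_mass (H e e0) e0 C bt td) subrr normr0 mulr_ge0 //; first exact: ltW.
  rewrite (class_strengthE (H e e0) C bt td); exact: (class_mass_ge0 (H e e0) C bt td).
Unshelve. all: by end_near.
Qed.

(** * The approximate solution *)

Section Representation.
Context {R : realType} (d : data R) (M B del : R).
Local Notation Y := (posd d).
Local Notation u := (veld d).
Local Notation front := (front d).
Local Notation merge := (merge d).

(** From this index on the fronts are right of X at time t, because Y_i >= Y_0 + i del and speeds
    are at most M. One unit of the 2 is the rounding, the other the shift between front i+1 and node
    Y_i. *)
Definition front_bound_index (X t : R) : nat :=
  (Num.truncn ((X + M * t - Y 0) / del)).+2.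

Definition in_class_strip (e : R) (a b : nat) (x t : R) : Prop :=
  [/\ is_shadow d a b, is_class_at d a b t &
      `|x - front a t| < class_width d e a b t / 2].

Definition strip_sum (N : nat) (F : nat -> nat -> R -> R) (e x t : R) : R :=
  \sum_(a < N) \sum_(b < N) (if `[< in_class_strip e a b x t >] then F a b t else 0).

Definition class_density (e : R) (a b : nat) (t : R) : R :=
  class_mass d a b t / class_width d e a b t.

(** A strip containing x has its front within e (t + 1) of x, so the sums cut off at this index miss
    no strip. *)
Definition strip_index (e x t : R) : nat := front_bound_index (`|x| + e * (t + 1)) t.

Definition in_some_strip (e x t : R) : Prop := exists a b, in_class_strip e a b x t.

Definition region_index (x t : R) : nat :=
  xget 0%N [set k | x <= front k t /\ forall j, (j < k)%N -> front j t < x].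

Definition vacuum_velocity_at (i : nat) (p : R * R) : R :=
  u 0 + (u 1 - u 0) * ((p.1 - front 0 p.2) / (front 1 p.2 - front 0 p.2)).

Definition rho_approx (e x t : R) : R :=
  if `[< in_some_strip e x t >] then strip_sum (strip_index e x t) (class_density e) e x t
  else density d (region_of (region_index x t)).

Definition u_approx (e x t : R) : R :=
  if `[< in_some_strip e x t >] then
    strip_sum (strip_index e x t) (fun a b t => class_density e a b t * class_speed d a b t) e x t
    / strip_sum (strip_index e x t) (class_density e) e x t
  else velocity d vacuum_velocity_at (region_of (region_index x t)) x t.

Context (H : regular_data d M B del).

Lemma front_bound_indexP X t k : 0 <= t -> (front_bound_index X t <= k)%N -> X < front k t.
Proof.
move=> t0; case: k => // k; rewrite /front_bound_index ltnS => kn.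
have := front_bound H k.+1 t0; rewrite ler_distl /= => /andP[h _].
apply: lt_le_trans h.
have d0 := gap_gt0 H.
have := truncnS_gt ((X + M * t - Y 0) / del).
rewrite ltr_pdivrMr // => h1; have h2 := posd_ge H k.
have : (Num.truncn ((X + M * t - Y 0) / del)).+1%:R * del <= k%:R * del.
  by rewrite ler_pM2r // ler_nat.
lra.
Qed.

Lemma region_indexP x t : 0 <= t -> x <= front (region_index x t) t /\
  forall j, (j < region_index x t)%N -> front j t < x.
Proof.
move=> t0; rewrite /region_index; case: xgetP => [j -> //|/= nex]; exfalso.
have ex : exists j, x <= front j t.
  by exists (front_bound_index x t); apply/ltW/front_bound_indexP.
case: (ex_minnP ex) => j yj jmin.
apply: (nex j); split => // i ij; rewrite ltNge; apply/negP => /jmin.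
by rewrite leqNgt ij.
Qed.

Lemma class_width_le e a b t : 0 < e -> class_width d e a b t <= e * (t + 2).
Proof.
move=> e0; rewrite /class_width; have b0 := class_birth_ge0 d a b.
have : class_xeps e a b <= e by rewrite /class_xeps; case: ifP => // _; exact: ltW.
have : e * (t - class_birth d a b) <= e * t by rewrite ler_pM2l //; lra.
lra.
Qed.

Lemma in_class_stripP e a b x t : 0 < e -> 0 <= t -> in_class_strip e a b x t ->
  [/\ is_class d a b, class_birth d a b <= t, (t%:E < class_death d a b)%E,
      is_shadow d a b & 0 < t /\ `|x - front a t| < e * (t + 1)].
Proof.
move=> e0 t0 [sh /(is_class_atP d _ _ t0)[C bt td] xt].
split=> //; split; last first.
  apply: lt_le_trans xt _.
  by have := class_width_le a b t e0; have := mulr_ge0 (ltW e0) t0; lra.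
move: t0; rewrite le_eqVlt => /predU1P[t0|//]; exfalso.
have ini : is_initial a b.
  by apply: contraT => /(class_birth_gt0 H C); rewrite ltNge t0 bt.
move: xt; rewrite /class_width /class_xeps ini (initial_birth H C ini) -t0.
rewrite subr0 !mulr0 addr0 mul0r ltNge => /negP; apply; exact: normr_ge0.
Qed.

Lemma in_class_strip_lt e a b x t N : 0 < e -> 0 <= t -> in_class_strip e a b x t ->
  (front_bound_index (`|x| + e * (t + 1)) t <= N)%N -> (a < N)%N /\ (b < N)%N.
Proof.
move=> e0 t0 st; have [C bt td _ [_ xt]] := in_class_stripP e0 t0 st.
move=> sN; have [ab _ _] := C.
suff bN : (b < N)%N by split => //; exact: leq_ltn_trans ab bN.
apply: leq_trans sN; rewrite ltnNge; apply/negP => nb.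
have := front_bound_indexP t0 nb.
rewrite (lives_front H C bt) ?ab ?leqnn //.
by move: xt; rewrite ltr_distl => /andP[h1 h2]; have := ler_norm x; lra.
Qed.

Lemma strip_sum_widen F e x t N N' : 0 < e -> 0 <= t ->
  (strip_index e x t <= N)%N -> (strip_index e x t <= N')%N ->
  strip_sum N F e x t = strip_sum N' F e x t.
Proof.
move=> e0 t0; wlog NN : N N' / (N <= N')%N.
  move=> W h h'; case: (leqP N N') => [/W->//|/ltnW/W->//].
move=> hN hN'; rewrite /strip_sum.
rewrite (big_ord_widen_cond N' xpredT (fun a => \sum_(b < N) (if `[< in_class_strip e a b x t >] then F a b t else 0))) //.
rewrite big_mkcond /=; apply: eq_bigr => a _.
case: ifPn => [aN|naN].
  rewrite (big_ord_widen_cond N' xpredT (fun b => (if `[< in_class_strip e a b x t >] then F a b t else 0))) //.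
  rewrite big_mkcond /=; apply: eq_bigr => b _; case: ifPn => // nbN.
  by case: asboolP => // st; have [_] := in_class_strip_lt e0 t0 st hN; rewrite (negbTE nbN).
rewrite big1 // => b _; case: asboolP => // st.
by have [] := in_class_strip_lt e0 t0 st hN; rewrite (negbTE naN).
Qed.

Lemma in_stripE e a b x t : 0 <= t -> is_class d a b ->
  in_strip e (class_wave d e a b) x t <-> in_class_strip e a b x t.
Proof.
move=> t0 C.
have hw : halfwidth e (class_wave d e a b) t = class_width d e a b t / 2.
  by rewrite /halfwidth /class_width /=; field.
rewrite /in_strip hw; split=> [[sh [bt td] xt]|[sh /(is_class_atP d _ _ t0)[_ bt td] xt]].
  by split; [exact: sh|apply/(is_class_atP d _ _ t0)|exact: xt].
by split; [exact: sh|split|exact: xt].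
Qed.

Lemma class_wave_inj e a b a' b' : class_wave d e a b = class_wave d e a' b' ->
  a = a' /\ b = b'.
Proof.
by move=> E; split; [have /region_of_inj := congr1 (@lreg R) E
  |have /region_of_inj := congr1 (@rreg R) E => -[]].
Qed.

(** [represents] speaks of an arbitrary enumeration s of the strips over (x, t). The map p sends k
    to the pair of indices of s k, and partitioning the sum over k along p leaves singletons. *)
Lemma strip_sum_enum e x t n (s : nat -> wave R) (f : wave R -> R) N :
  0 < e -> 0 <= t -> (strip_index e x t <= N)%N -> set_inj `I_n s ->
  s @` `I_n = [set w | class_waves d e w /\ in_strip e w x t] ->
  strip_sum N (fun a b _ => f (class_wave d e a b)) e x t = \sum_(k < n) f (s k).
Proof.
move=> e0 t0 hN si sS.
have ex (k : 'I_n) : exists p : 'I_N * 'I_N,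
    in_class_strip e p.1 p.2 x t /\ s k = class_wave d e p.1 p.2.
  have : (s @` `I_n) (s k) by exists k => //=.
  rewrite sS => -[[a [b [C sk]]]]; rewrite sk => /(in_stripE _ _ t0 C) st.
  have [aN bN] := in_class_strip_lt e0 t0 st hN.
  by exists (Ordinal aN, Ordinal bN).
have [p hp] := choice ex.
rewrite /strip_sum pair_big /= -big_mkcond /=.
rewrite [RHS](partition_big p (fun q => `[< in_class_strip e q.1 q.2 x t >])) /=; last first.
  by move=> k _; apply/asboolP; have [] := hp k.
apply: eq_bigr => q /asboolP st.
have [C _ _ _ _] := in_class_stripP e0 t0 st.
have : (s @` `I_n) (class_wave d e q.1 q.2).
  by rewrite sS; split; [exists q.1, q.2|apply/in_stripE].
move=> [k0 /= k0n sk0].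
rewrite (big_pred1 (Ordinal k0n)) /= ?sk0 // => k.
apply/eqP/eqP => [pk|->].
  have [_] := hp k; rewrite pk -sk0 => sk.
  by apply: val_inj => /=; apply: si sk; rewrite inE /=.
have [_ /=] := hp (Ordinal k0n); rewrite sk0 => /class_wave_inj[e1 e2].
by apply/eqP; rewrite [p _]surjective_pairing [q]surjective_pairing xpair_eqE -!val_eqE /= -e1 -e2 !eqxx.
Qed.

Lemma class_density_gt0 e a b x t : 0 < e -> 0 <= t -> in_class_strip e a b x t ->
  0 < class_density e a b t.
Proof.
move=> e0 t0 st; have [C bt td sh [tp _]] := in_class_stripP e0 t0 st.
apply: divr_gt0; first exact: (class_mass_gt0 H C bt (ltW td) tp sh).
exact: (class_width_gt0 H e0 C bt tp).
Qed.

Lemma strip_sum_ge0 (F : nat -> nat -> R -> R) e x t N :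
  (forall a b, in_class_strip e a b x t -> 0 <= F a b t) -> 0 <= strip_sum N F e x t.
Proof.
move=> F0; apply: sumr_ge0 => a _; apply: sumr_ge0 => b _.
by case: asboolP => // /F0.
Qed.

Lemma density_ge0 g : 0 <= density d g.
Proof. by case: g => i //=; exact/ltW/(rhod_gt0 H). Qed.

Lemma rho_approx_ge0 e x t : 0 < e -> 0 <= t -> 0 <= rho_approx e x t.
Proof.
move=> e0 t0; rewrite /rho_approx; case: ifP => _; last exact: density_ge0.
by apply: strip_sum_ge0 => a b st; apply/ltW/(class_density_gt0 e0 t0 st).
Qed.

Lemma in_region_index e x t : 0 <= t ->
  in_region (class_waves d e) (region_of (region_index x t)) x t.
Proof.
move=> t0; have [h1 h2] := region_indexP x t0.
have rmono i j : (i <= j)%N -> (rank (region_of i) <= rank (region_of j))%N.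
  by case: i j => [|[|i]] [|[|j]] //= ij; lia.
move=> _ [a [b [C ->]]] [/= bt td].
have [lt|ge] := ltnP b (region_index x t).
  left; split; first exact: (rmono b.+1 _ lt).
  by rewrite -(lives_front H C bt (k := b)) ?h2 //; case: C => -> _ _; rewrite leqnn.
right; split; last first.
  rewrite -(lives_front H C bt (k := b)); last by case: C => -> _ _; rewrite leqnn.
  exact: le_trans h1 (front_mono H _ ge).
apply: (rmono _ a); rewrite leqNgt; apply/negP => lt.
have := h2 _ lt; rewrite ltNge => /negP; apply.
have <- : front (region_index x t) t = front a t.
  by apply: (lives_front H C bt); rewrite (ltnW lt) ge.
exact: h1.
Qed.

Lemma in_some_stripE e x t : 0 < e -> 0 <= t ->
  in_some_strip e x t <-> exists w, class_waves d e w /\ in_strip e w x t.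
Proof.
move=> e0 t0; split=> [[a [b st]]|[_ [[a [b [C ->]]] st]]].
  have [C _ _ _ _] := in_class_stripP e0 t0 st.
  by exists (class_wave d e a b); split; [exists a, b|apply/in_stripE].
by exists a, b; apply/in_stripE.
Qed.

Lemma class_waves_vacuum_velocity e : vacuum_velocity d (class_waves d e) vacuum_velocity_at.
Proof.
move=> i ui /=.
have i0 : i = 0%N by case: i ui => // i; rewrite ltNge (veld_decr H).
subst i.
have vacl w t : class_waves d e w -> alive w t -> rreg w = Vac 0 ->
    Defs.center w = front 0 /\ (t%:E < merge 0)%E.
  move=> [a [b [C ->]]] /= [_ /= td] /(@region_of_inj b.+1 1) [b0].
  have [ab _ _] := C; move: td ab; rewrite b0 leqn0 => + /eqP -> /=.
  by rewrite /class_death lt_min => /andP[].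
have vacr w : class_waves d e w -> lreg w = Vac 0 -> Defs.center w = front 1.
  by move=> [a [b [C ->]]] /= /(@region_of_inj a 1) ->.
split.
  apply: continuous_in_subspaceT => p; rewrite inE /= => -[p0 [wl [wr [[[W1 A1 V1] _] _]]]].
  have [_ td] := vacl _ _ W1 A1 V1.
  have ne : front 1 p.2 - front 0 p.2 != 0.
    rewrite subr_eq0; apply/eqP => /esym /(mergeP H _ p0).
    by rewrite leNgt td.
  have cf k : {for p, continuous (fun q : R * R => front k q.2)}.
    apply: (@continuous_comp _ _ _ snd (front k)); first exact: cvg_snd.
    exact: (front_continuous H).
  apply: cvgD; first exact: cvg_cst.
  apply: cvgM; first exact: cvg_cst.
  apply: cvgM.
    by apply: cvgB; [exact: cvg_fst|exact: cf].
  by apply: cvgV => //; apply: cvgB; exact: cf.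
move=> wl wr t t0 [[W1 A1 V1] [W2 A2 V2]].
have [-> td] := vacl _ _ W1 A1 V1; rewrite (vacr _ W2 V2).
have ne : front 1 t - front 0 t != 0.
  rewrite subr_eq0; apply/eqP => /esym /(mergeP H _ t0).
  by rewrite leNgt td.
by rewrite /vacuum_velocity_at /= subrr mul0r mulr0 addr0 divff // mulr1 subrKC.
Qed.

Lemma class_waves_represents e : 0 < e ->
  represents e d (class_waves d e) (rho_approx e) (u_approx e).
Proof.
move=> e0; exists vacuum_velocity_at; first exact: class_waves_vacuum_velocity.
move=> x t t0 S.
have enum n (s : nat -> wave R) : set_inj `I_n s -> s @` `I_n = S -> (0 < n)%N ->
    rho_approx e x t = \sum_(k < n) rhoeps (s k) t /\
    u_approx e x t = (\sum_(k < n) rhoeps (s k) t * ueps (s k) t)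
                 / \sum_(k < n) rhoeps (s k) t.
  move=> si sS n0.
  have nst : in_some_strip e x t.
    apply/in_some_stripE => //; exists (s 0%N).
    have : (s @` `I_n) (s 0%N) by exists 0%N.
    by rewrite sS.
  have E F G : (forall a b, in_class_strip e a b x t -> F a b t = G (class_wave d e a b)) ->
      strip_sum (strip_index e x t) F e x t = \sum_(k < n) G (s k).
    move=> FG; rewrite -(strip_sum_enum G e0 t0 (leqnn _) si sS).
    apply: eq_bigr => a _; apply: eq_bigr => b _.
    by case: asboolP => // /FG ->.
  have D a b : in_class_strip e a b x t -> class_density e a b t = rhoeps (class_wave d e a b) t.
    by move=> [sh _ _]; rewrite /class_density /= /class_strength sh.
  rewrite /rho_approx /u_approx; case: asboolP => // _.
  rewrite (E (class_density e) (fun w => rhoeps w t)) //.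
  by rewrite (E _ (fun w => rhoeps w t * ueps w t)) // => a b /D ->.
split.
- split; last exact: rho_approx_ge0.
  apply: (@sub_finite_set _ _ ((fun p => class_wave d e p.1 p.2) @` (`I_(strip_index e x t) `*` `I_(strip_index e x t)))).
    move=> _ [[a [b [C ->]]] /(in_stripE _ _ t0 C) st].
    have [aN bN] := in_class_strip_lt e0 t0 st (leqnn _).
    by exists (a, b).
  by apply: finite_image; apply: finite_setX; exact: finite_II.
- move=> S0; exists (region_of (region_index x t)); first exact: in_region_index.
  rewrite /rho_approx /u_approx; case: asboolP => //.
  move/(in_some_stripE _ e0 t0) => [w sw].
  by have : S w by []; rewrite S0.
- move=> w Sw.
  have [||//|-> ->] := enum 1%N (fun=> w).
  + by move=> i j; rewrite !inE /= !ltnS !leqn0 => /eqP -> /eqP ->.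
  + by rewrite Sw eqEsubset; split=> [_ [k _ <-]|_ ->] //; exists 0%N.
  rewrite !big_ord1 mulrC mulKf //.
  have : S w by rewrite Sw.
  move=> [[a [b [C wE]]] st]; rewrite wE in st *.
  have {}st := (in_stripE _ _ t0 C).1 st.
  have := class_density_gt0 e0 t0 st; case: st => sh _ _.
  by rewrite /class_density /= /class_strength sh => /lt0r_neq0.
- by move=> n s n1 si sS; apply: enum => //; exact: ltnW.
Qed.

End Representation.

(** * Test functions and integrals *)

Section TestFunctions.
Context {R : realType}.
Implicit Types (f g : R * R -> R) (K L : R).

(** The support condition is stated as vanishing outside a square, a form that passes to derivatives
    with the same K. *)
Definition tame K f : Prop :=
  smooth f /\ forall p : R * R, (K < `|p.1|) || (K < `|p.2|) -> f p = 0.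

Definition dx f : R * R -> R := fun p => 'D_((1, 0) : R * R) f p.
Definition dt f : R * R -> R := fun p => 'D_((0, 1) : R * R) f p.

Lemma test_function_bounded (V : normedModType R) (f : V -> R) : test_function f ->
  exists2 K : R, 0 < K & forall p, K < `|p| -> f p = 0.
Proof.
move=> [sf cf]; have [K0 [Kr hK]] := compact_bounded cf.
exists (Num.max 1 (K0 + 1)); first by rewrite lt_max ltr01.
move=> p pK; apply/eqP; apply: contraT => fp.
have := hK (Num.max 1 (K0 + 1)); rewrite lt_max ltrDl ltr01 orbT => /(_ isT) hp.
have cp : closure [set p | f p != 0] p by apply: subset_closure; exact: fp.
have /= := hp p cp.
by rewrite leNgt pK.
Qed.

Lemma test_function_tame f : test_function f -> exists2 K, 0 < K & tame K f.
Proof.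
move=> tf; have [K K0 hK] := test_function_bounded tf.
exists K => //; split; first by case: tf.
by move=> p pK; apply: hK; rewrite prod_normE lt_max.
Qed.

Lemma tame_le K K' f : K <= K' -> tame K f -> tame K' f.
Proof.
move=> KK [sf zf]; split => // p h; apply: zf.
by case/orP: h => h; rewrite (le_lt_trans KK h) ?orbT.
Qed.

Lemma tame_derive K f v : tame K f -> tame K (fun p => 'D_v f p).
Proof.
move=> [sf zf]; split.
  move=> vs; have [h1 h2] := sf (rcons vs v).
  suff <- : iterated_derive (rcons vs v) f = iterated_derive vs (fun p => 'D_v f p).
    by [].
  by rewrite /iterated_derive foldr_rcons.
move=> p pK.
have nz : \near p, f p = (cst 0 : R * R -> R) p.
  case/orP: pK => pK.
    have op : open [set q : R * R | K < `|q.1|].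
      apply: (@open_comp _ _ (fun q : R * R => `|q.1|) [set r | K < r]); last exact: open_gt.
      by move=> q _; apply: continuous_comp; [exact: cvg_fst|exact: norm_continuous].
    by apply: filterS (open_nbhs_nbhs (conj op pK)) => q /= qK; apply: zf; rewrite qK.
  have op : open [set q : R * R | K < `|q.2|].
    apply: (@open_comp _ _ (fun q : R * R => `|q.2|) [set r | K < r]); last exact: open_gt.
    by move=> q _; apply: continuous_comp; [exact: cvg_snd|exact: norm_continuous].
  by apply: filterS (open_nbhs_nbhs (conj op pK)) => q /= qK; apply: zf; rewrite qK orbT.
by rewrite (near_eq_derive _ nz) derive_cst.
Qed.

Lemma tame_dx K f : tame K f -> tame K (dx f).
Proof. exact: tame_derive. Qed.

Lemma tame_dt K f : tame K f -> tame K (dt f).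
Proof. exact: tame_derive. Qed.

Lemma tame_continuous K f : tame K f -> continuous f.
Proof. by move=> [/(_ [::])[]]. Qed.

Lemma tame_bounded K f : tame K f -> exists2 L, 0 <= L & forall p, `|f p| <= L.
Proof.
move=> tf; have [sf zf] := tf; have cf := tame_continuous tf.
have cK : compact (`[- K, K] `*` `[- K, K] : set (R * R)).
  by apply: compact_setX; exact: segment_compact.
have := continuous_compact (continuous_subspaceT cf) cK.
move=> /compact_bounded[K0 [Kr hK]].
exists (Num.max 0 (K0 + 1)); first by rewrite le_max lexx.
have K1 : K0 < Num.max 0 (K0 + 1) by rewrite lt_max ltrDl ltr01 orbT.
move=> p; have [pK|pK] := boolP ((K < `|p.1|) || (K < `|p.2|)).
  by rewrite zf // normr0 le_max lexx.
apply: (hK _ K1); exists p => //.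
move: pK; rewrite negb_or -!leNgt !ler_norml => /andP[h1 h2].
by split; rewrite /= in_itv.
Qed.

Lemma tame_slice_x K f (x t : R) : tame K f ->
  is_derive x 1 (fun s => f (s, t)) (dx f (x, t)).
Proof.
move=> [/(_ [::])[_ /(_ (x, t) ((1, 0) : R * R))] df _].
have E : (fun h : R => h^-1 *: (((fun s => f (s, t)) \o shift x) (h *: 1) - f (x, t))) =
  (fun h : R => h^-1 *: ((f \o shift (x, t)) (h *: ((1, 0) : R * R)) - f (x, t))).
  apply/funext => h /=; congr (_ *: (f _ - _)).
  by congr pair => /=; rewrite /GRing.scale /= ?mulr0 ?add0r.
split; first by rewrite /derivable E.
by rewrite /dx /derive E.
Qed.

Lemma tame_slice_t K f (x t : R) : tame K f ->
  is_derive t 1 (fun s => f (x, s)) (dt f (x, t)).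
Proof.
move=> [/(_ [::])[_ /(_ (x, t) ((0, 1) : R * R))] df _].
have E : (fun h : R => h^-1 *: (((fun s => f (x, s)) \o shift t) (h *: 1) - f (x, t))) =
  (fun h : R => h^-1 *: ((f \o shift (x, t)) (h *: ((0, 1) : R * R)) - f (x, t))).
  apply/funext => h /=; congr (_ *: (f _ - _)).
  by congr pair => /=; rewrite /GRing.scale /= ?mulr0 ?add0r.
split; first by rewrite /derivable E.
by rewrite /dt /derive E.
Qed.

Lemma mean_value (h dh : R -> R) (a b : R) :
  (forall x : R, is_derive x 1 h (dh x)) ->
  exists2 c, `|c - a| <= `|b - a| & h b - h a = dh c * (b - a).
Proof.
move=> hd; have ch : continuous h.
  by move=> x; apply/differentiable_continuous/derivable1_diffP; have [] := hd x.
have [ab|/ltW ab] := leP a b.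
  have [c cab E] := MVT_segment ab (fun x _ => hd x) (continuous_subspaceT ch).
  exists c => //; move: cab; rewrite in_itv /= => /andP[c1 c2].
  by rewrite !ger0_norm; lra.
have [c cab E] := MVT_segment ab (fun x _ => hd x) (continuous_subspaceT ch).
exists c; last by rewrite -opprB E -mulrN opprB.
move: cab; rewrite in_itv /= => /andP[c1 c2].
by rewrite !ler0_norm; lra.
Qed.

Definition lipschitz2 L f : Prop := forall x y t s,
  `|f (y, s) - f (x, t)| <= L * (`|y - x| + `|s - t|).

(** For the primitive [prim_x f] only an expansion of this kind is proved, with the fields f and
    [prim_x (dt f)]. *)
Definition taylor2 L f fx ft : Prop := forall x y t s,
  `|f (y, s) - f (x, t) - (fx (x, t) * (y - x) + ft (x, t) * (s - t))|
    <= L * (`|y - x| + `|s - t|) ^+ 2.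

Lemma tame_lipschitz K f : tame K f -> exists2 L, 0 <= L & lipschitz2 L f.
Proof.
move=> tf.
have [L1 L10 h1] := tame_bounded (tame_dx tf).
have [L2 L20 h2] := tame_bounded (tame_dt tf).
exists (L1 + L2); first lra.
move=> x y t s.
have [c _ E1] := mean_value x y (fun v => tame_slice_x v s tf).
have [k _ E2] := mean_value t s (fun v => tame_slice_t x v tf).
have -> : f (y, s) - f (x, t) = dx f (c, s) * (y - x) + dt f (x, k) * (s - t).
  by rewrite -E1 -E2; ring.
apply: le_trans (ler_normD _ _) _; rewrite !normrM.
have g1 : `|dx f (c, s)| * `|y - x| <= L1 * `|y - x| by apply: ler_wpM2r.
have g2 : `|dt f (x, k)| * `|s - t| <= L2 * `|s - t| by apply: ler_wpM2r.
have := mulr_ge0 L10 (normr_ge0 (s - t)); have := mulr_ge0 L20 (normr_ge0 (y - x)); lra.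
Qed.

Lemma tame_taylor K f : tame K f -> exists2 L, 0 <= L & taylor2 L f (dx f) (dt f).
Proof.
move=> tf.
have [L1 L10 h1] := tame_lipschitz (tame_dx tf).
have [L2 L20 h2] := tame_lipschitz (tame_dt tf).
exists (L1 + L2); first lra.
move=> x y t s.
have [c c1 E1] := mean_value x y (fun v => tame_slice_x v s tf).
have [k k1 E2] := mean_value t s (fun v => tame_slice_t x v tf).
set A := `|y - x| in c1 *; set T := `|s - t| in k1 *.
have -> : f (y, s) - f (x, t) - (dx f (x, t) * (y - x) + dt f (x, t) * (s - t)) =
   (dx f (c, s) - dx f (x, t)) * (y - x) + (dt f (x, k) - dt f (x, t)) * (s - t).
  by rewrite !mulrBl -E1 -E2; ring.
have [A0 T0] : 0 <= A /\ 0 <= T by split; exact: normr_ge0.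
apply: le_trans (ler_normD _ _) _; rewrite !normrM -/A -/T.
have g1 : `|dx f (c, s) - dx f (x, t)| * A <= L1 * (A + T) * A.
  apply: ler_wpM2r => //; apply: le_trans (h1 _ _ _ _) _.
  by apply: ler_wpM2l => //; rewrite lerD2r.
have g2 : `|dt f (x, k) - dt f (x, t)| * T <= L2 * (A + T) * T.
  apply: ler_wpM2r => //; apply: le_trans (h2 _ _ _ _) _.
  by apply: ler_wpM2l => //; rewrite subrr normr0; lra.
have := mulr_ge0 L10 (mulr_ge0 A0 T0); have := mulr_ge0 L20 (mulr_ge0 A0 T0).
have := mulr_ge0 L10 (mulr_ge0 T0 T0); have := mulr_ge0 L20 (mulr_ge0 A0 A0).
rewrite expr2; lra.
Qed.

(* Chain rule along a differentiable curve for functions of two variables that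
   are only known to have a second order expansion. *)
Lemma taylor_is_derive L f fx ft (X : R -> R) (v t : R) : 0 <= L ->
  taylor2 L f fx ft -> is_derive t 1 X v ->
  is_derive t 1 (fun s => f (X s, s)) (fx (X t, t) * v + ft (X t, t)).
Proof.
move=> L0 T /is_derive1_caratheodory[w [Xw cw wt]].
apply/is_derive1_caratheodory.
pose l s := fx (X t, t) * w s + ft (X t, t).
pose q s := if s == t then l t else (f (X s, s) - f (X t, t)) / (s - t).
exists q; split.
- move=> s; rewrite /q; case: eqP => [->|/eqP]; first by rewrite !subrr mulr0.
  by rewrite -subr_eq0 => /divfK->.
- have cl : {for t, continuous l}.
    apply: cvgD; last exact: cvg_cst.
    by apply: cvgM => //; exact: cvg_cst.
  pose b s := L * (`|w s| + 1) ^+ 2 * `|s - t|.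
  have cb : b s @[s --> t] --> 0.
    have -> : 0 = L * (`|w t| + 1) ^+ 2 * `|t - t| by rewrite subrr normr0 mulr0.
    apply: cvgM; last by apply: cvg_norm; apply: cvgB; [exact: cvg_id|exact: cvg_cst].
    apply: cvgM; first exact: cvg_cst.
    have cc : (`|w s| + 1) @[s --> t] --> `|w t| + 1.
      by apply: cvgD; [exact: cvg_norm|exact: cvg_cst].
    by rewrite expr2; under eq_fun do rewrite expr2; apply: cvgM.
  have qE : q t = l t by rewrite /q eqxx.
  rewrite /prop_for /continuous_at qE.
  apply: cvg_sub0 cl; rewrite /=.
  apply: (@squeeze_cvgr _ _ _ _ (fun s => - b s) b); last exact: cb; last first.
    by rewrite -oppr0; exact: cvgN.
  apply: nearW => s; rewrite /= -ler_norml fctE /q.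
  case: eqP => [->|/eqP st].
    by rewrite subrr normr0 /b subrr normr0 mulr0.
  have st0 : s - t != 0 by rewrite subr_eq0.
  have -> : (f (X s, s) - f (X t, t)) / (s - t) - l s =
     (f (X s, s) - f (X t, t) - (fx (X t, t) * (X s - X t) + ft (X t, t) * (s - t))) / (s - t).
    by rewrite Xw /l; field.
  rewrite normrM normfV ler_pdivrMr ?normr_gt0 //.
  apply: le_trans (T _ _ _ _) _; rewrite Xw normrM /b.
  rewrite le_eqVlt; apply/orP; left; apply/eqP; ring.
- by rewrite /q eqxx /l wt.
Qed.

End TestFunctions.

(** * Integrals of bounded functions with bounded support *)

Section Integrals.
Context {R : realType}.
Notation mu := (@lebesgue_measure R).
Implicit Types (f g : R -> R) (K c : R).

Notation integral f := (\int[mu]_(x in [set: R]) f x).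

(* Short for bounded, measurable, of bounded support. *)
Definition bms f : Prop :=
  measurable_fun [set: R] f /\
  exists K c, forall x, `|f x| <= c /\ (K < `|x| -> f x = 0).

Lemma measurable_bool (P : R -> bool) : measurable [set x | P x] ->
  measurable_fun [set: R] (fun x => (P x)%:R : R).
Proof.
move=> mP; rewrite (_ : (fun x => _) = \1_[set x | P x]).
  exact: measurable_indic.
apply/funext => x; rewrite indicE; case: (boolP (P x)) => px; first by rewrite mem_set.
by rewrite memNset //; exact/negP.
Qed.

Lemma bms_integrable f : bms f -> mu.-integrable [set: R] (EFin \o f).
Proof.
move=> [mf [K [c h]]].
pose A : set R := [set` `[- K, K]].
pose g : R -> R := fun x => c * \1_A x.
have ig : mu.-integrable [set: R] (EFin \o g).
  rewrite (_ : EFin \o g = (fun x => c%:E * (EFin \o \1_A) x)%E).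
    by apply: integrableZl => //; exact: integrable_indic_itv.
  by apply/funext => x.
apply: le_integrable ig => //; first exact/measurable_EFinP.
move=> x _; rewrite /= lee_fin /g; have [h1 h2] := h x.
have c0 : 0 <= c by exact: le_trans (normr_ge0 _) h1.
have [Kx|xK] := ltP K `|x|; first by rewrite h2 // normr0.
rewrite indicE mem_set; first by rewrite mulr1 (ger0_norm c0).
by rewrite /A /= in_itv /= -ler_norml.
Qed.

Lemma bms_mul f g : bms f -> measurable_fun [set: R] g ->
  (exists c, forall x, `|g x| <= c) -> bms (fun x => f x * g x).
Proof.
move=> [mf [K [c h]]] mg [c' h']; split; first exact: measurable_funM.
exists K, (c * c') => x; have [h1 h2] := h x; split.
  by rewrite normrM; apply: ler_pM.
by move=> /h2 ->; rewrite mul0r.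
Qed.

Lemma bmsD f g : bms f -> bms g -> bms (fun x => f x + g x).
Proof.
move=> [mf [K [c h]]] [mg [K' [c' h']]]; split; first exact: measurable_funD.
exists (Num.max K K'), (c + c') => x; have [h1 h2] := h x; have [h1' h2'] := h' x.
split; first by apply: le_trans (ler_normD _ _) _; apply: lerD.
by rewrite gt_max => /andP[/h2 -> /h2' ->]; rewrite addr0.
Qed.

Lemma bmsZ (k : R) f : bms f -> bms (fun x => k * f x).
Proof.
move=> bf; rewrite (_ : (fun x => _) = (fun x => f x * k)).
  by apply: bms_mul => //; exists `|k|.
by apply/funext => x; rewrite mulrC.
Qed.

Lemma bmsN f : bms f -> bms (fun x => - f x).
Proof. by move=> /(bmsZ (-1)); congr bms; apply/funext => x; rewrite mulN1r. Qed.

Lemma bmsB f g : bms f -> bms g -> bms (fun x => f x - g x).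
Proof. by move=> bf bg; apply: bmsD => //; exact: bmsN. Qed.

Lemma bms0 : bms (fun=> 0).
Proof. by split => //; exists 0, 0 => x; rewrite normr0. Qed.

Lemma bms_sum (I : Type) (s : seq I) (P : pred I) (F : I -> R -> R) :
  (forall i, P i -> bms (F i)) -> bms (fun x => \sum_(i <- s | P i) F i x).
Proof.
move=> h; elim: s => [|i s IH].
  by rewrite (_ : (fun x => _) = fun=> 0); [exact: bms0|apply/funext => x; rewrite big_nil].
rewrite (_ : (fun x => _) = fun x => (if P i then F i x else 0) + \sum_(i <- s | P i) F i x).
  by apply: bmsD => //; case Pi: (P i); [exact: h|exact: bms0].
by apply/funext => x; rewrite big_cons; case: ifP => // _; rewrite add0r.
Qed.

Lemma bms_if (b : bool) f : (b -> bms f) -> bms (fun x => if b then f x else 0).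
Proof. by case: b => [h|_]; [exact: h|exact: bms0]. Qed.

Lemma bms_norm f : bms f -> bms (fun x => `|f x|).
Proof.
move=> [mf [K [c h]]]; split; first exact: measurableT_comp.
exists K, c => x; have [h1 h2] := h x; split; first by rewrite normr_id.
by move=> /h2 ->; rewrite normr0.
Qed.

Lemma bms_itv (P : R -> bool) (a b : R) : measurable [set x | P x] ->
  (forall x, P x -> a <= x <= b) -> bms (fun x => (P x)%:R).
Proof.
move=> mP h; split; first exact: measurable_bool.
exists (Num.max `|a| `|b|), 1 => x; split; first by case: (P x); rewrite ?normr1 ?normr0.
rewrite gt_max => /andP[xa xb]; case: (boolP (P x)) => // /h /andP[ax xb'].
have [x0|x0] := leP 0 x.
  by move: xb; rewrite (ger0_norm x0) => xb; have := ler_norm b; lra.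
by move: xa; rewrite (ltr0_norm x0) => xa; have := ler_norm (- a); rewrite normrN; lra.
Qed.

Lemma integralD f g : bms f -> bms g ->
  integral (fun x => f x + g x) = integral f + integral g.
Proof. by move=> bf bg; apply: RintegralD => //; exact: bms_integrable. Qed.

Lemma integralB f g : bms f -> bms g ->
  integral (fun x => f x - g x) = integral f - integral g.
Proof. by move=> bf bg; apply: RintegralB => //; exact: bms_integrable. Qed.

Lemma integralZ (k : R) f : bms f -> integral (fun x => k * f x) = k * integral f.
Proof. by move=> bf; apply: RintegralZl => //; exact: bms_integrable. Qed.

Lemma integral0' : integral (fun=> 0 : R) = 0.
Proof. by rewrite Rintegral_cst // mul0r. Qed.

Lemma integral_bigsum (I : Type) (s : seq I) (P : pred I) (F : I -> R -> R) :
  (forall i, P i -> bms (F i)) ->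
  integral (fun x => \sum_(i <- s | P i) F i x) = \sum_(i <- s | P i) integral (F i).
Proof.
move=> h; elim: s => [|i s IH].
  rewrite big_nil -[RHS]integral0'; apply: eq_Rintegral => x _; exact: big_nil.
rewrite big_cons; under eq_Rintegral do rewrite big_cons.
case: ifP => // Pi; rewrite integralD //; [by rewrite IH|exact: h|exact: bms_sum].
Qed.

Lemma le_integral' f g : bms f -> bms g -> (forall x, f x <= g x) ->
  integral f <= integral g.
Proof. by move=> bf bg fg; apply: le_Rintegral => //; exact: bms_integrable. Qed.

Lemma norm_integral_le f g : bms f -> bms g -> (forall x, `|f x| <= g x) ->
  `|integral f| <= integral g.
Proof.
move=> bf bg fg; rewrite ler_norml -mulN1r -integralZ //; apply/andP; split.
  apply: le_integral' => // [|x]; first exact: bmsZ.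
  by have := fg x; rewrite ler_norml mulN1r => /andP[].
by apply: le_integral' => // x; have := fg x; rewrite ler_norml => /andP[].
Qed.

Lemma integral_interval (P : R -> bool) (a b : R) : a <= b ->
  ([set x | P x] = [set` `[a, b]]) \/ ([set x | P x] = [set` `]a, b]]) \/
  ([set x | P x] = [set` `]a, b[]) ->
  bms (fun x => (P x)%:R) /\ integral (fun x => (P x)%:R) = b - a.
Proof.
move=> ab h.
have [mP Pab muP] : [/\ measurable [set x | P x], forall x, P x -> a <= x <= b &
    fine (mu [set x | P x]) = b - a].
  by case: h => [|[|]] E; (split; [by rewrite E; exact: measurable_itv|move=> x Px;
    have : [set x | P x] x by []; rewrite E /= in_itv /= => /andP[]; lra
    |rewrite E lebesgue_measure_itv /= lte_fin; move: ab; rewrite le_eqVlt =>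
      /predU1P[->|ab]; [by rewrite ltxx subrr|by rewrite ab]]).
split; first exact: (bms_itv mP Pab).
rewrite -muP /Rintegral; congr fine.
rewrite -(setIT [set x | P x]) -integral_indic //.
apply: eq_integral => x _; rewrite indicE; case: (boolP (P x)) => px.
  by rewrite mem_set.
by rewrite memNset //; exact/negP.
Qed.

Lemma bms_continuous f K : continuous f -> (forall x, K < `|x| -> f x = 0) -> bms f.
Proof.
move=> cf zf; split; first exact: continuous_measurable_fun.
have := continuous_compact (continuous_subspaceT cf) (@segment_compact _ (- K) K).
move=> /compact_bounded[K0 [Kr hK]].
exists K, (Num.max 0 (K0 + 1)) => x; split; last exact: zf.
have K1 : K0 < Num.max 0 (K0 + 1) by rewrite lt_max ltrDl ltr01 orbT.
have [xK|xK] := ltP K `|x|; first by rewrite zf // normr0 le_max lexx.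
by apply: (hK _ K1); exists x => //; rewrite /= in_itv /= -ler_norml.
Qed.

Lemma integral_eq_off_finite f g (s : seq R) : measurable_fun [set: R] f ->
  measurable_fun [set: R] g ->
  (forall x, x \notin s -> f x = g x) -> integral f = integral g.
Proof.
move=> mf mg fg; congr fine; apply: ae_eq_integral => //.
- exact/measurable_EFinP.
- exact/measurable_EFinP.
have cs : countable [set x | x \in s] by apply: finite_set_countable; exact: finite_seq.
exists [set x | x \in s]; split.
- exact: countable_measurable.
- exact: countable_lebesgue_measure0.
- move=> x /= nfg; apply: contrapT => /negP xs; apply: nfg => _.
  by rewrite fg.
Qed.

Lemma constant_off_finite (s : seq R) (a b : R) (h : R -> R) : a <= b ->
  {within `[a, b], continuous h} ->
  (forall t, a < t < b -> t \notin s -> is_derive t 1 h 0) -> h b = h a.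
Proof.
elim: s a b => [|e s IH] a b ab ch dh.
  have [c _] := MVT_segment ab (fun t (tab : t \in `]a, b[) => dh t ltac:(by move: tab; rewrite in_itv) isT) ch.
  by rewrite mul0r => /eqP; rewrite subr_eq0 => /eqP.
have [/andP[ae eb]|neab] := boolP (a < e < b); last first.
  apply: IH => // t tab ts; apply: dh => //; rewrite inE negb_or ts andbT.
  by apply: contraNneq neab => <-.
transitivity (h e).
  apply: IH => [||t /andP[et tb] ts]; first exact: ltW.
    by apply: continuous_subspaceW ch; apply: subset_itvr; rewrite bnd_simp ltW.
  apply: dh; first by rewrite (lt_trans ae et).
  by rewrite inE negb_or ts andbT gt_eqF.
apply: IH => [||t /andP[et tb] ts]; first exact: ltW.
  by apply: continuous_subspaceW ch; apply: subset_itvl; rewrite bnd_simp ltW.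
apply: dh; first by rewrite et (lt_trans tb eb).
by rewrite inE negb_or ts andbT lt_eqF.
Qed.

Lemma open_off_finite (s : seq R) (a b : R) : open [set t : R | a < t < b /\ t \notin s].
Proof.
elim: s => [|e s IH].
  rewrite (_ : [set t | _] = [set` `]a, b[]); first exact: interval_open.
  by apply/seteqP; split => t /=; rewrite in_itv /=; [case|].
rewrite (_ : [set t | _] = [set t | a < t < b /\ t \notin s] `&` [set t | t != e]).
  by apply: openI => //; exact: open_neq.
apply/seteqP; split => t /=; rewrite inE negb_or.
  by move=> [tab /andP[te ts]].
by move=> [[tab ts] te]; rewrite te.
Qed.

Lemma bms_off_finite (s : seq R) (a b c : R) (f : R -> R) :
  (forall t, a < t < b -> t \notin s -> {for t, continuous f}) ->
  (forall t, a < t < b -> t \notin s -> `|f t| <= c) ->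
  bms (fun t => if (a < t < b) && (t \notin s) then f t else 0).
Proof.
move=> cf bf; split.
  pose D := [set t : R | a < t < b /\ t \notin s].
  have oD : open D by exact: open_off_finite.
  have mD : measurable D by exact: open_measurable.
  rewrite (_ : (fun t => _) = f \_ D).
    apply/(measurable_restrictT f mD); apply: open_continuous_measurable_fun => //.
    by move=> t; rewrite inE => -[tab ts]; exact: cf.
  apply/funext => t; rewrite patchE /D; case: ifPn => h.
    by rewrite mem_set //; move/andP: h.
  by rewrite memNset // => -[h1 h2]; rewrite h1 h2 in h.
exists (Num.max `|a| `|b|), (Num.max 0 c) => x; split.
  case: ifPn => [/andP[h1 h2]|_]; last by rewrite normr0 le_max lexx.
  by rewrite le_max bf ?orbT.
rewrite gt_max => /andP[xa xb]; case: ifPn => // /andP[/andP[h1 h2] _].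
have [x0|x0] := leP 0 x.
  by move: xb; rewrite (ger0_norm x0) => xb; have := ler_norm b; lra.
by move: xa; rewrite (ltr0_norm x0) => xa; have := ler_norm (- a); rewrite normrN; lra.
Qed.

(** The fundamental theorem of calculus with finitely many exceptional times: F minus the indefinite
    integral of f is continuous with derivative 0 off s, hence constant. *)
Lemma integral_derivative (s : seq R) (a b c : R) (F f : R -> R) : a <= b ->
  continuous F ->
  (forall t, a < t < b -> t \notin s -> {for t, continuous f}) ->
  (forall t, a < t < b -> t \notin s -> `|f t| <= c) ->
  (forall t, a < t < b -> t \notin s -> is_derive t 1 F (f t)) ->
  integral (fun t => if (a < t < b) && (t \notin s) then f t else 0) = F b - F a.
Proof.
move=> ab cF cf bf dF; set f0 := fun t => if _ then _ else _.
have b0 : bms f0 by exact: bms_off_finite cf bf.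
have i0 := bms_integrable b0.
pose G t := \int[mu]_(x in `[a, t]) f0 x.
have iab : mu.-integrable `[a, b] (EFin \o f0) by apply: integrableS i0.
have cG : {within `[a, b], continuous G} by exact: parameterized_integral_continuous.
have ga : G a = 0 by rewrite /G set_itv1 Rintegral_set1.
have gb : G b = integral f0.
  rewrite /G Rintegral_mkcond; apply: eq_Rintegral => t _; rewrite patchE.
  case: ifPn => //; rewrite notin_setE /= in_itv /= /f0 => /negP.
  by rewrite negb_and -!ltNge => h; case: ifPn => // /andP[/andP[h1 h2] _]; case/orP: h; lra.
have : (fun t => F t - G t) b = (fun t => F t - G t) a.
  apply: (@constant_off_finite s a b (fun t => F t - G t)) => //.
    move=> t; apply: continuousB; first exact: continuous_subspaceT.
    exact: cG.
  move=> t tab ts; have /andP[at' tb] := tab.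
  have f0t : f0 t = f t by rewrite /f0 tab ts.
  have cf0 : {for t, continuous f0}.
    rewrite /prop_for /continuous_at f0t; apply: cvg_trans (cf t tab ts).
    apply: near_eq_cvg.
    have op : open_nbhs t [set z : R | a < z < b /\ z \notin s].
      by split; [exact: open_off_finite|].
    by apply: filterS (open_nbhs_nbhs op) => z [h1 h2]; rewrite /f0 h1 h2.
  have [dG eG] := continuous_FTC1_closed tb iab at' cf0.
  have dG' : is_derive t 1 G (f t).
    by split; [exact: dG|rewrite -derive1E eG f0t].
  have dF' := dF t tab ts.
  have := is_deriveB dF' dG'; rewrite subrr; exact.
by rewrite /= ga gb subr0 => h; lra.
Qed.

End Integrals.

(** * Primitives in space and the pairing with moving discontinuities *)

Section XPrimitive.
Context {R : realType}.
Notation mu := (@lebesgue_measure R).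
Notation integral f := (\int[mu]_(x in [set: R]) f x).
Implicit Types (f : R * R -> R) (K L : R).

(** The integral of f(., t) over the half line left of x. It makes the pairing of f with a step
    function an explicit function of the positions of the jumps. *)
Definition prim_x f (p : R * R) : R := integral (fun s => (s <= p.1)%R%:R * f (s, p.2)).

Lemma slice_bms K f (t : R) : tame K f -> bms (fun s => f (s, t)).
Proof.
move=> tf; apply: (@bms_continuous _ _ K).
  move=> x; apply: differentiable_continuous; apply/derivable1_diffP.
  by have [] := tame_slice_x x t tf.
by move=> x xK; case: tf => _; apply; rewrite /= xK.
Qed.

Lemma bms_bool_mul (P : R -> bool) (f : R -> R) : measurable [set x | P x] -> bms f ->
  bms (fun s => (P s)%:R * f s).
Proof.
move=> mP bf; rewrite (_ : (fun s => _) = fun s => f s * (P s)%:R).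
  apply: bms_mul => //; first exact: measurable_bool.
  by exists 1 => x; case: (P x); rewrite ?normr1 ?normr0.
by apply/funext => s; rewrite mulrC.
Qed.

Lemma measurable_le_set (X : R) : measurable [set x : R | x <= X].
Proof.
rewrite (_ : [set _ | _] = [set` `]-oo, X]]); first exact: measurable_itv.
by apply/seteqP; split => x /=; rewrite in_itv.
Qed.

Lemma half_bms K f (X t : R) : tame K f -> bms (fun s => (s <= X)%R%:R * f (s, t)).
Proof.
move=> tf; apply: (@bms_bool_mul (fun s => s <= X)); first exact: measurable_le_set.
exact: slice_bms tf.
Qed.

Lemma prim_x_diff_t K f (x t s : R) L : 0 <= K -> 0 <= L -> tame K f ->
  taylor2 L f (dx f) (dt f) ->
  `|prim_x f (x, s) - prim_x f (x, t) - prim_x (dt f) (x, t) * (s - t)|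
    <= 2 * K * L * (s - t) ^+ 2.
Proof.
move=> K0 L0 tf T; rewrite /prim_x /=.
have b1 := half_bms x s tf; have b2 := half_bms x t tf.
have b3 := half_bms x t (tame_dt tf).
rewrite [_ * (s - t)]mulrC -integralZ // -integralB // -integralB //; last first.
- exact: bmsZ.
- exact: bmsB.
have KK : - K <= K by lra.
have E : [set z : R | - K <= z <= K] = [set` `[- K, K]].
  by apply/seteqP; split => z /=; rewrite in_itv.
have [bI iI] := @integral_interval _ (fun z : R => - K <= z <= K) (- K) K KK (or_introl E).
have -> : 2 * K * L * (s - t) ^+ 2 = integral (fun z => L * (s - t) ^+ 2 * (- K <= z <= K)%R%:R).
  by rewrite integralZ // iI; ring.
apply: norm_integral_le.
- by apply: bmsB; [exact: bmsB|exact: bmsZ].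
- exact: bmsZ.
move=> z; have [zK|zK] := boolP (- K <= z <= K); last first.
  have h (g : R * R -> R) y : tame K g -> g (z, y) = 0.
    by move=> [_]; apply; rewrite /= ltNge ler_norml (negbTE zK).
  by rewrite !(h _ _ tf) !(h _ _ (tame_dt tf)) !mulr0 !subrr normr0.
rewrite mulr1.
have := T z z t s; rewrite !subrr normr0 add0r mulr0 add0r real_normK ?num_real // => Tz.
case: (z <= x); rewrite ?mul0r ?mul1r; first by rewrite (mulrC (s - t)).
by rewrite mulr0 !subr0 normr0 mulr_ge0 // sqr_ge0.
Qed.

Lemma prim_x_diff_x K f (x y t s : R) L : tame K f -> 0 <= L -> lipschitz2 L f ->
  `|prim_x f (y, s) - prim_x f (x, s) - f (x, t) * (y - x)|
    <= L * (`|y - x| + `|s - t|) * `|y - x|.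
Proof.
move=> tf L0 lf.
have main a b c : a <= b -> a <= c <= b ->
    `|prim_x f (b, s) - prim_x f (a, s) - f (c, t) * (b - a)|
    <= L * (`|b - a| + `|s - t|) * `|b - a|.
  move=> ab cab; rewrite /prim_x /=.
  have E : [set z : R | a < z <= b] = [set` `]a, b]].
    by apply/seteqP; split => z /=; rewrite in_itv.
  have [bI iI] := @integral_interval _ (fun z : R => a < z <= b) a b ab (or_intror (or_introl E)).
  have b1 := half_bms b s tf; have b2 := half_bms a s tf.
  rewrite (_ : f (c, t) * (b - a) = integral (fun z => f (c, t) * (a < z <= b)%R%:R)); last first.
    by rewrite integralZ // iI.
  rewrite -integralB // -integralB //; last first.
  - exact: bmsZ.
  - exact: bmsB.
  have ba0 : 0 <= b - a by lra.
  have -> : L * (`|b - a| + `|s - t|) * `|b - a| =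
      integral (fun z => L * (`|b - a| + `|s - t|) * (a < z <= b)%R%:R).
    by rewrite integralZ // iI (ger0_norm ba0).
  apply: norm_integral_le.
  - by apply: bmsB; [exact: bmsB|exact: bmsZ].
  - exact: bmsZ.
  move=> z; case: (leP z b) => zb; case: (leP z a) => za /=.
  - by rewrite !mul1r !mulr0 subr0 subrr normr0.
  - rewrite !mulr1 mul1r mul0r subr0; apply: le_trans (lf _ _ _ _) _.
    apply: ler_wpM2l => //; rewrite lerD2r (ger0_norm ba0) ler_norml; lra.
  - lra.
  - by rewrite !mul0r !mulr0 !subr0 normr0.
have [xy|/ltW yx] := leP x y; first by apply: main; rewrite ?lexx.
have := @main y x x yx; rewrite lexx yx => /(_ isT).
rewrite (distrC x y) => h; apply: le_trans h.
by rewrite -normrN le_eqVlt; apply/orP; left; apply/eqP; congr (`|_|); ring.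
Qed.

(** The increment is split at (x, s). The change in time is a Taylor expansion under the integral,
    over a support of length 2 K, and the change in space is the integral of f over a short
    interval. *)
Lemma prim_x_taylor K f : 0 <= K -> tame K f ->
  exists2 L, 0 <= L & taylor2 L (prim_x f) f (prim_x (dt f)).
Proof.
move=> K0 tf.
have [L1 L10 T1] := tame_taylor tf; have [L2 L20 T2] := tame_lipschitz tf.
have h0 : 0 <= 2 * K * L1 by rewrite !mulr_ge0.
exists (2 * K * L1 + L2); first lra.
move=> x y t s.
have h1 := prim_x_diff_t x t s K0 L10 tf T1.
have h2 := prim_x_diff_x x y t s tf L20 T2.
set A := `|y - x| in h2 *; set T := `|s - t| in h2 *.
have -> : prim_x f (y, s) - prim_x f (x, t) - (f (x, t) * (y - x) + prim_x (dt f) (x, t) * (s - t)) =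
  (prim_x f (x, s) - prim_x f (x, t) - prim_x (dt f) (x, t) * (s - t)) +
  (prim_x f (y, s) - prim_x f (x, s) - f (x, t) * (y - x)) by ring.
apply: le_trans (ler_normD _ _) _.
have [A0 T0] : 0 <= A /\ 0 <= T by split; exact: normr_ge0.
have T2' : (s - t) ^+ 2 = T ^+ 2 by rewrite real_normK ?num_real.
rewrite T2' in h1.
have := mulr_ge0 h0 (mulr_ge0 A0 T0); have := mulr_ge0 L20 (mulr_ge0 A0 T0).
have := mulr_ge0 h0 (mulr_ge0 A0 A0); have := mulr_ge0 L20 (mulr_ge0 T0 T0).
move: h1 h2; rewrite !expr2; lra.
Qed.

Lemma taylor2_continuous L f fx ft : 0 <= L -> taylor2 L f fx ft -> continuous f.
Proof.
move=> L0 T [x t].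
pose b (p : R * R) := (`|fx (x, t)| * `|p.1 - x| + `|ft (x, t)| * `|p.2 - t|) +
   L * ((`|p.1 - x| + `|p.2 - t|) * (`|p.1 - x| + `|p.2 - t|)).
have cb : b p @[p --> (x, t)] --> 0.
  have -> : 0 = b (x, t) by rewrite /b /= !subrr !normr0 !(mulr0, addr0).
  have c1 : `|p.1 - x| @[p --> (x, t)] --> `|x - x|.
    by apply: cvg_norm; apply: cvgB; [exact: cvg_fst|exact: cvg_cst].
  have c2 : `|p.2 - t| @[p --> (x, t)] --> `|t - t|.
    by apply: cvg_norm; apply: cvgB; [exact: cvg_snd|exact: cvg_cst].
  apply: cvgD.
    by apply: cvgD; [apply: cvgM; [exact: cvg_cst|exact: c1]|apply: cvgM; [exact: cvg_cst|exact: c2]].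
  have c3 := cvgD c1 c2.
  by apply: cvgM; [exact: cvg_cst|apply: cvgM; exact: c3].
apply: cvg_zero; rewrite /=.
apply: (@squeeze_cvgr _ _ _ _ (fun s => - b s) b); last exact: cb; last first.
  by rewrite -oppr0; exact: cvgN.
apply: nearW => -[y s]; rewrite -ler_norml fctE /=.
have := T x y t s; rewrite expr2 => h.
have -> : f (y, s) - f (x, t) = (f (y, s) - f (x, t) - (fx (x, t) * (y - x) + ft (x, t) * (s - t)))
   + (fx (x, t) * (y - x) + ft (x, t) * (s - t)) by ring.
apply: le_trans (ler_normD _ _) _; rewrite /b /= addrC; apply: lerD => //.
by apply: le_trans (ler_normD _ _) _; rewrite !normrM.
Qed.

Lemma prim_x_continuous K f : 0 <= K -> tame K f -> continuous (prim_x f).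
Proof. by move=> K0 tf; have [L L0 T] := prim_x_taylor K0 tf; exact: taylor2_continuous T. Qed.

Lemma continuous_curve (g : R * R -> R) (X : R -> R) (t : R) : continuous g ->
  {for t, continuous X} -> {for t, continuous (fun s => g (X s, s))}.
Proof.
move=> cg cX; apply: (@continuous_comp _ _ _ (fun s => (X s, s)) g); last exact: cg.
by rewrite /prop_for /continuous_at; apply: (@cvg_pair _ _ _ _ (nbhs (X t)) (nbhs t)); [exact: cX|exact: cvg_id].
Qed.

Lemma prim_x_dx K f (x t : R) : 0 <= K -> tame K f -> prim_x (dx f) (x, t) = f (x, t).
Proof.
move=> K0 tf; have tdf := tame_dx tf.
have [L L0 T] := prim_x_taylor K0 tdf.
have d1 (z : R) : is_derive z 1 (fun v => prim_x (dx f) (v, t) - f (v, t)) 0.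
  have h1 : is_derive z 1 (fun v => prim_x (dx f) (v, t)) (dx f (z, t)).
    (* The chain rule is applied to a function of the second variable only, so that it yields an
       ordinary derivative in x. *)
    have := @taylor_is_derive _ L (fun p => prim_x (dx f) (p.2, t)) (fun=> 0) (fun p => dx f (p.2, t)) id 1 z L0.
    rewrite /= mul0r add0r; apply.
      move=> a b c e /=; rewrite mul0r add0r.
      have := T c e t t; rewrite !subrr normr0 mulr0 !addr0 => h.
      apply: le_trans h _; apply: ler_wpM2l => //.
      rewrite ler_sqr ?nnegrE ?addr_ge0 //.
      by rewrite lerDr.
  have := is_deriveB h1 (tame_slice_x z t tf); rewrite subrr; exact.
have [c _] := mean_value (- K - 1) x d1.
rewrite mul0r => /eqP; rewrite subr_eq0 => /eqP E.
have fz : forall g : R * R -> R, tame K g -> forall z, z < - K -> g (z, t) = 0.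
  by move=> g [_ zg] z zK; apply: zg; rewrite /= ltr0_norm; [apply/orP; left|]; lra.
have KK : - K - 1 < - K by lra.
have p0 : prim_x (dx f) (- K - 1, t) = 0.
  rewrite /prim_x -[RHS](@integral0' R); apply: eq_Rintegral => z _ /=.
  case: leP => zK; last by rewrite mul0r.
  rewrite mul1r; apply: fz => //; exact: le_lt_trans zK KK.
have := E; rewrite p0 (fz _ tf (- K - 1) KK).
by rewrite subrr => /eqP; rewrite subr_eq0 => /eqP.
Qed.

Lemma prim_x_right K f (x t : R) : tame K f -> K <= x ->
  prim_x f (x, t) = integral (fun s => f (s, t)).
Proof.
move=> [_ zf] Kx; apply: eq_Rintegral => z _ /=.
case: leP => zx; first by rewrite mul1r.
rewrite mul0r zf //= (@lt_le_trans _ _ z) //; first exact: le_lt_trans zx.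
exact: ler_norm.
Qed.

Lemma continuous_bigsum (I : Type) (r : seq I) (F : I -> R -> R) (t : R) :
  (forall i, {for t, continuous (F i)}) ->
  {for t, continuous (fun s => \sum_(i <- r) F i s)}.
Proof.
move=> cF; elim: r => [|i r IH].
  rewrite (_ : (fun s => _) = fun=> 0); first exact: cvg_cst.
  by apply/funext => s; rewrite big_nil.
rewrite (_ : (fun s => _) = fun s => F i s + \sum_(j <- r) F j s).
  by apply: cvgD; [exact: cF|exact: IH].
by apply/funext => s; rewrite big_cons.
Qed.

Section Functional.
Context (K : R) (K0 : 0 <= K) (f : R * R -> R) (tf : tame K f).
Context (N : nat) (al be : nat -> R) (X S : nat -> R -> R).

(* The pairing with f(., t) of the density that is al_k between the curves
   X_{k-1} and X_k, plus point charges S_k on X_k. *)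
Definition pairing (t : R) : R :=
  al N * prim_x f (K, t) +
  \sum_(k < N) ((al k - al k.+1) * prim_x f (X k t, t) + S k t * f (X k t, t)).

(** The weak form at time t, integrated in x, for the density [al], the flux [be] and point charges
    with speeds V_k. The flux enters through its jumps because f is the primitive of [dx f]. *)
Definition pairing_rate (V : nat -> R) (t : R) : R :=
  al N * prim_x (dt f) (K, t) +
  \sum_(k < N) ((al k - al k.+1) * prim_x (dt f) (X k t, t) +
    (be k - be k.+1) * f (X k t, t) +
    S k t * (dt f (X k t, t) + V k * dx f (X k t, t))).

(** Moving the k-th jump contributes (al_k - al_{k+1}) V_k f. The equation for S_k cancels this term
    and leaves the jump of [be]. *)
Lemma pairing_derive (V : nat -> R) (t : R) :
  (forall k, (k < N)%N -> is_derive t 1 (X k) (V k)) ->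
  (forall k, (k < N)%N -> is_derive t 1 (S k)
     ((al k.+1 - al k) * V k - (be k.+1 - be k))) ->
  is_derive t 1 pairing (pairing_rate V t).
Proof.
move=> dX dS.
have [L L0 T] := prim_x_taylor K0 tf; have [L' L'0 T'] := tame_taylor tf.
have d0 : is_derive t 1 (fun s => al N * prim_x f (K, s)) (al N * prim_x (dt f) (K, t)).
  have := taylor_is_derive L0 T (is_derive_cst K t (1 : R)).
  by rewrite mulr0 add0r => h; apply: is_deriveZ.
pose h (k : 'I_N) s := (al k - al k.+1) * prim_x f (X k s, s) + S k s * f (X k s, s).
pose dh (k : 'I_N) := (al k - al k.+1) * prim_x (dt f) (X k t, t) +
    (be k - be k.+1) * f (X k t, t) +
    S k t * (dt f (X k t, t) + V k * dx f (X k t, t)).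
have d1 (k : 'I_N) : is_derive t 1 (h k) (dh k).
  have dXk := dX k (ltn_ord k); have dSk := dS k (ltn_ord k).
  have e1 := taylor_is_derive L0 T dXk; have e2 := taylor_is_derive L'0 T' dXk.
  have e3 : is_derive t 1 (fun s => (al k - al k.+1) * prim_x f (X k s, s))
      ((al k - al k.+1) * (f (X k t, t) * V k + prim_x (dt f) (X k t, t))).
    exact: is_deriveZ.
  have e4 := is_deriveM dSk e2.
  apply: is_derive_eq (is_deriveD e3 e4) _.
  by rewrite /dh /GRing.scale /=; ring.
have ds := is_derive_sum d1.
have -> : pairing = (fun s => al N * prim_x f (K, s)) + \sum_(k < N) h k.
  by apply/funext => s; rewrite /pairing fctE fct_sumE.
exact: is_deriveD.
Qed.

Lemma pairing_continuous : (forall k, (k < N)%N -> continuous (X k)) ->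
  (forall k, (k < N)%N -> continuous (S k)) -> continuous pairing.
Proof.
move=> cX cS t; apply: cvgD.
  apply: cvgM; first exact: cvg_cst.
  exact: (continuous_curve (X := fun=> K) (prim_x_continuous K0 tf) (cvg_cst _)).
apply: continuous_bigsum => k; apply: cvgD; apply: cvgM.
- exact: cvg_cst.
- exact: (continuous_curve (prim_x_continuous K0 tf) (cX _ (ltn_ord k) t)).
- exact: cS.
- exact: (continuous_curve (tame_continuous tf) (cX _ (ltn_ord k) t)).
Qed.

Lemma pairing_rate_continuous (V : nat -> R -> R) (t : R) :
  (forall k, (k < N)%N -> continuous (X k)) ->
  (forall k, (k < N)%N -> continuous (S k)) ->
  (forall k, (k < N)%N -> {for t, continuous (V k)}) ->
  {for t, continuous (fun s => pairing_rate (V ^~ s) s)}.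
Proof.
move=> cX cS cV; apply: cvgD.
  apply: cvgM; first exact: cvg_cst.
  exact: (continuous_curve (X := fun=> K) (prim_x_continuous K0 (tame_dt tf)) (cvg_cst _)).
apply: continuous_bigsum => k.
have cc g : tame K g -> {for t, continuous (fun s => g (X k s, s))}.
  by move=> tg; exact: (continuous_curve (tame_continuous tg) (cX _ (ltn_ord k) t)).
apply: cvgD; first apply: cvgD; apply: cvgM.
- exact: cvg_cst.
- exact: (continuous_curve (prim_x_continuous K0 (tame_dt tf)) (cX _ (ltn_ord k) t)).
- exact: cvg_cst.
- exact: cc.
- exact: cS.
- apply: cvgD; first exact: (cc _ (tame_dt tf)).
  by apply: cvgM; [exact: cV|exact: (cc _ (tame_dx tf))].
Qed.

End Functional.

End XPrimitive.

(** * Sums over the classes and closing speeds *)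

Lemma is_derive_inverse_gap {R : realType} (c w g' t : R) (g : R -> R) : g t + w != 0 ->
  is_derive t 1 g g' -> is_derive t 1 (fun s => c / (g s + w)) (- (c / (g t + w) ^+ 2 * g')).
Proof.
move=> gw dg.
have dw : is_derive t 1 (fun s => g s + w) g'.
  by have := is_deriveD dg (is_derive_cst w t (1 : R)); rewrite addr0; exact.
have [hd hv] := dw.
have dV : is_derive t 1 (fun s => (g s + w)^-1) (- ((g t + w) ^- 2) * g').
  split; first exact: derivableV.
  by rewrite deriveV // hv.
apply: is_derive_eq (is_deriveZ _ dV) _.
by rewrite /GRing.scale /=; ring.
Qed.

Section ClassSums.
Context {R : realType} (d : data R).
Local Notation Y := (posd d).
Local Notation u := (veld d).
Local Notation front := (front d).
Local Notation merge := (merge d).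
Context {M B del : R} (H : regular_data d M B del).

Definition class_sum (N : nat) (G : nat -> nat -> R) (t : R) : R :=
  \sum_(a < N) \sum_(b < N) (if `[< is_class_at d a b t >] then G a b else 0).

Lemma sum_if_unique (N : nat) (P : nat -> bool) (g : R) : 0 <= g ->
  (forall a a', P a -> P a' -> a = a') ->
  \sum_(a < N) (if P a then g else 0) <= g.
Proof.
move=> g0 uP; have [/existsP[a0 Pa0]|] := boolP [exists a : 'I_N, P a].
  rewrite (bigD1 a0) //= Pa0 big1 ?addr0 // => a /eqP na; case: ifPn => // Pa.
  by case: na; apply: val_inj; exact: uP.
rewrite negb_exists => /forallP nP; rewrite big1 // => a _.
by rewrite (negbTE (nP a)).
Qed.

Lemma is_class_at_fst a a' b t : is_class_at d a b t -> is_class_at d a' b t -> a = a'.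
Proof.
move=> C C'; have [ab _ _] := C; have [ab' _ _] := C'.
have k1 : (a <= b <= b)%N by rewrite ab leqnn.
have k2 : (a' <= b <= b)%N by rewrite ab' leqnn.
by have [] := is_class_at_unique C C' k1 k2.
Qed.

(** Each front is the last one of at most one class at time t, so a sum over classes, though written
    over pairs, costs only N terms. *)
Lemma class_sum_le_snd N (G : nat -> R) t : (forall b, 0 <= G b) ->
  class_sum N (fun _ b => G b) t <= \sum_(b < N) G b.
Proof.
move=> G0; rewrite /class_sum exchange_big /=; apply: ler_sum => b _.
apply: (@sum_if_unique N (fun a => `[< is_class_at d a b t >])) => // a a' /asboolP C /asboolP C'.
exact: is_class_at_fst C C'.
Qed.

Lemma class_sum_le N (G G' : nat -> nat -> R) t :
  (forall a b, (b < N)%N -> is_class_at d a b t -> G a b <= G' a b) ->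
  class_sum N G t <= class_sum N G' t.
Proof.
move=> GG; apply: ler_sum => a _; apply: ler_sum => b _.
by case: asboolP => // /(GG _ _ (ltn_ord b)).
Qed.

Lemma eq_class_sum N (G G' : nat -> nat -> R) t :
  (forall a b, (b < N)%N -> is_class_at d a b t -> G a b = G' a b) ->
  class_sum N G t = class_sum N G' t.
Proof.
move=> GG; apply: eq_bigr => a _; apply: eq_bigr => b _.
by case: asboolP => // /(GG _ _ (ltn_ord b)) ->.
Qed.

Lemma class_sum_le_const N (c : R) (G : nat -> nat -> R) t : 0 <= c ->
  (forall a b, (b < N)%N -> is_class_at d a b t -> G a b <= c) -> class_sum N G t <= N%:R * c.
Proof.
move=> c0 Gc; apply: le_trans (@class_sum_le N G (fun _ _ => c) t Gc) _.
apply: le_trans (@class_sum_le_snd N (fun=> c) t (fun=> c0)) _.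
by rewrite sumr_const card_ord mulr_natl.
Qed.

(** Every front lies in exactly one class. Classes reaching beyond the first N fronts, of which the
    left sum may contain only a part, are removed by the vanishing of psi. *)
Lemma class_sum_group N (S psi : nat -> R) t : 0 <= t ->
  (forall a b k, is_class_at d a b t -> (a <= k <= b)%N -> psi k = psi a) ->
  (forall a b, is_class_at d a b t -> (N <= b)%N -> psi a = 0) ->
  \sum_(k < N) S k * psi k =
  class_sum N (fun a b => (\sum_(a <= k < b.+1) S k) * psi a) t.
Proof.
move=> t0 pc pz.
have E a b : (b < N)%N -> is_class_at d a b t ->
    (\sum_(a <= k < b.+1) S k) * psi a =
    \sum_(k < N) (if (a <= k <= b)%N then S k * psi k else 0).
  move=> bN C; rewrite mulr_suml.
  rewrite -(big_mkord xpredT (fun k => if (a <= k <= b)%N then S k * psi k else 0)).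
  have [ab _ _] := C.
  rewrite [RHS](@big_cat_nat _ _ _ a 0%N N) //=; last by apply: ltnW; apply: leq_ltn_trans ab bN.
  rewrite [X in _ = X + _]big1_seq ?add0r; last first.
    by move=> k /=; rewrite mem_index_iota /= => ka; rewrite leqNgt ka.
  rewrite [RHS](@big_cat_nat _ _ _ b.+1 a N) //=; last by rewrite leqW.
  rewrite [X in _ = _ + X]big1_seq ?addr0; last first.
    by move=> k /=; rewrite mem_index_iota => /andP[bk _]; rewrite [(k <= b)%N]leqNgt bk andbF.
  apply: eq_big_nat => k /andP[ak kb]; rewrite ak -ltnS kb /=.
  by rewrite (pc _ _ _ C) // ak -ltnS kb.
transitivity (\sum_(k < N) \sum_(a < N) \sum_(b < N)
    (if `[< is_class_at d a b t >] && (a <= k <= b)%N then S k * psi k else 0)).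
  apply: eq_bigr => k _.
  have [a [b [C kab]]] := exists_class_at H k t0.
  have U (a' b' : 'I_N) : `[< is_class_at d a' b' t >] && (a' <= k <= b')%N ->
      a = a' /\ b = b'.
    by move=> /andP[/asboolP C' kab']; exact: is_class_at_unique C C' kab kab'.
  have [bN|Nb] := ltnP b N; last first.
    have -> : psi k = 0 by rewrite (pc _ _ _ C kab) (pz _ _ C Nb).
    by rewrite mulr0 big1 // => a' _; rewrite big1 // => b' _; rewrite if_same.
  have aN : (a < N)%N by have [ab _ _] := C; exact: leq_ltn_trans ab bN.
  rewrite (bigD1 (Ordinal aN)) //= (bigD1 (Ordinal bN)) //=.
  have -> : `[< is_class_at d a b t >] by apply/asboolP.
  rewrite kab /= big1 ?addr0.
    rewrite big1 ?addr0 // => a' /eqP na; rewrite big1 // => b' _.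
    case: ifPn => // /U[aa _]; case: na; exact: val_inj.
  move=> b' /eqP nb; case: ifPn => // cc.
  have : `[< is_class_at d (Ordinal aN) b' t >] && (Ordinal aN <= k <= b')%N by exact: cc.
  by move=> /U[_ bb]; case: nb; apply: val_inj.
rewrite exchange_big /=; apply: eq_bigr => a _.
rewrite exchange_big /=; apply: eq_bigr => b _.
case: asboolP => [C|_] /=; last by rewrite big1.
by rewrite E.
Qed.

(** The jump at a single front. Over a class these jumps telescope to the mass of the wave, and each
    one satisfies the jump equation by itself. Sums over a fixed set of fronts thus pass through
    interactions unchanged. *)
Definition mass_charge (k : nat) (t : R) : R :=
  mass d (region_of k.+1) (front k t) t - mass d (region_of k) (front k t) t.

Definition momentum_charge (k : nat) (t : R) : R :=
  momentum d (region_of k.+1) (front k t) t - momentum d (region_of k) (front k t) t.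

Lemma class_sum_mass_charge a b t : 0 <= t -> is_class_at d a b t ->
  \sum_(a <= k < b.+1) mass_charge k t = class_mass d a b t.
Proof.
move=> t0 [ab h _]; rewrite /class_mass.
rewrite -(telescope_sumr (fun k => mass d (region_of k) (front a t) t)); last by rewrite leqW.
apply: eq_big_nat => k kab; rewrite /mass_charge.
by rewrite (front_class H t0 h) //; move: kab; rewrite ltnS.
Qed.

Lemma class_sum_momentum_charge a b t : 0 <= t -> is_class_at d a b t ->
  \sum_(a <= k < b.+1) momentum_charge k t = class_momentum d a b t.
Proof.
move=> t0 [ab h _]; rewrite /class_momentum.
rewrite -(telescope_sumr (fun k => momentum d (region_of k) (front a t) t)); last by rewrite leqW.
apply: eq_big_nat => k kab; rewrite /momentum_charge.
by rewrite (front_class H t0 h) //; move: kab; rewrite ltnS.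
Qed.

Lemma class_speed_between a b t : is_class d a b -> class_birth d a b <= t ->
  (t%:E <= class_death d a b)%E -> 0 < t ->
  rvel d (region_of b.+1) <= class_speed d a b t <= lvel d (region_of a).
Proof.
move=> C bt td t0; have [sh|sh] := boolP (is_shadow d a b).
  have m0 := class_mass_gt0 H C bt td t0 sh.
  have := class_speed_bounds H C bt td t0.
  by rewrite -(class_speedE H C bt td t0) !ler_pM2l.
have [ini _ _ _ /(_ t0) e] := class_contact H C bt td sh.
by rewrite /class_speed ini /initial_speed (negbTE sh) -e !lexx.
Qed.

Lemma class_speed_le a b t : is_class d a b -> class_birth d a b <= t ->
  (t%:E <= class_death d a b)%E -> 0 < t -> `|class_speed d a b t| <= M.
Proof.
move=> C bt td t0; have /andP[h1 h2] := class_speed_between C bt td t0.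
have : `|lvel d (region_of a)| <= M by case: (region_of a) => i; exact: (veld_le H).
have : `|rvel d (region_of b.+1)| <= M by case: (region_of b.+1) => i; exact: (veld_le H).
rewrite !ler_norml; lra.
Qed.

Lemma class_front_derive a b k t : is_class d a b -> class_birth d a b < t ->
  (t%:E < class_death d a b)%E -> (a <= k <= b)%N ->
  is_derive t 1 (front k) (class_speed d a b t).
Proof.
move=> C bt td kab.
have fk s : class_birth d a b < s -> (s%:E < class_death d a b)%E -> front k s = front a s.
  by move=> bs sd; exact: (lives_front H C (ltW bs)).
have [sh|sh] := boolP (is_shadow d a b).
  have [v [cv vt nv]] := shadow_strict H sh C bt td.
  rewrite -vt; apply: (is_derive_near (g := v)) => //.
  near=> s; have [e bs sd] : [/\ front a s - front a t = v s * (s - t),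
          class_birth d a b < s & (s%:E < class_death d a b)%E] by near: s.
  by rewrite !fk.
have E s : class_birth d a b < s -> (s%:E < class_death d a b)%E ->
    front k s = Y b.-1 + s * lvel d (region_of a).
  move=> bs sd; rewrite fk //.
  by have [_ -> _ _ _] := class_contact H C (ltW bs) (ltW sd) sh.
have [ini _ _ _ _] := class_contact H C (ltW bt) (ltW td) sh.
rewrite /class_speed ini /initial_speed (negbTE sh).
apply: (is_derive_near (g := fun=> lvel d (region_of a))); last exact: cvg_cst.
near=> s; have [bs sd] : class_birth d a b < s /\ (s%:E < class_death d a b)%E.
  by near: s; exact: near_lives.
by rewrite !E //; ring.
Unshelve. all: by end_near.
Qed.

Definition front_speed (k : nat) (t : R) : R := 'D_1 (front k) t.

Lemma class_front_speed a b k t : is_class d a b -> class_birth d a b < t ->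
  (t%:E < class_death d a b)%E -> (a <= k <= b)%N ->
  front_speed k t = class_speed d a b t.
Proof. by move=> C bt td kab; have [] := class_front_derive C bt td kab. Qed.

Lemma front_speed_continuous a b k t : is_class d a b -> class_birth d a b < t ->
  (t%:E < class_death d a b)%E -> (a <= k <= b)%N ->
  {for t, continuous (front_speed k)}.
Proof.
move=> C bt td kab; rewrite /prop_for /continuous_at (class_front_speed C bt td kab).
have cs : class_speed d a b s @[s --> t] --> class_speed d a b t.
  have [sh|sh] := boolP (is_shadow d a b).
    exact: (class_speed_continuous H C sh (ltW bt) (ltW td)).
  have [ini _ _ _ _] := class_contact H C (ltW bt) (ltW td) sh.
  rewrite (_ : class_speed d a b = fun=> initial_speed d a b); first exact: cvg_cst.
  by apply/funext => s; rewrite /class_speed ini.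
apply: cvg_trans cs; apply: near_eq_cvg.
near=> s; have [bs sd] : class_birth d a b < s /\ (s%:E < class_death d a b)%E.
  by near: s; exact: near_lives.
by rewrite (class_front_speed C bs sd kab).
Unshelve. all: by end_near.
Qed.

(* Off these times, the classes of the fronts k < n are locally constant. *)
Definition merge_times (n : nat) : seq R := [seq fine (merge k) | k <- iota 0 n].

Lemma class_off_merge_times n a b t : 0 < t -> is_class_at d a b t -> (b <= n)%N ->
  t \notin merge_times n ->
  [/\ is_class d a b, class_birth d a b < t & (t%:E < class_death d a b)%E].
Proof.
move=> t0 C bn tE; have [Cc bt td] := (is_class_atP d _ _ (ltW t0)).1 C.
split=> //; apply/bigmax_ltP; split => // k ak.
have kab : (a <= k < b)%N by rewrite ak ltn_ord.
rewrite lt_neqAle; apply/andP; split; last first.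
  rewrite -lee_fin (fineK (is_class_fin Cc kab)).
  by have /(class_birth_le _ Cc)[_] := bt; exact.
apply: contraNneq tE => <-; apply/mapP; exists (k : nat) => //.
by rewrite mem_iota /= (leq_trans _ bn) // ltn_ord.
Qed.

Section Regular.
Context (n N : nat) (T : R).
Hypothesis nN : forall a b k t, 0 <= t <= T -> is_class_at d a b t ->
  (a <= k <= b)%N -> (k < N)%N -> (b <= n)%N.

(** By hypothesis, up to time T a class meeting the first N fronts ends at index n at the latest.
    Off [merge_times n] each of these fronts is therefore in the interior of the lifetime of its
    class. *)
Let regular k t : 0 < t < T -> t \notin merge_times n -> (k < N)%N ->
  exists a b, [/\ is_class d a b, class_birth d a b < t,
    (t%:E < class_death d a b)%E, is_class_at d a b t & (a <= k <= b)%N].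
Proof.
move=> /andP[t0 tT] tE kN; have [a [b [C kab]]] := exists_class_at H k (ltW t0).
have tT' : 0 <= t <= T by rewrite !ltW.
by have [C1 bt td] := class_off_merge_times t0 C (nN tT' C kab kN) tE; exists a, b.
Qed.

Lemma regular_front_derive k t : 0 < t < T -> t \notin merge_times n -> (k < N)%N ->
  is_derive t 1 (front k) (front_speed k t).
Proof.
move=> t0 tE kN; have [a [b [C bt td _ kab]]] := regular t0 tE kN.
by rewrite (class_front_speed C bt td kab); exact: class_front_derive.
Qed.

Lemma regular_front_speed_continuous k t : 0 < t < T -> t \notin merge_times n -> (k < N)%N ->
  {for t, continuous (front_speed k)}.
Proof.
move=> t0 tE kN; have [a [b [C bt td _ kab]]] := regular t0 tE kN.
exact: front_speed_continuous C bt td kab.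
Qed.

Lemma regular_front_speed_le k t : 0 < t < T -> t \notin merge_times n -> (k < N)%N ->
  `|front_speed k t| <= M.
Proof.
move=> t0 tE kN; have [a [b [C bt td _ kab]]] := regular t0 tE kN.
rewrite (class_front_speed C bt td kab); apply: class_speed_le => //; try exact: ltW.
by case/andP: t0.
Qed.

Lemma regular_class_speed a b k t : 0 < t < T -> t \notin merge_times n -> (k < N)%N ->
  is_class_at d a b t -> (a <= k <= b)%N -> front_speed k t = class_speed d a b t.
Proof.
move=> t0 tE kN C kab; have [a' [b' [C' bt td C2 kab']]] := regular t0 tE kN.
have [-> ->] := is_class_at_unique C C2 kab kab'.
exact: class_front_speed.
Qed.

Lemma veld_mono i j : (0 < i)%N -> (i <= j)%N -> u j <= u i.
Proof.
case: i => // i _; case: j => // j; rewrite ltnS => ij.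
rewrite -(subnKC ij); elim: (j - i)%N => [|m IH]; first by rewrite addn0.
by apply: le_trans IH; rewrite addnS; exact: (veld_decr H).
Qed.

(** The speed of a class is at least the velocity on its right, hence at least the velocity on the
    left of any later class, hence at least the speed of that class. The middle step compares
    velocities of positive index, whence 0 < k. *)
Lemma regular_front_speed_mono k l t : 0 < t < T -> t \notin merge_times n ->
  (0 < k)%N -> (k <= l)%N -> (l < N)%N -> front_speed l t <= front_speed k t.
Proof.
move=> tt tE k0 kl lN; have kN := leq_ltn_trans kl lN.
have [a [b [C bt td C1 kab]]] := regular tt tE kN.
have [a' [b' [C' bt' td' C1' lab']]] := regular tt tE lN.
have /andP[t0 _] := tt.
rewrite (class_front_speed C bt td kab) (class_front_speed C' bt' td' lab').
have [lb|bl] := leqP l b.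
  have lab : (a <= l <= b)%N by rewrite lb (leq_trans _ kl) //; case/andP: kab.
  by have [-> ->] := is_class_at_unique C1 C1' lab lab'.
have ba' : (b < a')%N.
  rewrite ltnNge; apply/negP => a'b.
  have bab : (a <= b <= b)%N by rewrite leqnn andbT; case: C.
  have bab' : (a' <= b <= b')%N.
    by rewrite a'b; apply: leq_trans (ltnW bl) _; case/andP: lab'.
  have [_ bb] := is_class_at_unique C1 C1' bab bab'.
  by move: bl; rewrite ltnNge bb; case/andP: lab' => _ ->.
have /andP[h1 _] := class_speed_between C (ltW bt) (ltW td) t0.
have /andP[_ h2] := class_speed_between C' (ltW bt') (ltW td') t0.
apply: le_trans h2 (le_trans _ h1).
have b0 : (0 < b)%N by apply: leq_trans k0 _; case/andP: kab.
case: b b0 ba' {C bt td C1 kab h1 bl} => // b _; case: a' {C' bt' td' C1' lab'} => [|[|a']] //= ba'.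
by apply: veld_mono.
Qed.

Section Pair.
Context (w : R) (w0 : 0 < w) (k l : nat).
Hypotheses (k0 : (0 < k)%N) (kl : (k <= l)%N) (lN : (l < N)%N).

(* For fronts k, l > 0 this is the derivative of 4 w^2 / (gap + w), where gap is
   their nonincreasing distance: it dominates their closing speed while gap < w,
   and its integral is at most 4 w. *)
Definition pair_rate (t : R) : R :=
  4 * w ^+ 2 / (front l t - front k t + w) ^+ 2 * (front_speed k t - front_speed l t).

Let gap_ge0 t : 0 <= front l t - front k t.
Proof. by rewrite subr_ge0; exact: (front_mono H). Qed.

Lemma pair_rate_ge0 t : 0 < t < T -> t \notin merge_times n -> 0 <= pair_rate t.
Proof.
move=> tt tE; apply: mulr_ge0; last first.
  by rewrite subr_ge0; exact: regular_front_speed_mono.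
by apply: divr_ge0; rewrite ?sqr_ge0 // mulr_ge0 ?sqr_ge0.
Qed.

Lemma pair_rate_ge t : 0 < t < T -> t \notin merge_times n ->
  front l t - front k t < w -> front_speed k t - front_speed l t <= pair_rate t.
Proof.
move=> tt tE gw; rewrite -[leLHS]mul1r; apply: ler_wpM2r.
  by rewrite subr_ge0; exact: regular_front_speed_mono.
have g0 := gap_ge0 t.
rewrite ler_pdivlMr ?mul1r; last by apply: exprn_gt0; lra.
(* For gap < w the denominator is below (2 w)^2, so the weight is at least 1. *)
have -> : 4 * w ^+ 2 = (2 * w) ^+ 2 by rewrite exprMn; congr (_ * _); rewrite expr2; ring.
by rewrite ler_sqr ?nnegrE; lra.
Qed.

Let gw t : 0 < front l t - front k t + w.
Proof. by rewrite ltr_wpDl // gap_ge0. Qed.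

Let sq t : 4 * w ^+ 2 <= 4 * (front l t - front k t + w) ^+ 2.
Proof.
apply: ler_wpM2l => //; rewrite ler_sqr ?nnegrE; [|exact: ltW..].
by rewrite lerDr gap_ge0.
Qed.

Lemma pair_rate_bms : bms (fun t => if (0 < t < T) && (t \notin merge_times n) then pair_rate t else 0).
Proof.
have kN := leq_ltn_trans kl lN.
apply: (@bms_off_finite _ _ _ _ (4 * (M + M))) => t tt tE.
  have cg : {for t, continuous (fun s => front l s - front k s + w)}.
    apply: cvgD; last exact: cvg_cst.
    by apply: cvgB; exact: (front_continuous H).
  apply: cvgM; last by apply: cvgB; exact: regular_front_speed_continuous.
  apply: cvgM; first exact: cvg_cst.
  apply: cvgV.
    by apply: lt0r_neq0; apply: exprn_gt0.
  by rewrite expr2; under eq_fun do rewrite expr2; apply: cvgM; exact: cg.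
rewrite normrM; apply: ler_pM => //.
  rewrite ger0_norm; last by apply: divr_ge0; rewrite ?sqr_ge0 // mulr_ge0 ?sqr_ge0.
  rewrite ler_pdivrMr; last by apply: exprn_gt0.
  exact: sq.
apply: le_trans (ler_normB _ _) _.
by apply: lerD; exact: regular_front_speed_le.
Qed.

Lemma pair_rate_integral : 0 <= T ->
  \int[@lebesgue_measure R]_(t in [set: R])
    (if (0 < t < T) && (t \notin merge_times n) then pair_rate t else 0) <= 4 * w.
Proof.
move=> T0; have kN := leq_ltn_trans kl lN.
pose g t := front l t - front k t.
pose h (s : R) : R := - (4 * w) + 4 * w ^+ 2 / (s + w).
have gw' t : g t + w != 0 by exact: lt0r_neq0 (gw t).
have cg : continuous g by move=> t; apply: cvgB; exact: (front_continuous H).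
have ch : continuous (h \o g).
  move=> t; apply: cvgD; first exact: cvg_cst.
  apply: cvgM; first exact: cvg_cst.
  by apply: cvgV; [exact: gw'|apply: cvgD; [exact: cg|exact: cvg_cst]].
have -> : \int[@lebesgue_measure R]_(t in [set: R])
    (if (0 < t < T) && (t \notin merge_times n) then pair_rate t else 0) = (h \o g) T - (h \o g) 0.
  apply: (@integral_derivative R (merge_times n) 0 T (4 * (M + M)) (h \o g) pair_rate T0 ch).
  - move=> t tt tE; apply: cvgM; last by apply: cvgB; exact: regular_front_speed_continuous.
    apply: cvgM; first exact: cvg_cst.
    apply: cvgV; first by rewrite expf_neq0 // gw'.
    have cgw : {for t, continuous (fun s => g s + w)}.
      by apply: cvgD; [exact: cg|exact: cvg_cst].
    by rewrite expr2; under eq_fun do rewrite expr2; apply: cvgM; exact: cgw.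
  - move=> t tt tE; have g0 := gap_ge0 t.
    rewrite normrM; apply: ler_pM => //.
      rewrite ger0_norm; last by apply: divr_ge0; rewrite ?sqr_ge0 // mulr_ge0 ?sqr_ge0.
      rewrite ler_pdivrMr; last exact: exprn_gt0.
      exact: sq.
    apply: le_trans (ler_normB _ _) _.
    by apply: lerD; exact: regular_front_speed_le.
  - move=> t tt tE.
    have dk := regular_front_derive tt tE kN; have dl := regular_front_derive tt tE lN.
    have dg : is_derive t 1 g (front_speed l t - front_speed k t) by exact: is_deriveB.
    have dh := is_derive_inverse_gap (4 * w ^+ 2) (gw' t) dg.
    have dc := is_derive_cst (- (4 * w)) t (1 : R).
    apply: is_derive_eq (is_deriveD dc dh) _.
    by rewrite add0r -mulrN opprB.
have gw0 : 0 < g 0 + w by exact: gw.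
have gwT : 0 < g T + w by exact: gw.
rewrite /= /h.
have h1 : 4 * w ^+ 2 / (g T + w) <= 4 * w.
  rewrite ler_pdivrMr // expr2 mulrA; apply: ler_wpM2l; first by rewrite mulr_ge0 // ltW.
  by rewrite lerDr gap_ge0.
have h2 : 0 <= 4 * w ^+ 2 / (g 0 + w).
  by apply: divr_ge0; [rewrite mulr_ge0 ?sqr_ge0|exact: ltW].
by lra.
Qed.

End Pair.
End Regular.
End ClassSums.

(** * Measurability in the plane *)

Section PlaneMeasurability.
Context {R : realType}.
Notation mu := (@lebesgue_measure R).
Notation integral f := (\int[mu]_(x in [set: R]) f x).

(** An open set is a union of boxes with rational corners, which [unpickle] enumerates. This
    connects continuity with the product sigma-algebra. *)
Lemma plane_open_measurable (U : set (R * R)) : open U -> measurable U.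
Proof.
move=> oU.
pose S (p q : R * R) : set (R * R) := [set` `]p.1, p.2[] `*` [set` `]q.1, q.2[].
pose A (n : nat) : set (R * R) := if @unpickle ((rat * rat) * (rat * rat))%type n is Some (a, b) then
  let s := S (ratr a.1, ratr a.2) (ratr b.1, ratr b.2) in
  if `[< s `<=` U >] then s else set0 else set0.
have mA n : measurable (A n).
  rewrite /A; case: unpickle => [[a b]|] //=; case: asboolP => // _.
  by apply: measurableX; exact: measurable_itv.
suff -> : U = \bigcup_n A n by exact: bigcupT_measurable.
apply/seteqP; split => [[x y] Uxy|p [n _]]; last first.
  by rewrite /A; case: unpickle => [[a b]|] //=; case: asboolP => //; apply.
have /nbhs_ballP[r /= r0 br] := open_nbhs_nbhs (conj oU Uxy).
have box (z : R) : exists a b : rat, ratr a < z < ratr b /\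
    forall z', ratr a < z' < ratr b -> ball z r z'.
  have /rat_in_itvoo[a] : z - r < z by rewrite ltrBlDr ltrDl.
  have /rat_in_itvoo[b] : z < z + r by rewrite ltrDl.
  rewrite !in_itv /= => /andP[b1 b2] /andP[a1 a2]; exists a, b; split; first by rewrite a2.
  move=> z' /andP[h1 h2]; rewrite /ball /= ltr_distl.
  by rewrite -ltrBDr -ltrBlDr; apply/andP; split; lra.
have [a1 [a2 [ax ab]]] := box x; have [b1 [b2 [bx bb]]] := box y.
have [n An] : exists n, @unpickle ((rat * rat) * (rat * rat))%type n = Some ((a1, a2), (b1, b2)).
  by eexists; exact: pickleK.
exists n; first exact: I.
rewrite /A An /=; case: asboolP => [_|]; first by split; rewrite /= in_itv.
case=> -[x' y'] [/=]; rewrite !in_itv /= => hx hy.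
by apply: br; split; [exact: ab|exact: bb].
Qed.

Lemma plane_continuous_measurable (f : R * R -> R) : continuous f -> measurable_fun [set: R * R] f.
Proof.
move=> /continuousP cf; apply: (measurability _ (RGenOpens.measurableE R)).
move=> _ [_ [a [b ->] <-]]; rewrite setTI; apply: plane_open_measurable.
exact/cf/interval_open.
Qed.

(** The inverse of x is x times the real power -1 of x^2, also at x = 0, where both sides are 0. *)
Lemma measurable_invr : measurable_fun [set: R] (fun x : R => x^-1).
Proof.
rewrite (_ : (fun x => _) = fun x => x * (x ^+ 2) `^ (- 1)).
  apply: measurable_funM => //.
  exact: (measurableT_comp (measurable_powR _)).
apply/funext => x; rewrite powR_inv1 ?sqr_ge0 //.
have [->|x0] := eqVneq x 0; first by rewrite invr0 mul0r.
by field.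
Qed.

Lemma plane_slice_bms (F : R * R -> R) (K c t : R) : measurable_fun [set: R * R] F ->
  (forall p, `|F p| <= c) -> (forall p, K < `|p.1| -> F p = 0) ->
  bms (fun x => F (x, t)).
Proof.
move=> mF bF zF; split; first exact: measurable_fun_pair1.
by exists K, c => x; split => // xK; exact: zF.
Qed.

Definition plane_box (K : R) : set (R * R) := [set p | `|p.1| <= K /\ 0 <= p.2 <= K].

Lemma plane_boxE K : plane_box K = [set` `[- K, K]] `*` [set` `[0, K]].
Proof.
apply/seteqP; split => -[x t] /=; rewrite /plane_box /= !in_itv /= ler_norml.
  by case.
by case.
Qed.

Lemma plane_box_measurable K : measurable (plane_box K).
Proof. by rewrite plane_boxE; apply: measurableX; exact: measurable_itv. Qed.

Lemma plane_box_integrable (F : R * R -> R) (K c : R) :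
  measurable_fun (plane_box K) F -> (forall p, plane_box K p -> `|F p| <= c) ->
  (mu \x mu)%E.-integrable (plane_box K) (EFin \o F).
Proof.
move=> mF bF; apply: measurable_bounded_integrable => //.
- exact: plane_box_measurable.
- have mK a b : measurable [set` `[a, b] : interval R] by exact: measurable_itv.
  have E := @product_measure1E _ _ _ _ R mu mu _ _ (mK (- K) K) (mK 0 K).
  have : (mu [set` `[(- K)%R, K]] * mu [set` `[0%R, K]] < +oo)%E.
    by rewrite !lebesgue_measure_itv /=; do 2 case: ifP => // _; rewrite ?mul0e ?mule0 // -EFinM ltry.
  by rewrite -E plane_boxE; exact.
- exists c; split; first exact: num_real.
  by move=> c' cc' p pK; apply: le_trans (bF p pK) (ltW cc').
Qed.

Lemma integral_slice_bms (F : R * R -> R) (K c : R) : 0 <= K -> measurable_fun [set: R * R] F ->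
  (forall p, `|F p| <= c) -> (forall p, ~ plane_box K p -> F p = 0) ->
  bms (fun t => integral (fun x => F (x, t))).
Proof.
move=> K0 mF bF zF.
have iF : (mu \x mu)%E.-integrable [set: R * R] (EFin \o F).
  have iK : (mu \x mu)%E.-integrable (plane_box K) (EFin \o F).
    by apply: (@plane_box_integrable _ _ c) => //; exact: measurable_funTS.
  have mK : @measurable _ (measurableTypeR R * measurableTypeR R)%type (plane_box K).
    exact: plane_box_measurable.
  have := (integrable_mkcond _ mK).1 iK.
  congr (integrable _ _); apply/funext => p; rewrite patchE.
  by case: ifPn => // /negP; rewrite inE => /zF /= ->.
split.
  have := measurable_fubini_G iF; rewrite /fubini_G => mG.
  exact: (measurableT_comp (@fine_measurable R _ measurableT) mG).
have sb t : bms (fun x => F (x, t)).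
  apply: (@plane_slice_bms _ K c) => // p pK; apply: zF => -[h _].
  by move: pK; rewrite ltNge h.
have KK : - K <= K by lra.
have E : [set z : R | - K <= z <= K] = [set` `[- K, K]].
  by apply/seteqP; split => z /=; rewrite in_itv.
have [bI iI] := @integral_interval _ (fun z : R => - K <= z <= K) (- K) K KK (or_introl E).
exists K, (c * (K - - K)) => t; split.
  rewrite -iI -integralZ //; apply: norm_integral_le => //; first exact: bmsZ.
  move=> x; have [xK|xK] := boolP (- K <= x <= K); first by rewrite mulr1.
  rewrite mulr0 zF ?normr0 // => -[/=]; rewrite ler_norml => h.
  by rewrite h in xK.
move=> tK; rewrite -[RHS](@integral0' R); apply: eq_Rintegral => x _.
rewrite zF // => -[_ /= /andP[t0 tK']].
by move: tK; rewrite ger0_norm // ltNge tK'.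
Qed.

End PlaneMeasurability.

(** * The weak form at a fixed time *)

Section StripFlow.
Context {R : realType} (d : data R) {M B del : R} (H : regular_data d M B del).
Local Notation front := (front d).
Local Notation merge := (merge d).
Context (e K : R) (e0 : 0 < e) (e1 : e <= 1) (K0 : 0 <= K).

(** A strip over a point of [-K, K] has its centre within e (t + 1) <= K + 1 of this point, hence
    left of 2 K + 1. Up to time K only the first N fronts can be there. *)
Definition front_count : nat := front_bound_index d M del (2 * K + 1) K.
Local Notation N := front_count.

Lemma front_bound_index_mono X X' t t' : X <= X' -> t <= t' ->
  (front_bound_index d M del X t <= front_bound_index d M del X' t')%N.
Proof.
move=> XX tt; rewrite /front_bound_index !ltnS; apply: le_truncn.
have g0 := gap_gt0 H; rewrite ler_pM2r ?invr_gt0 //.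
have Mt : M * t <= M * t' by exact: ler_wpM2l (M_ge0 H) _ _ tt.
by lra.
Qed.

Lemma strip_index_le x t : `|x| <= K -> 0 <= t <= K ->
  (strip_index d M del e x t <= N)%N.
Proof.
move=> xK /andP[t0 tK]; apply: front_bound_index_mono => //.
have : e * (t + 1) <= 1 * (t + 1) by apply: ler_wpM2r => //; rewrite addr_ge0.
move: xK tK; lra.
Qed.

Lemma far_front k t : 0 <= t <= K -> (N <= k)%N -> K < front k t.
Proof.
move=> /andP[t0 tK] Nk; apply: (front_bound_indexP H t0).
apply: leq_trans Nk; apply: front_bound_index_mono => //. by lra.
Qed.

Lemma region_index_le x t : `|x| <= K -> 0 <= t <= K -> (region_index d x t <= N)%N.
Proof.
move=> xK tt; have /andP[t0 _] := tt.
rewrite leqNgt; apply/negP => lt; have [_ /(_ _ lt) h] := region_indexP H x t0.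
have := far_front tt (leqnn N); have := ler_norm x; lra.
Qed.

Definition node_flux (q k : nat) : R :=
  density d (region_of k) * lvel d (region_of k) ^+ q.

(* The value [al k] on the region number k, for k <= n, as a sum of jumps. *)
Definition step (n : nat) (al : nat -> R) (x t : R) : R :=
  al n + \sum_(k < n) (al k - al k.+1) * (x <= front k t)%R%:R.

Lemma stepE n al x t : 0 <= t -> (region_index d x t <= n)%N ->
  step n al x t = al (region_index d x t).
Proof.
move=> t0; set r := region_index d x t => rn.
have [h1 h2] : x <= front r t /\ forall j, (j < r)%N -> front j t < x.
  exact: (region_indexP H x t0).
rewrite /step -(big_mkord xpredT (fun k => (al k - al k.+1) * (x <= front k t)%R%:R)).
rewrite (big_cat_nat _ (n := r)) //=.
rewrite big1_seq ?add0r; last first.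
  by move=> k; rewrite mem_index_iota /= => /h2; rewrite ltNge => /negbTE ->; rewrite mulr0.
rewrite (eq_big_nat _ _ (F2 := fun k => - (al k.+1 - al k))); last first.
  move=> k /andP[rk _]; rewrite (le_trans h1 (front_mono H _ rk)) mulr1; ring.
by rewrite sumrN telescope_sumr // opprB addrC subrK.
Qed.

Definition strip_moment (q : nat) (x t : R) : R :=
  strip_sum d N (fun a b t => class_density d e a b t * class_speed d a b t ^+ q) e x t.

(* The formula is uniform in (x, t) because [strip_moment 0 / strip_moment 0] is
   1 on the strips and 0 / 0 = 0 elsewhere. *)
Definition flow (q : nat) (x t : R) : R :=
  strip_moment 0 x t * (strip_moment 1 x t / strip_moment 0 x t) ^+ q
  + (1 - strip_moment 0 x t / strip_moment 0 x t) * step N (node_flux q) x t.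

Lemma rho_approxE x t : `|x| <= K -> 0 <= t <= K -> in_some_strip d e x t ->
  rho_approx d M del e x t = strip_moment 0 x t.
Proof.
move=> xK tt st; have /andP[t0 _] := tt; rewrite /rho_approx; case: asboolP => // _.
rewrite (strip_sum_widen H _ e0 t0 (leqnn _) (strip_index_le xK tt)).
by apply: eq_bigr => a _; apply: eq_bigr => b _; rewrite expr0 mulr1.
Qed.

Lemma u_approxE x t : `|x| <= K -> 0 <= t <= K -> in_some_strip d e x t ->
  u_approx d M del e x t = strip_moment 1 x t / strip_moment 0 x t.
Proof.
move=> xK tt st; have /andP[t0 _] := tt; rewrite -rho_approxE // /rho_approx /u_approx.
case: asboolP => // _; congr (_ / _).
rewrite (strip_sum_widen H _ e0 t0 (leqnn _) (strip_index_le xK tt)).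
by apply: eq_bigr => a _; apply: eq_bigr => b _; rewrite expr1.
Qed.

Lemma strip_sum0 F n x t : ~ in_some_strip d e x t -> strip_sum d n F e x t = 0.
Proof.
move=> nst; rewrite /strip_sum big1 // => a _; rewrite big1 // => b _.
by case: asboolP => // st; case: nst; exists a, b.
Qed.

Lemma strip_moment0_gt0 x t : `|x| <= K -> 0 <= t <= K -> in_some_strip d e x t ->
  0 < strip_moment 0 x t.
Proof.
move=> xK tt [a [b st]]; have /andP[t0 _] := tt.
have [aN bN] := in_class_strip_lt H e0 t0 st (strip_index_le xK tt).
have dg a' b' : in_class_strip d e a' b' x t ->
    0 < class_density d e a' b' t * class_speed d a' b' t ^+ 0.
  by move=> st'; rewrite expr0 mulr1; exact: (class_density_gt0 H e0 t0 st').
have ge0 (a' b' : 'I_N) : 0 <= (if `[< in_class_strip d e a' b' x t >] then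
    class_density d e a' b' t * class_speed d a' b' t ^+ 0 else 0).
  by case: asboolP => // /dg /ltW.
rewrite /strip_moment /strip_sum (bigD1 (Ordinal aN)) //= (bigD1 (Ordinal bN)) //=.
rewrite -addrA; apply: ltr_wpDr; last first.
  by case: asboolP => // _; exact: dg.
apply: addr_ge0; first by apply: sumr_ge0 => b' _; exact: (ge0 (Ordinal aN) b').
by apply: sumr_ge0 => a' _; apply: sumr_ge0 => b' _; exact: ge0.
Qed.

Lemma flowE q x t : `|x| <= K -> 0 <= t <= K ->
  rho_approx d M del e x t * u_approx d M del e x t ^+ q = flow q x t.
Proof.
move=> xK tt; have /andP[t0 _] := tt; rewrite /flow.
have [st|st] := pselect (in_some_strip d e x t).
  rewrite (rho_approxE xK tt st) (u_approxE xK tt st).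
  by rewrite divff ?subrr ?mul0r ?addr0 // lt0r_neq0 // strip_moment0_gt0.
rewrite /strip_moment !strip_sum0 // mul0r invr0 mul0r subr0 mul1r add0r.
rewrite (stepE _ t0 (region_index_le xK tt)) /rho_approx /u_approx /node_flux.
case: asboolP => // _; case: (region_of _) => i //=.
by rewrite !mul0r.
Qed.

(** The mass is at most 2 B M t. The width is e t for an initial class, which compensates small t,
    and at least 2 e for all others. *)
Lemma class_density_le a b x t : 0 <= t <= K -> in_class_strip d e a b x t ->
  class_density d e a b t <= 2 * B * M * (1 + K) / e.
Proof.
move=> /andP[t0 tK] st; have [C bt td sh [tp _]] := in_class_stripP H e0 t0 st.
have B0 : 0 <= B := ltW (lt_le_trans (rhod_gt0 H 0) (rhod_le H 0)).
have BM : 0 <= B * M by rewrite mulr_ge0 // (M_ge0 H).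
rewrite ler_pdivrMr; last exact: (class_width_gt0 H e0 C bt tp).
apply: le_trans (class_mass_le H C bt (ltW td)) _.
rewrite [leRHS]mulrAC ler_pdivlMr // /class_width /class_xeps.
have [ini|_] := boolP (is_initial a b).
  rewrite (initial_birth H C ini) subr0 mulr0 addr0.
  have := mulr_ge0 (mulr_ge0 BM K0) (mulr_ge0 (ltW e0) t0); lra.
have h1 : 0 <= e * (t - class_birth d a b) by rewrite mulr_ge0 ?subr_ge0 // ltW.
have h2 := mulr_ge0 BM h1; have h3 := mulr_ge0 K0 h2.
have h4 : B * M * e * t <= B * M * e * K by apply: ler_wpM2l => //; rewrite mulr_ge0 // ltW.
have h5 := mulr_ge0 BM (ltW e0).
have h6 := mulr_ge0 h5 K0.
lra.
Qed.

Lemma in_strip_speed a b x t : 0 <= t -> in_class_strip d e a b x t ->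
  `|class_speed d a b t| <= M.
Proof.
move=> t0 st; have [C bt td sh [tp _]] := in_class_stripP H e0 t0 st.
exact: (class_speed_le H C bt (ltW td) tp).
Qed.

Lemma u_approx_bound x t : `|x| <= K -> 0 <= t <= K -> in_some_strip d e x t ->
  `|u_approx d M del e x t| <= M.
Proof.
move=> xK tt st; have /andP[t0 _] := tt.
rewrite (u_approxE xK tt st) normrM normfV.
have W0 := strip_moment0_gt0 xK tt st.
rewrite (gtr0_norm W0) ler_pdivrMr // /strip_moment /strip_sum mulr_sumr.
apply: le_trans (ler_norm_sum _ _ _) _; apply: ler_sum => a _.
rewrite mulr_sumr; apply: le_trans (ler_norm_sum _ _ _) _; apply: ler_sum => b _.
case: asboolP => [st'|_]; last by rewrite normr0 mulr0.
have dg := class_density_gt0 H e0 t0 st'.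
rewrite expr0 expr1 mulr1 normrM (gtr0_norm dg) mulrC.
by apply: ler_wpM2r; [exact: ltW|exact: in_strip_speed st'].
Qed.

(** A crude bound that is not uniform in e. It serves integrability at fixed e, not the limit. *)
Definition flow_cap (q : nat) : R :=
  (N%:R * (N%:R * (2 * B * M * (1 + K) / e)) + B) * M ^+ q.

Lemma flow_bound q x t : `|x| <= K -> 0 <= t <= K -> `|flow q x t| <= flow_cap q.
Proof.
move=> xK tt; have /andP[t0 _] := tt.
have B0 : 0 <= B := ltW (lt_le_trans (rhod_gt0 H 0) (rhod_le H 0)).
have Mq : 0 <= M ^+ q by rewrite exprn_ge0 // (M_ge0 H).
have D0 : 0 <= 2 * B * M * (1 + K) / e.
  by rewrite mulr_ge0 ?invr_ge0 ?(ltW e0) // !mulr_ge0 ?(M_ge0 H) // addr_ge0.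
have ND : 0 <= N%:R * (N%:R * (2 * B * M * (1 + K) / e)) by do 2 apply: mulr_ge0 => //.
rewrite -flowE //.
have [st|st] := pselect (in_some_strip d e x t).
  rewrite normrM normrX; apply: ler_pM => //.
    rewrite (rho_approxE xK tt st) gtr0_norm ?strip_moment0_gt0 //.
    apply: ler_wpDr => //; rewrite /strip_moment /strip_sum.
    have le1 n (F : 'I_n -> R) c : (forall i, F i <= c) -> \sum_i F i <= n%:R * c.
      move=> Fc; apply: le_trans (ler_sum _ (fun i _ => Fc i)) _.
      by rewrite sumr_const card_ord mulr_natl.
    apply: (le1) => a; apply: (@le1 N _ (2 * B * M * (1 + K) / e)) => b.
    case: asboolP => // st'; rewrite expr0 mulr1; exact: class_density_le st'.
  by rewrite lerXn2r ?nnegrE ?(M_ge0 H) ?u_approx_bound.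
rewrite /rho_approx /u_approx; case: asboolP => // _.
rewrite normrM normrX; case: (region_of _) => i /=; last first.
  by rewrite normr0 mul0r mulr_ge0 // addr_ge0.
apply: ler_pM; [exact: normr_ge0|exact: exprn_ge0| |].
  by rewrite gtr0_norm ?(rhod_gt0 H) //; apply: ler_wpDl => //; exact: (rhod_le H).
by rewrite lerXn2r ?nnegrE ?(M_ge0 H) ?(veld_le H).
Qed.

Lemma measurable_le_ereal (y : \bar R) : measurable [set t : R | (y <= t%:E)%E].
Proof.
case: y => [r||].
- rewrite (_ : [set _ | _] = [set` `[r, +oo[]); first exact: measurable_itv.
  by apply/seteqP; split => t /=; rewrite in_itv /= andbT lee_fin.
- rewrite (_ : [set _ | _] = set0) //; apply/seteqP; split => t //=.
- rewrite (_ : [set _ | _] = setT) //; apply/seteqP; split => t //= _.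
  exact: leNye.
Qed.

Lemma measurable_bool_fun (P : R -> Prop) : measurable [set t | P t] ->
  measurable_fun [set: R] (fun t => `[< P t >]).
Proof.
move=> mP; apply: (measurable_fun_bool true); rewrite setTI.
by rewrite (_ : _ @^-1` _ = [set t | P t]) //; apply/seteqP; split => t /asboolP.
Qed.

Lemma measurable_is_class_at a b : measurable [set t : R | is_class_at d a b t].
Proof.
have [ab|ab] := boolP (a <= b)%N; last first.
  rewrite (_ : [set _ | _] = set0) //; apply/seteqP; split => t //= -[].
  by rewrite (negbTE ab).
rewrite (_ : [set _ | _] =
   (\bigcap_k [set t : R | (a <= k < b)%N -> (merge k <= t%:E)%E])
   `&` ~` [set t : R | (class_death d a b <= t%:E)%E]).
  apply: measurableI; last by apply: measurableC; exact: measurable_le_ereal.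
  apply: bigcapT_measurable => k; case: (boolP (a <= k < b)%N) => kab.
    rewrite (_ : [set t | _] = [set t : R | (merge k <= t%:E)%E]).
      exact: measurable_le_ereal.
    by apply/seteqP; split => t /=; [exact|].
  by rewrite (_ : [set t | _] = setT) //; apply/seteqP; split.
apply/seteqP; split => t /=.
  by move=> [_ h td]; split; [move=> k _; exact: h|apply/negP; rewrite -ltNge].
by move=> [h /negP]; rewrite -ltNge => td; split => // k kab; exact: h.
Qed.

Let mfst : measurable_fun [set: R * R] (fst : R * R -> R) := measurable_fst.
Let msnd : measurable_fun [set: R * R] (snd : R * R -> R) := measurable_snd.

Lemma measurable_class_width a b : measurable_fun [set: R] (class_width d e a b).
Proof.
apply: measurable_funD => //; apply: measurable_funM => //.
exact: measurable_funB.
Qed.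

Lemma measurable_class_density a b : measurable_fun [set: R] (class_density d e a b).
Proof.
apply: measurable_funM.
  by apply: continuous_measurable_fun; exact: (class_mass_continuous H).
by apply: (measurableT_comp measurable_invr); exact: measurable_class_width.
Qed.

Lemma measurable_class_speed a b : measurable_fun [set: R] (class_speed d a b).
Proof.
rewrite /class_speed; case: (is_initial a b); first exact: measurable_cst.
apply: measurable_funM.
  by apply: continuous_measurable_fun; exact: (class_momentum_continuous H).
apply: (measurableT_comp measurable_invr).
by apply: continuous_measurable_fun; exact: (class_mass_continuous H).
Qed.

Lemma measurable_in_class_strip a b :
  measurable_fun [set: R * R] (fun p : R * R => `[< in_class_strip d e a b p.1 p.2 >]).
Proof.
rewrite (_ : (fun p => _) = (fun p : R * R => is_shadow d a b &&
   (`[< is_class_at d a b p.2 >] && (`|p.1 - front a p.2| < class_width d e a b p.2 / 2)))).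
  apply: measurable_and; first exact: measurable_cst.
  apply: measurable_and.
    apply: (measurableT_comp (measurable_bool_fun (measurable_is_class_at a b)) msnd).
  apply: measurable_fun_ltr.
    apply: measurableT_comp => //; apply: measurable_funB => //.
    apply: (@measurableT_comp _ _ _ _ _ _ (front a) _ snd) => //.
    by apply: continuous_measurable_fun; exact: (front_continuous H).
  apply: measurable_funM => //.
  exact: (measurableT_comp (measurable_class_width a b) msnd).
apply/funext => p; apply/asboolP/and3P => [[sh C xt]|[sh /asboolP C xt]]; split => //.
exact/asboolP.
Qed.

Lemma measurable_strip_sum n F : (forall a b, measurable_fun [set: R] (F a b)) ->
  measurable_fun [set: R * R] (fun p : R * R => strip_sum d n F e p.1 p.2).
Proof.
move=> mF; apply: measurable_sum => a; apply: measurable_sum => b.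
apply: measurable_fun_ifT => //; first exact: measurable_in_class_strip.
exact: (measurableT_comp (mF a b) msnd).
Qed.

Lemma measurable_strip_moment q :
  measurable_fun [set: R * R] (fun p : R * R => strip_moment q p.1 p.2).
Proof.
apply: measurable_strip_sum => a b; apply: measurable_funM.
  exact: measurable_class_density.
by apply: measurable_funX; exact: measurable_class_speed.
Qed.

Lemma measurable_step n al :
  measurable_fun [set: R * R] (fun p : R * R => step n al p.1 p.2).
Proof.
apply: measurable_funD => //; apply: measurable_sum => k.
apply: measurable_funM => //.
rewrite (_ : (fun p => _) = fun p : R * R => if p.1 <= front k p.2 then 1 else 0 : R); last first.
  by apply/funext => p; case: ifP.
apply: measurable_fun_ifT => //; apply: measurable_fun_ler => //.
apply: (@measurableT_comp _ _ _ _ _ _ (front k) _ snd) => //.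
by apply: continuous_measurable_fun; exact: (front_continuous H).
Qed.

Lemma measurable_flow q : measurable_fun [set: R * R] (fun p : R * R => flow q p.1 p.2).
Proof.
have m0 := measurable_strip_moment 0; have m1 := measurable_strip_moment 1.
have mV : measurable_fun [set: R * R] (fun p : R * R => (strip_moment 0 p.1 p.2)^-1).
  exact: (measurableT_comp measurable_invr m0).
apply: measurable_funD; apply: measurable_funM => //.
- by apply: measurable_funX; apply: measurable_funM.
- by apply: measurable_funB => //; apply: measurable_funM.
- exact: measurable_step.
Qed.

End StripFlow.

Arguments front_count {R} d M del K.
Arguments strip_moment {R} d M del e K q x t.
Arguments flow {R} d M del e K q x t.
Arguments flow_cap {R} d M B del e K q.

(** * Pointwise error of superposed strips *)

Section PointwiseError.
Context {R : realType} (d : data R) {M B del : R} (H : regular_data d M B del).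
Local Notation front := (front d).
Context (e K : R) (e0 : 0 < e) (e1 : e <= 1) (K0 : 0 <= K).
Local Notation N := (front_count d M del K).

Section StripSums.
Context (n : nat) (x t : R).
Local Notation S f := (strip_sum d n (fun a b _ => f a b) e x t).
Implicit Types f g : nat -> nat -> R.

Lemma strip_sumD f g : S (fun a b => f a b + g a b) = S f + S g.
Proof.
rewrite /strip_sum -big_split; apply: eq_bigr => a _; rewrite -big_split.
by apply: eq_bigr => b _ /=; case: ifP => //; rewrite addr0.
Qed.

Lemma strip_sumZ (c : R) f : S (fun a b => c * f a b) = c * S f.
Proof.
rewrite /strip_sum mulr_sumr; apply: eq_bigr => a _; rewrite mulr_sumr.
by apply: eq_bigr => b _ /=; case: ifP => //; rewrite mulr0.
Qed.

Lemma strip_sumB f g : S (fun a b => f a b - g a b) = S f - S g.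
Proof.
rewrite -[- S g]mulN1r -strip_sumZ -strip_sumD.
by apply: eq_bigr => a _; apply: eq_bigr => b _; rewrite mulN1r.
Qed.

Lemma strip_sum_le f g : (forall a b, in_class_strip d e a b x t -> f a b <= g a b) ->
  S f <= S g.
Proof.
move=> fg; apply: ler_sum => a _; apply: ler_sum => b _.
by case: asboolP => // /fg.
Qed.

Lemma eq_strip_sum f g : (forall a b, in_class_strip d e a b x t -> f a b = g a b) ->
  S f = S g.
Proof.
move=> fg; apply: eq_bigr => a _; apply: eq_bigr => b _.
by case: asboolP => // /fg.
Qed.

Lemma strip_sum_norm f : `|S f| <= S (fun a b => `|f a b|).
Proof.
apply: le_trans (ler_norm_sum _ _ _) _; apply: ler_sum => a _.
apply: le_trans (ler_norm_sum _ _ _) _; apply: ler_sum => b _.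
by case: ifP => //; rewrite normr0.
Qed.

Lemma strip_sum_ge f a b : (a < n)%N -> (b < n)%N -> in_class_strip d e a b x t ->
  (forall a b, in_class_strip d e a b x t -> 0 <= f a b) -> f a b <= S f.
Proof.
move=> an bn st f0.
have ge0 (i j : 'I_n) : 0 <= (if `[< in_class_strip d e i j x t >] then f i j else 0).
  by case: asboolP => // /f0.
rewrite /strip_sum (bigD1 (Ordinal an)) //= (bigD1 (Ordinal bn)) //=.
case: asboolP => // _; rewrite -addrA lerDl; apply: addr_ge0.
  by apply: sumr_ge0 => j _; exact: (ge0 (Ordinal an) j).
by apply: sumr_ge0 => i _; apply: sumr_ge0 => j _; exact: ge0.
Qed.

End StripSums.

Context (x t : R) (tK : 0 < t <= K).
Local Notation S f := (strip_sum d N (fun a b _ => f a b) e x t).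
Local Notation dens a b := (class_density d e a b t).
Local Notation vel a b := (class_speed d a b t).

Let t0 : 0 <= t. Proof. by case/andP: tK => /ltW. Qed.
Let tt : 0 <= t <= K. Proof. by case/andP: tK => /ltW -> ->. Qed.

Definition velocity_spread : R :=
  S (fun a b => S (fun a' b' => dens a' b' * (vel a' b' - vel a b) ^+ 2)).

Lemma velocity_spread_ge0 : 0 <= velocity_spread.
Proof.
apply: strip_sum_ge0 => a b _; apply: strip_sum_ge0 => a' b' st.
by rewrite mulr_ge0 ?sqr_ge0 // ltW // (class_density_gt0 H e0 t0 st).
Qed.

(* The variance of the velocity is at most its second moment about any of its values. *)
Lemma moment_defect p : (p <= 1)%N -> `|x| <= K -> in_some_strip d e x t ->
  `|strip_moment d M del e K 0 x t * (strip_moment d M del e K 1 x t / strip_moment d M del e K 0 x t) ^+ p.+1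
    - strip_moment d M del e K p.+1 x t| <= velocity_spread.
Proof.
move=> p1 xK nst; have W0 := strip_moment0_gt0 H e0 e1 xK tt nst.
have [a [b st]] := nst.
have [aN bN] := in_class_strip_lt H e0 t0 st (strip_index_le H e1 xK tt).
set w0 := strip_moment _ _ _ _ _ 0 _ _ in W0 *; set w1 := strip_moment _ _ _ _ _ 1 _ _.
(* The momentum of superposed strips is exact by construction; only the second power of the velocity
   has a defect. *)
case: p p1 => [|[|]] // _.
  rewrite expr1 mulrC divfK ?subrr ?normr0 ?velocity_spread_ge0 //.
  exact: lt0r_neq0.
set w2 := strip_moment _ _ _ _ _ 2 _ _.
pose v := vel a b.
have w0E : w0 = S (fun a b => dens a b).
  apply: (@eq_strip_sum N x t (fun a b => dens a b * vel a b ^+ 0)) => i j _.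
  by rewrite expr0 mulr1.
have w1E : w1 = S (fun a b => dens a b * vel a b).
  apply: (@eq_strip_sum N x t (fun a b => dens a b * vel a b ^+ 1)) => i j _.
  by rewrite expr1.
have w2E : w2 = S (fun a b => dens a b * vel a b ^+ 2) by [].
have E c : S (fun a' b' => dens a' b' * (vel a' b' - c) ^+ 2) = w2 - 2 * c * w1 + c ^+ 2 * w0.
  rewrite w0E w1E w2E -!strip_sumZ -strip_sumB -strip_sumD.
  by apply: eq_strip_sum => a' b' _; ring.
have le : S (fun a' b' => dens a' b' * (vel a' b' - v) ^+ 2) <= velocity_spread.
  apply: (@strip_sum_ge N x t (fun a b => S (fun a' b' => dens a' b' * (vel a' b' - vel a b) ^+ 2)) a b aN bN st).
  move=> i j _; apply: strip_sum_ge0 => a' b' st'.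
  by rewrite mulr_ge0 ?sqr_ge0 // ltW // (class_density_gt0 H e0 t0 st').
(* The second moment about c is the variance term plus the mass times the squared distance from c to
   the mean velocity. *)
have F c : w2 - 2 * c * w1 + c ^+ 2 * w0 = (w2 - w0 * (w1 / w0) ^+ 2) + w0 * (c - w1 / w0) ^+ 2.
  by field; exact: lt0r_neq0.
have g0 c : 0 <= w2 - 2 * c * w1 + c ^+ 2 * w0.
  rewrite -E; apply: strip_sum_ge0 => a' b' st'.
  by rewrite mulr_ge0 ?sqr_ge0 // ltW // (class_density_gt0 H e0 t0 st').
have := g0 (w1 / w0); rewrite F subrr expr0n mulr0 addr0 => pos.
rewrite distrC ger0_norm //; apply: le_trans le; rewrite E F.
by rewrite lerDl mulr_ge0 ?sqr_ge0 // ltW.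
Qed.

Context (f : R * R -> R) (tf : tame K f) (L : R).
Hypotheses (L0 : 0 <= L) (fx_le : forall p, `|dx f p| <= L) (ft_le : forall p, `|dt f p| <= L)
  (fx_lip : lipschitz2 L (dx f)) (ft_lip : lipschitz2 L (dt f)).

Definition transport (a b : nat) : R :=
  dt f (front a t, t) + vel a b * dx f (front a t, t).

Lemma step_bound (q k : nat) (y : R) : `|y| <= K ->
  `|step d N (node_flux d q) y t| <= B * M ^+ q.
Proof.
move=> yK; rewrite (stepE H _ t0 (region_index_le H yK tt)) /node_flux.
have B0 : 0 <= B := ltW (lt_le_trans (rhod_gt0 H 0) (rhod_le H 0)).
have Mq : 0 <= M ^+ q by rewrite exprn_ge0 // (M_ge0 H).
case: (region_of _) => i /=; last by rewrite mul0r normr0 mulr_ge0.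
rewrite normrM normrX; apply: ler_pM; [exact: normr_ge0|exact: exprn_ge0| |].
  by rewrite gtr0_norm ?(rhod_gt0 H) // (rhod_le H).
by rewrite lerXn2r ?nnegrE ?(M_ge0 H) ?(veld_le H).
Qed.

Let w := e * (K + 2).

Lemma transport_error p a b : in_class_strip d e a b x t ->
  `|dens a b * vel a b ^+ p * (dt f (x, t) + vel a b * dx f (x, t)) -
    dens a b * vel a b ^+ p * transport a b| <=
  dens a b * (M ^+ p * (1 + M) * L * w).
Proof.
move=> st; have dg := class_density_gt0 H e0 t0 st; have vM := in_strip_speed H e0 t0 st.
have [_ _ xX] := st; have M0 := M_ge0 H.
have ww : `|x - front a t| <= w.
  have [C bt _ _ [tp _]] := in_class_stripP H e0 t0 st.
  have h1 := class_width_gt0 H e0 C bt tp.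
  have h2 : class_width d e a b t <= w.
    apply: le_trans (class_width_le d a b t e0) _; rewrite ler_pM2l // lerD2r.
    by case/andP: tK.
  apply: le_trans (ltW xX) (le_trans _ h2).
  by rewrite ler_pdivrMr // ler_peMr ?ler1n // ltW.
rewrite -mulrBr normrM normrM (gtr0_norm dg); move: (dens a b) dg => D dg.
rewrite -!mulrA; apply: ler_wpM2l; first exact: ltW.
apply: ler_pM => //; first by rewrite normrX lerXn2r ?nnegrE.
have l1 : `|dt f (x, t) - dt f (front a t, t)| <= L * w.
  apply: le_trans (ft_lip _ _ _ _) _; rewrite subrr normr0 addr0.
  exact: ler_wpM2l.
have l2 : `|dx f (x, t) - dx f (front a t, t)| <= L * w.
  apply: le_trans (fx_lip _ _ _ _) _; rewrite subrr normr0 addr0.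
  exact: ler_wpM2l.
rewrite /transport.
have -> : dt f (x, t) + vel a b * dx f (x, t) -
    (dt f (front a t, t) + vel a b * dx f (front a t, t)) =
    (dt f (x, t) - dt f (front a t, t)) + vel a b * (dx f (x, t) - dx f (front a t, t)).
  by ring.
apply: le_trans (ler_normD _ _) _; rewrite mulrDl mul1r; apply: lerD => //.
by rewrite normrM; apply: ler_pM.
Qed.

(** The integrand of the weak form minus that of the ideal solution, where the point charges are
    spread over the strips but tested with the derivative of f along the front. *)
Definition flow_error (p : nat) : R :=
  flow d M del e K p x t * dt f (x, t) + flow d M del e K p.+1 x t * dx f (x, t)
  - (step d N (node_flux d p) x t * dt f (x, t) + step d N (node_flux d p.+1) x t * dx f (x, t))
  - S (fun a b => dens a b * vel a b ^+ p * transport a b).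

(** Three errors: the region values hidden by the strips, the variation of the test function across
    a strip of width at most w, and the variance of overlapping velocities in the flux. *)
Lemma flow_error_le p : (p <= 1)%N ->
  `|flow_error p| <=
    S (fun a b => B * M ^+ p * (1 + M) * L + dens a b * (M ^+ p * (1 + M) * L * w))
    + L * velocity_spread.
Proof.
move=> p1; have M0 := M_ge0 H.
have B0 : 0 <= B := ltW (lt_le_trans (rhod_gt0 H 0) (rhod_le H 0)).
have sp := velocity_spread_ge0.
have c0 : 0 <= B * M ^+ p * (1 + M) * L by rewrite !mulr_ge0 ?exprn_ge0 ?addr_ge0.
pose T := S (fun a b => dens a b * vel a b ^+ p * (dt f (x, t) + vel a b * dx f (x, t)))
  - S (fun a b => dens a b * vel a b ^+ p * transport a b).
have leT : `|T| <= S (fun a b => dens a b * (M ^+ p * (1 + M) * L * w)).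
  rewrite /T -strip_sumB; apply: le_trans (strip_sum_norm _ _ _ _) _.
  by apply: strip_sum_le => a b; exact: transport_error.
have TE : T = strip_moment d M del e K p x t * dt f (x, t)
     + strip_moment d M del e K p.+1 x t * dx f (x, t)
  - S (fun a b => dens a b * vel a b ^+ p * transport a b).
  have Wq q : strip_moment d M del e K q x t = S (fun a b => dens a b * vel a b ^+ q) by [].
  congr (_ - _); transitivity (dt f (x, t) * S (fun a b => dens a b * vel a b ^+ p)
    + dx f (x, t) * S (fun a b => dens a b * vel a b ^+ p.+1)); last first.
    by rewrite -!Wq; congr (_ + _); exact: mulrC.
  rewrite -strip_sumZ -strip_sumZ -strip_sumD.
  by apply: eq_strip_sum => a b _; rewrite exprS; ring.
rewrite strip_sumD.
have sc0 : 0 <= S (fun _ _ => B * M ^+ p * (1 + M) * L) by exact: strip_sum_ge0.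
have Ls : 0 <= L * velocity_spread by rewrite mulr_ge0.
have [xK|xK] := leP `|x| K; last first.
  have fz : dt f (x, t) = 0 /\ dx f (x, t) = 0.
    by split; [case: (tame_dt tf) => _|case: (tame_dx tf) => _]; apply; rewrite /= xK.
  have -> : flow_error p = T by rewrite /flow_error TE; case: fz => -> ->; ring.
  lra.
have [nst|nst] := pselect (in_some_strip d e x t); last first.
  have -> : flow_error p = 0.
    rewrite /flow_error /flow /strip_moment !strip_sum0 // !(mul0r, invr0, subr0, mul1r, add0r).
    by rewrite subrr.
  rewrite normr0; have := le_trans (normr_ge0 _) leT; lra.
have W0 := strip_moment0_gt0 H e0 e1 xK tt nst.
have md := moment_defect p1 xK nst.
set w0 := strip_moment _ _ _ _ _ 0 _ _ in W0 md; set w1 := strip_moment _ _ _ _ _ 1 _ _ in md.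
have wp : w0 * (w1 / w0) ^+ p = strip_moment d M del e K p x t.
  case: p p1 {md T leT TE c0 sc0} => [|[|]] // _; first by rewrite expr0 mulr1.
  by rewrite expr1 mulrC divfK // lt0r_neq0.
pose G := step d N (node_flux d p) x t * dt f (x, t) + step d N (node_flux d p.+1) x t * dx f (x, t).
have -> : flow_error p = T - G +
    (w0 * (w1 / w0) ^+ p.+1 - strip_moment d M del e K p.+1 x t) * dx f (x, t).
  rewrite /flow_error TE /flow -/w0 -/w1 divff ?lt0r_neq0 // subrr !mul0r !addr0 wp /G.
  by ring.
have leG : `|G| <= S (fun _ _ => B * M ^+ p * (1 + M) * L).
  have [a [b st]] := nst.
  have [aN bN] := in_class_strip_lt H e0 t0 st (strip_index_le H e1 xK tt).
  apply: le_trans (@strip_sum_ge N x t (fun _ _ => B * M ^+ p * (1 + M) * L) a b aN bN st (fun _ _ _ => c0)).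
  apply: le_trans (ler_normD _ _) _; rewrite !normrM.
  have -> : B * M ^+ p * (1 + M) * L = B * M ^+ p * L + B * M ^+ p.+1 * L by rewrite exprS; ring.
  by apply: lerD; apply: ler_pM => //; exact: step_bound.
have h3 : `|(w0 * (w1 / w0) ^+ p.+1 - strip_moment d M del e K p.+1 x t) * dx f (x, t)| <=
    L * velocity_spread.
  by rewrite normrM mulrC; apply: ler_pM.
apply: le_trans (ler_normD _ _) _; apply: lerD => //.
by apply: le_trans (ler_normB _ _) _; rewrite addrC; exact: lerD.
Qed.

End PointwiseError.

Arguments flow_error {R} d M del e K x t f p.
Arguments velocity_spread {R} d M del e K x t.

(** * The error integrated in space *)

Section IntegratedError.
Context {R : realType} (d : data R) {M B del : R} (H : regular_data d M B del).
Local Notation front := (front d).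
Notation mu := (@lebesgue_measure R).
Notation integral f := (\int[mu]_(x in [set: R]) f x).
Context (e K : R) (e0 : 0 < e) (e1 : e <= 1) (K0 : 0 <= K).
Local Notation N := (front_count d M del K).

Section Strips.
Context (n : nat) (t : R) (t0 : 0 < t).

Lemma strip_indicator a b :
  bms (fun x => `[< in_class_strip d e a b x t >]%:R : R) /\
  integral (fun x => `[< in_class_strip d e a b x t >]%:R : R) =
    (if `[< is_class_at d a b t >] && is_shadow d a b then class_width d e a b t else 0).
Proof.
have [/andP[/asboolP C sh]|nC] := boolP (`[< is_class_at d a b t >] && is_shadow d a b); last first.
  rewrite (_ : (fun x => _) = fun=> 0); first by split; [exact: bms0|exact: integral0'].
  apply/funext => x; case: asboolP => // -[sh C _]; case/negP: nC.
  by rewrite sh andbT; exact/asboolP.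
have [Cc bt td] := (is_class_atP d _ _ (ltW t0)).1 C.
have w0 := class_width_gt0 H e0 Cc bt t0.
set w := class_width d e a b t in w0 *; set X := front a t.
have Xw : X - w / 2 <= X + w / 2 by lra.
have E : [set x | `[< in_class_strip d e a b x t >]] = [set` `]X - w / 2, X + w / 2[].
  apply/seteqP; split => x /=; rewrite in_itv /= -ltr_distl.
    by case/asboolP.
  by move=> xX; apply/asboolP; split.
have [h1 h2] := @integral_interval _ (fun x => `[< in_class_strip d e a b x t >]) _ _ Xw (or_intror (or_intror E)).
by split => //; rewrite h2; lra.
Qed.

Lemma strip_sumE (f : nat -> nat -> R) : (fun x => strip_sum d n (fun a b _ => f a b) e x t) =
  (fun x => \sum_(a < n) \sum_(b < n) f a b * `[< in_class_strip d e a b x t >]%:R).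
Proof.
apply/funext => x; apply: eq_bigr => a _; apply: eq_bigr => b _.
by case: ifP; rewrite ?mulr1 ?mulr0.
Qed.

Lemma strip_sum_bms (f : nat -> nat -> R) :
  bms (fun x => strip_sum d n (fun a b _ => f a b) e x t).
Proof.
rewrite strip_sumE; apply: bms_sum => a _; apply: bms_sum => b _; apply: bmsZ.
by case: (strip_indicator a b).
Qed.

Lemma strip_sum_integral (f : nat -> nat -> R) :
  integral (fun x => strip_sum d n (fun a b _ => f a b) e x t) =
  class_sum d n (fun a b => if is_shadow d a b then f a b * class_width d e a b t else 0) t.
Proof.
have sb (a b : nat) : bms (fun x => f a b * `[< in_class_strip d e a b x t >]%:R).
  by apply: bmsZ; case: (strip_indicator a b).
rewrite strip_sumE integral_bigsum; last by move=> a _; exact: bms_sum.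
apply: eq_bigr => a _; rewrite integral_bigsum //.
apply: eq_bigr => b _; rewrite integralZ; last by case: (strip_indicator a b).
rewrite (strip_indicator a b).2.
by case: (`[< is_class_at d a b t >]) => /=; case: (is_shadow d a b); rewrite ?mulr0.
Qed.

End Strips.

Context (n : nat).
Hypothesis nN : forall a b k t, 0 <= t <= K -> is_class_at d a b t ->
  (a <= k <= b)%N -> (k < N)%N -> (b <= n)%N.
Context (t : R) (tK : 0 < t < K) (tE : t \notin merge_times d n).

Let t0 : 0 < t. Proof. by case/andP: tK. Qed.
Let tK' : 0 < t <= K. Proof. by case/andP: tK => -> /ltW. Qed.
Let tt : 0 <= t <= K. Proof. by case/andP: tK => /ltW -> /ltW. Qed.

Let w := e * (K + 2).
Let mb := B * (2 * M * K).
Local Notation dens a b := (class_density d e a b t).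
Local Notation vel a b := (class_speed d a b t).

(** A pair of shadow classes is represented by their last fronts. These have positive indices, where
    front speeds are monotone, even if a class contains front 0. The length e (K + 2) dominates all
    strip widths up to time K. *)
Definition collision_rate (b b' : nat) (s : R) : R :=
  if (0 < b)%N && (0 < b')%N then pair_rate d (e * (K + 2)) (minn b b') (maxn b b') s else 0.

Lemma shadow_snd_gt0 a b : (a <= b)%N -> is_shadow d a b -> (0 < b)%N.
Proof. by case: b => //; rewrite leqn0 => /eqP ->; rewrite /is_shadow /= ltxx. Qed.

Let w0 : 0 < w.
Proof. by rewrite mulr_gt0 // ltr_wpDl. Qed.

Lemma collision_rate_ge0 b b' : (b < N)%N -> (b' < N)%N -> 0 <= collision_rate b b' t.
Proof.
move=> bN bN'; rewrite /collision_rate; case: ifP => // /andP[b0 b0'].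
apply: (pair_rate_ge0 H nN) => //; rewrite ?gtn_max ?bN ?bN' ?leq_min ?b0 //.
by rewrite geq_min leq_maxl.
Qed.

Lemma class_front_snd a b : is_class_at d a b t -> front b t = front a t.
Proof. by move=> [ab h _]; apply: (front_class H (ltW t0) h); rewrite ab leqnn. Qed.

Lemma collision_rate_ge a b a' b' : is_class_at d a b t -> is_class_at d a' b' t ->
  is_shadow d a b -> is_shadow d a' b' -> (b < N)%N -> (b' < N)%N ->
  `|front a t - front a' t| < w -> `|vel a b - vel a' b'| <= collision_rate b b' t.
Proof.
move=> C C' sh sh' bN bN'.
rewrite -(class_front_snd C) -(class_front_snd C').
have ab : (a <= b <= b)%N by have [-> _ _] := C; rewrite leqnn.
have ab' : (a' <= b' <= b')%N by have [-> _ _] := C'; rewrite leqnn.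
have b0 : (0 < b)%N by apply: shadow_snd_gt0 sh; case/andP: ab.
have b0' : (0 < b')%N by apply: shadow_snd_gt0 sh'; case/andP: ab'.
rewrite -(regular_class_speed H nN tK tE bN C ab) -(regular_class_speed H nN tK tE bN' C' ab').
rewrite /collision_rate b0 b0' /=.
have main k l : (0 < k)%N -> (k <= l)%N -> (l < N)%N -> `|front k t - front l t| < w ->
    `|front_speed d k t - front_speed d l t| <= pair_rate d w k l t.
  move=> k0 kl lN; rewrite distrC ger0_norm ?subr_ge0 ?(front_mono H) // => fw.
  rewrite ger0_norm ?subr_ge0; last exact: (regular_front_speed_mono H nN tK tE).
  exact: (pair_rate_ge H nN k0 kl lN tK tE fw).
have [bb|/ltnW bb] := leqP b b'.
  exact: main.
rewrite (distrC (front b t)) (distrC (front_speed _ b _)).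
exact: main.
Qed.

Lemma class_mass_cap a b : is_class_at d a b t -> class_mass d a b t <= mb.
Proof.
move=> C; have [Cc bt td] := (is_class_atP d _ _ (ltW t0)).1 C.
apply: le_trans (class_mass_le H Cc bt (ltW td)) _; apply: ler_wpM2l.
  exact: ltW (lt_le_trans (rhod_gt0 H 0) (rhod_le H 0)).
by apply: ler_wpM2l; [rewrite mulr_ge0 // (M_ge0 H)|case/andP: tt].
Qed.

Lemma density_width a b : is_class_at d a b t -> dens a b * class_width d e a b t = class_mass d a b t.
Proof.
move=> C; have [Cc bt td] := (is_class_atP d _ _ (ltW t0)).1 C.
by rewrite /class_density divfK // lt0r_neq0 // (class_width_gt0 H e0 Cc bt t0).
Qed.

Lemma class_width_cap a b : is_class_at d a b t -> 0 < class_width d e a b t <= w.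
Proof.
move=> C; have [Cc bt td] := (is_class_atP d _ _ (ltW t0)).1 C.
rewrite (class_width_gt0 H e0 Cc bt t0) /=; apply: le_trans (class_width_le d a b t e0) _.
by rewrite ler_pM2l // lerD2r; case/andP: tt.
Qed.

(** Two strips over the same x have fronts closer than w. Replacing the membership of x in the outer
    strip by this condition leaves a single strip density to be integrated in x. *)
Definition spread_bound (x : R) : R :=
  class_sum d N (fun a b => if is_shadow d a b then
    strip_sum d N (fun a' b' _ => if `|front a' t - front a t| < w then
      dens a' b' * (vel a' b' - vel a b) ^+ 2 else 0) e x t else 0) t.

Lemma velocity_spread_le x : velocity_spread d M del e K x t <= spread_bound x.
Proof.
rewrite /velocity_spread /spread_bound; apply: ler_sum => a _; apply: ler_sum => b _.
case: asboolP => [[sh C xX]|_].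
  case: asboolP => // _; rewrite sh; apply: strip_sum_le => a' b' [sh' C' xX'].
  have /andP[_ w1] := class_width_cap C; have /andP[_ w2] := class_width_cap C'.
  have c1 : `|front a' t - x| < w / 2.
    by rewrite distrC; apply: lt_le_trans xX' _; rewrite ler_pM2r.
  have c2 : `|x - front a t| < w / 2 by apply: lt_le_trans xX _; rewrite ler_pM2r.
  have : `|front a' t - front a t| < w.
    have -> : front a' t - front a t = (front a' t - x) + (x - front a t) by ring.
    by apply: le_lt_trans (ler_normD _ _) _; rewrite [w]splitr; exact: ltrD.
  by move=> ->.
case: ifP => // _; case: ifP => // _; apply: strip_sum_ge0 => a' b' st.
case: ifP => // _; rewrite mulr_ge0 ?sqr_ge0 // ltW //.
exact: (class_density_gt0 H e0 (ltW t0) st).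
Qed.

Lemma spread_bound_bms : bms spread_bound.
Proof.
apply: bms_sum => a _; apply: bms_sum => b _; apply: bms_if => _; apply: bms_if => _.
exact: strip_sum_bms.
Qed.

Lemma sum_collision_le (c : R) : 0 <= c ->
  class_sum d N (fun a b => if is_shadow d a b then
    class_sum d N (fun a' b' => if is_shadow d a' b' then
      (if `|front a' t - front a t| < w then c * `|vel a' b' - vel a b| else 0) else 0) t else 0) t
  <= c * \sum_(b < N) \sum_(b' < N) collision_rate b b' t.
Proof.
move=> c0.
have r0 (b b' : 'I_N) : 0 <= collision_rate b b' t by exact: collision_rate_ge0.
pose r b b' := if (b < N)%N && (b' < N)%N then collision_rate b b' t else 0.
have r_ge0 b b' : 0 <= r b b'.
  by rewrite /r; case: ifP => // /andP[bN bN']; exact: collision_rate_ge0.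
have rE (b b' : 'I_N) : r b b' = collision_rate b b' t by rewrite /r !ltn_ord.
apply: (@le_trans _ _ (class_sum d N (fun a b => c * \sum_(b' < N) r b b') t)).
  apply: class_sum_le => a b bN C; case: ifP => sh; last first.
    by apply: mulr_ge0 => //; exact: sumr_ge0.
  rewrite mulr_sumr; apply: (@le_trans _ _ (class_sum d N (fun a' b' => c * r b b') t)).
    apply: class_sum_le => a' b' bN' C'; case: ifP => sh'; last by rewrite mulr_ge0.
    case: ifP => cl; last by rewrite mulr_ge0.
    apply: ler_wpM2l => //; rewrite distrC /r bN bN' /=.
    by apply: (collision_rate_ge C C') => //; rewrite distrC.
  by apply: (@class_sum_le_snd _ d N (fun b' => c * r b b')) => b'; rewrite mulr_ge0.
apply: le_trans (@class_sum_le_snd _ d N (fun b => c * \sum_(b' < N) r b b') t _) _.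
  by move=> b; rewrite mulr_ge0 // sumr_ge0.
rewrite mulr_sumr; apply: ler_sum => b _; apply: ler_wpM2l => //.
by apply: ler_sum => b' _; rewrite rE.
Qed.

(** The density of one strip integrates to its mass, at most [mb], and |v' - v|^2 <= 2 M |v' - v|
    makes the bound linear in the closing speed. *)
Lemma spread_bound_integral :
  integral spread_bound <= 2 * M * mb * \sum_(b < N) \sum_(b' < N) collision_rate b b' t.
Proof.
have M0 := M_ge0 H.
have mb0 : 0 <= mb.
  have B0 : 0 <= B := ltW (lt_le_trans (rhod_gt0 H 0) (rhod_le H 0)).
  by rewrite /mb !mulr_ge0.
apply: le_trans (sum_collision_le _); last by rewrite mulr_ge0 // mulr_ge0.
rewrite /spread_bound integral_bigsum; last first.
  move=> a _; apply: bms_sum => b _; apply: bms_if => _; apply: bms_if => _.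
  exact: strip_sum_bms.
apply: ler_sum => a _; rewrite integral_bigsum; last first.
  by move=> b _; apply: bms_if => _; apply: bms_if => _; exact: strip_sum_bms.
apply: ler_sum => b _ /=; case: asboolP => [C|_]; last by rewrite integral0'.
case: ifP => sh; last by rewrite integral0'.
rewrite strip_sum_integral //=; apply: class_sum_le => a' b' bN' C'.
case: ifP => // sh'; case: ifP => cl; last by rewrite mul0r.
have m0 : 0 <= class_mass d a' b' t.
  have [Cc bt td] := (is_class_atP d _ _ (ltW t0)).1 C'.
  exact: (class_mass_ge0 H Cc bt (ltW td)).
have vM i j : is_class_at d i j t -> `|vel i j| <= M.
  move=> Ci; have [Cc bt td] := (is_class_atP d _ _ (ltW t0)).1 Ci.
  exact: (class_speed_le H Cc bt (ltW td) t0).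
rewrite mulrAC (density_width C') -real_normK ?num_real // expr2 mulrA mulrC [leRHS]mulrC.
apply: ler_wpM2l => //; rewrite [leRHS]mulrC; apply: ler_pM => //.
  exact: class_mass_cap.
apply: le_trans (ler_normB _ _) _; have := vM _ _ C; have := vM _ _ C'; lra.
Qed.

End IntegratedError.

Arguments spread_bound {R} d M del e K t x.

(** * Comparison with the ideal solution at a fixed time *)

Section FlowPairing.
Context {R : realType} (d : data R) {M B del : R} (H : regular_data d M B del).
Local Notation front := (front d).
Notation mu := (@lebesgue_measure R).
Notation integral f := (\int[mu]_(x in [set: R]) f x).
Context (e K : R) (e0 : 0 < e) (e1 : e <= 1) (K0 : 0 <= K).
Local Notation N := (front_count d M del K).
Context (n : nat).
Hypothesis nN : forall a b k t, 0 <= t <= K -> is_class_at d a b t ->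
  (a <= k <= b)%N -> (k < N)%N -> (b <= n)%N.
Context (t : R) (tK : 0 < t < K) (tE : t \notin merge_times d n).

Let t0 : 0 < t. Proof. by case/andP: tK. Qed.
Let tK' : 0 < t <= K. Proof. by case/andP: tK => -> /ltW. Qed.
Let tt : 0 <= t <= K. Proof. by case/andP: tK => /ltW -> /ltW. Qed.

Let w := e * (K + 2).
Let mb := B * (2 * M * K).
Local Notation dens a b := (class_density d e a b t).
Local Notation vel a b := (class_speed d a b t).

Context (f : R * R -> R) (tf : tame K f) (L : R).
Hypotheses (L0 : 0 <= L) (fx_le : forall p, `|dx f p| <= L) (ft_le : forall p, `|dt f p| <= L)
  (fx_lip : lipschitz2 L (dx f)) (ft_lip : lipschitz2 L (dt f)).

Lemma step_bms_mul m al (g : R * R -> R) : tame K g -> bms (fun x => step d m al x t * g (x, t)).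
Proof.
move=> tg; rewrite (_ : (fun x => _) = fun x => al m * g (x, t) +
    \sum_(k < m) (al k - al k.+1) * ((x <= front k t)%R%:R * g (x, t))).
  apply: bmsD; first by apply: bmsZ; exact: slice_bms tg.
  by apply: bms_sum => k _; apply: bmsZ; exact: half_bms tg.
apply/funext => x; rewrite /step mulrDl mulr_suml; congr (_ + _).
by apply: eq_bigr => k _; rewrite mulrA.
Qed.

Lemma step_integral m al (g : R * R -> R) : tame K g ->
  integral (fun x => step d m al x t * g (x, t)) =
  al m * integral (fun x => g (x, t)) + \sum_(k < m) (al k - al k.+1) * prim_x g (front k t, t).
Proof.
move=> tg; rewrite (_ : (fun x => _) = fun x => al m * g (x, t) +
    \sum_(k < m) (al k - al k.+1) * ((x <= front k t)%R%:R * g (x, t))); last first.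
  apply/funext => x; rewrite /step mulrDl mulr_suml; congr (_ + _).
  by apply: eq_bigr => k _; rewrite mulrA.
have hb (k : 'I_m) : bms (fun x => (al k - al k.+1) * ((x <= front k t)%R%:R * g (x, t))).
  by apply: bmsZ; exact: half_bms tg.
rewrite integralD; [|by apply: bmsZ; exact: slice_bms tg|by apply: bms_sum => k _; exact: hb].
rewrite integralZ; last exact: slice_bms tg.
congr (_ + _); rewrite integral_bigsum; last by move=> k _; exact: hb.
by apply: eq_bigr => k _; rewrite integralZ //; exact: half_bms tg.
Qed.

Definition charge (p k : nat) : R -> R :=
  if p is 0 then mass_charge d k else momentum_charge d k.

Let psi k : R := dt f (front k t, t) + front_speed d k t * dx f (front k t, t).

(** Fronts are grouped into classes. There [psi] is constant, and it vanishes on classes reaching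
    index N, which lie right of the support. The charges of a class add up to mass times speed^p,
    and contacts carry no mass. *)
Lemma charge_sum p : (p <= 1)%N ->
  \sum_(k < N) charge p k t * psi k =
  integral (fun x => strip_sum d N (fun a b _ => dens a b * vel a b ^+ p * transport d t f a b) e x t).
Proof.
move=> p1; rewrite (strip_sum_integral H e0 N t0).
have far k : (N <= k)%N -> dt f (front k t, t) = 0 /\ dx f (front k t, t) = 0.
  move=> Nk; have kK : K < `|front k t|.
    by apply: lt_le_trans (ler_norm _); exact: (far_front H tt).
  by split; [case: (tame_dt tf) => _|case: (tame_dx tf) => _]; apply; rewrite /= kK.
have psiE a b k : (b < N)%N -> is_class_at d a b t -> (a <= k <= b)%N -> psi k = transport d t f a b.
  move=> bN C kab; have kN : (k < N)%N by case/andP: kab => _ kb; exact: leq_ltn_trans bN.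
  rewrite /psi /transport (regular_class_speed H nN tK tE kN C kab).
  by have [_ h _] := C; rewrite (front_class H (ltW t0) h kab).
have psi0 a b k : (N <= b)%N -> is_class_at d a b t -> (a <= k <= b)%N -> psi k = 0.
  move=> Nb C kab; have [ab h _] := C; have [z1 z2] := far _ Nb.
  have bE : front b t = front a t by apply: (front_class H (ltW t0) h); rewrite ab leqnn.
  by rewrite /psi (front_class H (ltW t0) h kab) -bE z1 z2 mulr0 addr0.
have aab a b : is_class_at d a b t -> (a <= a <= b)%N by move=> [ab _ _]; rewrite leqnn.
rewrite (class_sum_group H (fun k => charge p k t) (ltW t0)); first last.
- by move=> a b C Nb; apply: psi0 C (aab _ _ C).
- move=> a b k C kab; have [bN|Nb] := ltnP b N.
    by rewrite (psiE _ _ _ bN C kab) (psiE _ _ _ bN C (aab _ _ C)).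
  by rewrite (psi0 _ _ _ Nb C kab) (psi0 _ _ _ Nb C (aab _ _ C)).
apply: eq_class_sum => a b bN C; rewrite (psiE _ _ _ bN C (aab _ _ C)).
have [Cc bt td] := (is_class_atP d _ _ (ltW t0)).1 C.
have -> : \sum_(a <= k < b.+1) charge p k t = class_mass d a b t * vel a b ^+ p.
  case: p p1 => [|[|]] // _; first by rewrite expr0 mulr1 (class_sum_mass_charge H (ltW t0) C).
  by rewrite expr1 (class_speedE H Cc bt (ltW td) t0) (class_sum_momentum_charge H (ltW t0) C).
case: ifP => sh.
  rewrite -(density_width H e0 tK C); ring.
by have [_ _ -> _ _] := class_contact H Cc bt (ltW td) (negbT sh); rewrite !mul0r.
Qed.

Lemma flow_bms q (g : R * R -> R) : tame K g -> bms (fun x => flow d M del e K q x t * g (x, t)).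
Proof.
move=> tg; have [c [mg [K' [c' gb]]]] : exists c : R, bms (fun x => g (x, t)).
  by exists 0; exact: slice_bms tg.
split.
  apply: measurable_funM => //.
  exact: (measurable_fun_pair1 t (measurable_flow H e K q)).
exists K, (flow_cap d M B del e K q * c') => x; split; last first.
  by move=> xK; case: tg => _ -> ; rewrite ?mulr0 //= xK.
have [xK|xK] := leP `|x| K.
  rewrite normrM; apply: ler_pM => //; first exact: (flow_bound H e0 e1 K0 q xK tt).
  by have [] := gb x.
case: tg => _ -> /=; last by rewrite xK.
rewrite mulr0 normr0; apply: mulr_ge0; last by apply: le_trans (gb x).1.
have z : `|0 : R| <= K by rewrite normr0.
exact: le_trans (normr_ge0 _) (flow_bound H e0 e1 K0 q z tt).
Qed.

(** Since [prim_x (dx f)] is f, the pairing rate is the space integral of the weak form of the ideal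
    solution. The difference is the integral of [flow_error]: strips cost O(N w), and the variance
    costs the collision rates. *)
Lemma flow_pairing_le p : (p <= 1)%N ->
  `|integral (fun x => flow d M del e K p x t * dt f (x, t) + flow d M del e K p.+1 x t * dx f (x, t))
    - pairing_rate K f N (node_flux d p) (node_flux d p.+1) front (charge p)
        (fun k => front_speed d k t) t| <=
  N%:R * (B * M ^+ p * (1 + M) * L * w + mb * (M ^+ p * (1 + M) * L * w))
  + L * (2 * M * mb * \sum_(b < N) \sum_(b' < N) collision_rate d e K b b' t).
Proof.
move=> p1; have M0 := M_ge0 H.
have B0 : 0 <= B := ltW (lt_le_trans (rhod_gt0 H 0) (rhod_le H 0)).
have tdt := tame_dt tf; have tdx := tame_dx tf.
have w0 : 0 < w by rewrite mulr_gt0 // ltr_wpDl.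
pose al := node_flux d p; pose be := node_flux d p.+1.
(* This integral multiplies the flux of the last region, which therefore drops out. It is evaluated
   at K + 1, strictly outside the support. *)
have idx : integral (fun x => dx f (x, t)) = 0.
  have KK : K <= K + 1 by rewrite lerDl.
  rewrite -(prim_x_right t tdx KK) (prim_x_dx _ _ K0 tf).
  by case: tf => _; apply; rewrite /= ger0_norm ?addr_ge0 // ltrDl ltr01.
have -> : pairing_rate K f N al be front (charge p) (fun k => front_speed d k t) t =
    integral (fun x => step d N al x t * dt f (x, t) + step d N be x t * dx f (x, t)) +
    integral (fun x => strip_sum d N (fun a b _ => dens a b * vel a b ^+ p * transport d t f a b) e x t).
  rewrite integralD; [|exact: step_bms_mul|exact: step_bms_mul].
  rewrite (step_integral N al tdt) (step_integral N be tdx) idx mulr0 add0r -charge_sum //.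
  rewrite /pairing_rate -(prim_x_right t tdt (lexx K)) big_split big_split /=.
  rewrite !addrA; congr (_ + _ + _); apply: eq_bigr => k _; congr (_ * _).
  exact/esym/(prim_x_dx _ _ K0 tf).
have b1 : bms (fun x => flow d M del e K p x t * dt f (x, t) + flow d M del e K p.+1 x t * dx f (x, t)).
  by apply: bmsD; exact: flow_bms.
have b2 : bms (fun x => step d N al x t * dt f (x, t) + step d N be x t * dx f (x, t)).
  by apply: bmsD; exact: step_bms_mul.
have b3 : bms (fun x => strip_sum d N (fun a b _ => dens a b * vel a b ^+ p * transport d t f a b) e x t).
  exact: (strip_sum_bms H e0 N t0).
rewrite opprD addrA -integralB // -integralB //; last exact: bmsB.
pose c1 := B * M ^+ p * (1 + M) * L; pose c2 := M ^+ p * (1 + M) * L * w.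
have c10 : 0 <= c1 by rewrite /c1 !mulr_ge0 ?exprn_ge0 ?addr_ge0.
have c20 : 0 <= c2 by apply: mulr_ge0; [rewrite !mulr_ge0 ?exprn_ge0 ?addr_ge0|exact: ltW].
have b4 : bms (fun x => strip_sum d N (fun a b _ => c1 + dens a b * c2) e x t).
  exact: (strip_sum_bms H e0 N t0).
have b5 := spread_bound_bms H e0 tK.
have bl : bms (fun x => L * spread_bound d M del e K t x) by exact: bmsZ.
apply: (@le_trans _ _ (integral (fun x => strip_sum d N (fun a b _ => c1 + dens a b * c2) e x t
   + L * spread_bound d M del e K t x))).
  apply: norm_integral_le.
  - by apply: bmsB => //; exact: bmsB.
  - exact: bmsD.
  move=> x; apply: le_trans (flow_error_le H e0 e1 x tK' tf L0 fx_le ft_le fx_lip ft_lip p1) _.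
  by apply: lerD => //; apply: ler_wpM2l => //; exact: (velocity_spread_le H e0 tK).
rewrite integralD // integralZ // (strip_sum_integral H e0 N t0); apply: lerD; last first.
  by apply: ler_wpM2l => //; exact: (spread_bound_integral H e0 K0 nN tK tE).
apply: class_sum_le_const.
  by rewrite addr_ge0 // mulr_ge0 // ?(ltW w0) // /mb !mulr_ge0.
move=> a b bN C; have /andP[h1 h2] := class_width_cap H e0 tK C.
case: ifP => _; last by rewrite addr_ge0 // mulr_ge0 // ?(ltW w0) // /mb !mulr_ge0.
have -> : (c1 + dens a b * c2) * class_width d e a b t =
    c1 * class_width d e a b t + class_mass d a b t * c2.
  by rewrite -(density_width H e0 tK C); ring.
apply: lerD.
  exact: ler_wpM2l.
by apply: ler_wpM2r => //; exact: (class_mass_cap H tK C).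
Qed.

End FlowPairing.

(** * Integration in time *)

Section WeakDefect.
Context {R : realType} (d : data R) {M B del : R} (H : regular_data d M B del).
Local Notation front := (front d).
Notation mu := (@lebesgue_measure R).
Notation integral f := (\int[mu]_(x in [set: R]) f x).

(** A class through a front k < N stays left of Y_{N-1} + M K up to time K, so it contains no front
    of large index. *)
Lemma front_count_class (K : R) (N : nat) : exists n, forall a b k t, 0 <= t <= K ->
  is_class_at d a b t -> (a <= k <= b)%N -> (k < N)%N -> (b <= n)%N.
Proof.
exists (front_bound_index d M del (posd d N.-1 + M * K) K) => a b k t /andP[t0 tK] [ab h _] kab kN.
rewrite leqNgt; apply/negP => lt.
have h1 : posd d N.-1 + M * K < front b t.
  apply: (front_bound_indexP H t0); apply: leq_trans (ltnW lt).
  by apply: (front_bound_index_mono H).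
have bE : front b t = front k t.
  by rewrite (front_class H t0 h kab) (front_class H t0 h) // ab leqnn.
have : front b t <= front N t by rewrite bE; apply: (front_mono H); exact: ltnW.
have : front N t <= posd d N.-1 + M * t.
  by have := front_bound H N t0; rewrite ler_distl => /andP[].
have : M * t <= M * K by apply: ler_wpM2l => //; exact: (M_ge0 H).
move: h1; lra.
Qed.

Lemma charge_continuous p k : continuous (charge d p k).
Proof.
by case: p => [|p] t; apply: cvgB;
  [exact: (mass_continuous H)..|exact: (momentum_continuous H)|exact: (momentum_continuous H)].
Qed.

Lemma charge_derive p k (t V : R) : (p <= 1)%N -> is_derive t 1 (front k) V ->
  is_derive t 1 (charge d p k) ((node_flux d p k.+1 - node_flux d p k) * V
    - (node_flux d p.+1 k.+1 - node_flux d p.+1 k)).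
Proof.
move=> p1 dF.
have dl (c : R) (i : nat) : is_derive t 1 (fun s => front k s - s * veld d i - c) (V - veld d i).
  have h1 := is_deriveB (is_deriveB dF (is_deriveZ (veld d i) (is_derive_id t (1 : R)))) (is_derive_cst c t (1 : R)).
  rewrite (_ : (fun s => _) = (front k - veld d i *: id) - cst c); last first.
    by apply/funext => s; rewrite /GRing.scale /= !fctE /= mulrC.
  by apply: is_derive_eq h1 _; rewrite /GRing.scale /= mulr1 subr0.
have dm g (c c' : R) : is_derive t 1
    (fun s => c + c' * (front k s - s * veld d (region_node g) - posd d (region_node g)))
    (c' * (V - veld d (region_node g))).
  have h1 := is_deriveD (is_derive_cst c t (1 : R)) (is_deriveZ c' (dl (posd d (region_node g)) (region_node g))).
  by apply: is_derive_eq h1 _; rewrite add0r.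
have fluxE q j : node_flux d q j = density d (region_of j) * veld d (region_node (region_of j)) ^+ q.
  by rewrite /node_flux; case: (region_of j) => i //=; rewrite !mul0r.
rewrite !fluxE; case: p p1 => [|[|]] // _; rewrite /charge.
- have := is_deriveB (dm (region_of k.+1) (mass_upto d (posd d (region_node (region_of k.+1)))) (density d (region_of k.+1)))
    (dm (region_of k) (mass_upto d (posd d (region_node (region_of k)))) (density d (region_of k))).
  by move=> h; apply: is_derive_eq h _; rewrite !expr0 !expr1; ring.
- have := is_deriveB (dm (region_of k.+1) (impulse_upto d (posd d (region_node (region_of k.+1))))
      (density d (region_of k.+1) * veld d (region_node (region_of k.+1))))
    (dm (region_of k) (impulse_upto d (posd d (region_node (region_of k))))
      (density d (region_of k) * veld d (region_node (region_of k)))).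
  by move=> h; apply: is_derive_eq h _; rewrite !expr1; ring.
Qed.

Lemma charge_initial p k : charge d p k 0 = 0.
Proof.
have footE j : (k.-1 = j.-1) \/ (j = k.+1) -> foot d (region_of j) (front k 0) 0 = front k 0.
  case: j => [|[|j]] jk; rewrite /= ?mul0r ?subr0 // (front_initial H).
  by case: jk => [->|[<-]].
have f0 : is_foot d (region_of k) (front k 0) 0 by apply: (is_foot0 H); left.
have f1 : is_foot d (region_of k.+1) (front k 0) 0 by apply: (is_foot0 H); right.
case: p => [|p] /=.
  by rewrite /mass_charge (mass_foot H f0) (mass_foot H f1) !footE ?subrr; [|left|right].
by rewrite /momentum_charge (momentum_foot H f0) (momentum_foot H f1) !footE ?subrr; [|left|right].
Qed.

Context (e K : R) (e0 : 0 < e) (e1 : e <= 1) (Kp : 0 < K).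
Local Notation N := (front_count d M del K).
Let K0 : 0 <= K := ltW Kp.
Context (f : R * R -> R) (tf : tame K f) (fK : forall x, f (x, K) = 0) (L : R).
Hypotheses (L0 : 0 <= L) (fx_le : forall p, `|dx f p| <= L) (ft_le : forall p, `|dt f p| <= L)
  (fx_lip : lipschitz2 L (dx f)) (ft_lip : lipschitz2 L (dt f)).

Definition weak_flow (p : nat) (z : R * R) : R :=
  if `[< plane_box K z >] then
    flow d M del e K p z.1 z.2 * dt f z + flow d M del e K p.+1 z.1 z.2 * dx f z
  else 0.

Lemma measurable_weak_flow p : measurable_fun [set: R * R] (weak_flow p).
Proof.
apply: measurable_fun_ifT => //.
  apply: (measurable_fun_bool true); rewrite setTI.
  rewrite (_ : _ @^-1` _ = plane_box K); first exact: plane_box_measurable.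
  by apply/seteqP; split => z /asboolP.
have mdt := plane_continuous_measurable (tame_continuous (tame_dt tf)).
have mdx := plane_continuous_measurable (tame_continuous (tame_dx tf)).
by apply: measurable_funD; apply: measurable_funM => //; exact: (measurable_flow H).
Qed.

Lemma weak_flow_bms p : bms (fun t => integral (fun x => weak_flow p (x, t))).
Proof.
apply: (@integral_slice_bms _ _ K (flow_cap d M B del e K p * L + flow_cap d M B del e K p.+1 * L)) => //.
- exact: measurable_weak_flow.
- move=> z; rewrite /weak_flow; case: asboolP => [[zK zt]|_].
    apply: le_trans (ler_normD _ _) _; rewrite !normrM.
    by apply: lerD; apply: ler_pM => //; exact: (flow_bound H e0 e1 K0).
  have z0 : `|0 : R| <= K by rewrite normr0.
  have zz : 0 <= (0 : R) <= K by apply/andP; split.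
  have cap q : 0 <= flow_cap d M B del e K q.
    exact: le_trans (normr_ge0 _) (flow_bound H e0 e1 K0 q z0 zz).
  by rewrite normr0 addr_ge0 // mulr_ge0.
- by move=> z nz; rewrite /weak_flow; case: asboolP.
Qed.

Local Notation moment p := (fun x t => rho_approx d M del e x t * u_approx d M del e x t ^+ p).

Lemma weak_flowE p t : 0 <= t -> integral (fun x => moment p x t * dt f (x, t) + moment p.+1 x t * dx f (x, t)) =
  integral (fun x => weak_flow p (x, t)).
Proof.
move=> t0; apply: eq_Rintegral => x _; rewrite /weak_flow /plane_box /=.
have zero : (K < `|x|) || (K < `|t|) -> dt f (x, t) = 0 /\ dx f (x, t) = 0.
  by move=> out; split; [case: (tame_dt tf) => _|case: (tame_dx tf) => _]; apply.
case: asboolP => [[xK tt]|nb]; first by rewrite !(flowE H e0 e1 _ xK tt).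
have [|-> ->] := zero; last by rewrite !mulr0 addr0.
apply: contra_notT nb; rewrite negb_or -!leNgt => /andP[xK tK]; split => //.
by rewrite t0 -(ger0_norm t0).
Qed.

Lemma weak_flow_slice p t : 0 <= t <= K -> integral (fun x => weak_flow p (x, t)) =
  integral (fun x => flow d M del e K p x t * dt f (x, t) + flow d M del e K p.+1 x t * dx f (x, t)).
Proof.
move=> tt; have /andP[t0 _] := tt; rewrite -weak_flowE //; apply: eq_Rintegral => x _.
have [xK|xK] := leP `|x| K; first by rewrite !(flowE H e0 e1 _ xK tt).
have [-> ->] : dt f (x, t) = 0 /\ dx f (x, t) = 0; last by rewrite !mulr0.
by split; [case: (tame_dt tf) => _|case: (tame_dx tf) => _]; apply; rewrite /= xK.
Qed.

Definition flow_pairing p : R -> R := pairing K f N (node_flux d p) front (charge d p).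

Definition flow_pairing_rate p (t : R) : R :=
  pairing_rate K f N (node_flux d p) (node_flux d p.+1) front (charge d p)
    (fun k => front_speed d k t) t.

Lemma flow_pairing_final p : flow_pairing p K = 0.
Proof.
rewrite /flow_pairing /pairing.
have z x : prim_x f (x, K) = 0.
  by rewrite -[RHS](@integral0' R); apply: eq_Rintegral => y _; rewrite /= fK mulr0.
by rewrite z mulr0 add0r big1 // => k _; rewrite z fK !mulr0 addr0.
Qed.

Lemma flow_pairing_initial p :
  integral (fun x => moment p x 0 * f (x, 0)) = flow_pairing p 0.
Proof.
have z0 : 0 <= (0 : R) <= K by apply/andP; split.
rewrite (_ : (fun x => _) = fun x => step d N (node_flux d p) x 0 * f (x, 0)); last first.
  apply/funext => x; have [xK|xK] := leP `|x| K; last first.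
    by case: tf => _ -> /=; rewrite ?mulr0 ?xK.
  congr (_ * _); rewrite (flowE H e0 e1 _ xK z0) /flow /strip_moment !strip_sum0.
    by rewrite mul0r invr0 mul0r subr0 mul1r add0r.
    by move=> [a [b st]]; have [_ _ _ _ []] := in_class_stripP H e0 (lexx 0) st; rewrite ltxx.
  by move=> [a [b st]]; have [_ _ _ _ []] := in_class_stripP H e0 (lexx 0) st; rewrite ltxx.
rewrite (step_integral d 0 N (node_flux d p) tf) /flow_pairing /pairing (prim_x_right 0 tf (lexx K)).
by congr (_ + _); apply: eq_bigr => k _; rewrite charge_initial mul0r addr0.
Qed.

End WeakDefect.

Arguments weak_flow {R} d M del e K f p z.
Arguments flow_pairing {R} d M del K f p t.
Arguments flow_pairing_rate {R} d M del K f p t.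

(** * The bound of the weak defect *)

Section WeakDefectBound.
Context {R : realType} (d : data R) {M B del : R} (H : regular_data d M B del).
Local Notation front := (front d).
Notation mu := (@lebesgue_measure R).
Notation integral f := (\int[mu]_(x in [set: R]) f x).
Context (e K : R) (e0 : 0 < e) (e1 : e <= 1) (Kp : 0 < K).
Local Notation N := (front_count d M del K).
Let K0 : 0 <= K := ltW Kp.
Context (f : R * R -> R) (tf : tame K f) (fK : forall x, f (x, K) = 0) (L : R).
Hypotheses (L0 : 0 <= L) (fx_le : forall p, `|dx f p| <= L) (ft_le : forall p, `|dt f p| <= L)
  (fx_lip : lipschitz2 L (dx f)) (ft_lip : lipschitz2 L (dt f)).
Context (n : nat).
Hypothesis nN : forall a b k t, 0 <= t <= K -> is_class_at d a b t ->
  (a <= k <= b)%N -> (k < N)%N -> (b <= n)%N.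
Let w := e * (K + 2).
Let mb := B * (2 * M * K).

Lemma continuous_bound (h : R -> R) : continuous h ->
  exists2 c, 0 <= c & forall t, 0 < t < K -> `|h t| <= c.
Proof.
move=> ch; have := continuous_compact (continuous_subspaceT ch) (@segment_compact _ 0 K).
move=> /compact_bounded[c0 [_ hc]]; exists (Num.max 0 (c0 + 1)); first by rewrite le_max lexx.
move=> t /andP[h1 h2]; apply: (hc (Num.max 0 (c0 + 1))); first by rewrite lt_max ltrDl ltr01 orbT.
by exists t => //; rewrite /= in_itv /= !ltW.
Qed.

Lemma flow_pairing_rate_bounded p : exists c, forall t, 0 < t < K -> t \notin merge_times d n ->
  `|flow_pairing_rate d M del K f p t| <= c.
Proof.
have ccurve (g : R * R -> R) k : continuous g -> continuous (fun t => g (front k t, t)).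
  by move=> cg t; apply: continuous_curve => //; exact: (front_continuous H).
have [c0 c00 h0] : exists2 c, 0 <= c & forall t, 0 < t < K ->
    `|node_flux d p N * prim_x (dt f) (K, t)| <= c.
  apply: continuous_bound => t; apply: cvgM; first exact: cvg_cst.
  exact: (continuous_curve (X := fun=> K) (prim_x_continuous K0 (tame_dt tf)) (cvg_cst _)).
have term (k : 'I_N) : exists c, forall t, 0 < t < K -> t \notin merge_times d n ->
   `|(node_flux d p k - node_flux d p k.+1) * prim_x (dt f) (front k t, t)
     + (node_flux d p.+1 k - node_flux d p.+1 k.+1) * f (front k t, t)
     + charge d p k t * (dt f (front k t, t) + front_speed d k t * dx f (front k t, t))| <= c.
  have [c1 _ h1] : exists2 c, 0 <= c & forall t, 0 < t < K ->
      `|(node_flux d p k - node_flux d p k.+1) * prim_x (dt f) (front k t, t)| <= c.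
    apply: continuous_bound => t; apply: cvgM; first exact: cvg_cst.
    exact: (ccurve _ k (prim_x_continuous K0 (tame_dt tf)) t).
  have [c2 _ h2] : exists2 c, 0 <= c & forall t, 0 < t < K ->
      `|(node_flux d p.+1 k - node_flux d p.+1 k.+1) * f (front k t, t)| <= c.
    apply: continuous_bound => t; apply: cvgM; first exact: cvg_cst.
    exact: (ccurve _ k (tame_continuous tf) t).
  have [c3 c30 h3] := continuous_bound (@charge_continuous _ _ _ _ _ H p k).
  exists (c1 + c2 + c3 * (L + M * L)) => t tK tE.
  apply: le_trans (ler_normD _ _) _; apply: lerD.
    by apply: le_trans (ler_normD _ _) _; apply: lerD; [exact: h1|exact: h2].
  rewrite normrM; apply: ler_pM => //; first exact: h3.
  apply: le_trans (ler_normD _ _) _; apply: lerD => //.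
  rewrite normrM; apply: ler_pM => //.
  exact: (regular_front_speed_le H nN tK tE (ltn_ord k)).
have [c hc] := choice term.
exists (c0 + \sum_(k < N) c k) => t tK tE; rewrite /flow_pairing_rate /pairing_rate.
apply: le_trans (ler_normD _ _) _; apply: lerD; first exact: h0.
apply: le_trans (ler_norm_sum _ _ _) _; apply: ler_sum => k _; exact: hc.
Qed.

Local Notation regular t := ((0 < t < K) && (t \notin merge_times d n)).

(** Fronts and charges are continuous through the merge times, hence so is the pairing, and the
    fundamental theorem applies across all interactions at once. The final value is 0 because f
    vanishes at time K. *)
Lemma flow_pairing_integral p : (p <= 1)%N ->
  bms (fun t => if regular t then flow_pairing_rate d M del K f p t else 0) /\
  integral (fun t => if regular t then flow_pairing_rate d M del K f p t else 0) =
    - flow_pairing d M del K f p 0.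
Proof.
move=> p1; have [c hc] := flow_pairing_rate_bounded p.
have cf t : 0 < t < K -> t \notin merge_times d n ->
    {for t, continuous (flow_pairing_rate d M del K f p)}.
  move=> tK tE; apply: (@pairing_rate_continuous _ K K0 f tf N (node_flux d p) (node_flux d p.+1)
    front (charge d p) (front_speed d) t).
  - by move=> k _; exact: (front_continuous H).
  - by move=> k _; exact: (charge_continuous H).
  - by move=> k kN; exact: (regular_front_speed_continuous H nN tK tE kN).
split; first exact: bms_off_finite cf hc.
transitivity (flow_pairing d M del K f p K - flow_pairing d M del K f p 0); last first.
  by rewrite (flow_pairing_final d (M := M) (del := del) fK p) sub0r.
apply: (@integral_derivative R (merge_times d n) 0 K c (flow_pairing d M del K f p) _ K0).
- apply: pairing_continuous => // k _; first exact: (front_continuous H).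
  exact: (charge_continuous H).
- exact: cf.
- exact: hc.
- move=> t tK tE; apply: pairing_derive => // k kN.
    exact: (regular_front_derive H nN tK tE kN).
  exact: (charge_derive p1 (regular_front_derive H nN tK tE kN)).
Qed.

Local Notation rate_sum t := (\sum_(b < N) \sum_(b' < N) collision_rate d e K b b' t).

Lemma rate_sum_integral :
  bms (fun t => if regular t then rate_sum t else 0) /\
  integral (fun t => if regular t then rate_sum t else 0) <= N%:R * (N%:R * (4 * w)).
Proof.
have w0 : 0 < w by rewrite mulr_gt0 // ltr_wpDl.
have one (b b' : 'I_N) : bms (fun t => if regular t then collision_rate d e K b b' t else 0) /\
    integral (fun t => if regular t then collision_rate d e K b b' t else 0) <= 4 * w.
  rewrite /collision_rate; case bb : ((0 < b)%N && (0 < b')%N); last first.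
    rewrite (_ : (fun t => _) = fun=> 0); last by apply/funext => t; case: (regular t).
    by split; [exact: bms0|rewrite integral0' mulr_ge0 // ltW].
  have mM : (minn b b' <= maxn b b')%N by rewrite geq_min leq_maxl.
  have MN : (maxn b b' < N)%N by rewrite gtn_max !ltn_ord.
  split; first exact: (pair_rate_bms H nN w0 mM MN).
  exact: (pair_rate_integral H nN w0 mM MN K0).
have E : (fun t => if regular t then rate_sum t else 0) = (fun t => \sum_(b < N) \sum_(b' < N)
    (if regular t then collision_rate d e K b b' t else 0)).
  apply/funext => t; case: ifP => // _.
  by rewrite big1 // => b _; rewrite big1.
have sum_le (F : 'I_N -> R) c : (forall i, F i <= c) -> \sum_i F i <= N%:R * c.
  move=> Fc; apply: le_trans (ler_sum _ (fun i _ => Fc i)) _.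
  by rewrite sumr_const card_ord mulr_natl.
rewrite E; split.
  by apply: bms_sum => b _; apply: bms_sum => b' _; exact: (one b b').1.
rewrite integral_bigsum; last by move=> b _; apply: bms_sum => b' _; exact: (one b b').1.
apply: (sum_le) => b; rewrite integral_bigsum; last by move=> b' _; exact: (one b b').1.
by apply: (sum_le) => b'; exact: (one b b').2.
Qed.

Local Notation moment p := (fun x t => rho_approx d M del e x t * u_approx d M del e x t ^+ p).

(** The initial term of the defect is the pairing at t = 0, that is, minus the time integral of the
    pairing rate. The defect is therefore the time integral of the difference bounded in
    [flow_pairing_le]; each of the N^2 pairs contributes at most 4 w to the collision part. *)
Lemma weak_defect_le p : (p <= 1)%N ->
  `|weak_defect (moment p) (moment p.+1) f| <=
  K * (N%:R * (B * M ^+ p * (1 + M) * L * w + mb * (M ^+ p * (1 + M) * L * w)))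
  + L * (2 * M * mb) * (N%:R * (N%:R * (4 * w))).
Proof.
move=> p1; set A := N%:R * _.
pose g t := integral (fun x => weak_flow d M del e K f p (x, t)).
have bg : bms g := weak_flow_bms H e0 e1 Kp tf L0 fx_le ft_le p.
have mreg : measurable [set t : R | regular t].
  rewrite (_ : [set t | _] = [set t : R | 0 < t < K /\ t \notin merge_times d n]).
    by apply: open_measurable; exact: open_off_finite.
  by apply/seteqP; split => t /= /andP.
pose g' t := if regular t then g t else 0.
have g'E : g' = (fun t => (regular t)%:R * g t).
  by apply/funext => t; rewrite /g'; case: ifP => _; rewrite ?mul1r ?mul0r.
have bg' : bms g' by rewrite g'E; exact: (@bms_bool_mul _ (fun t => regular t)).
have [bF iF] := flow_pairing_integral p1.
have [bS iS] := rate_sum_integral.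
have -> : weak_defect (moment p) (moment p.+1) f = integral (fun t => g' t -
    (if regular t then flow_pairing_rate d M del K f p t else 0)).
  rewrite integralB // iF opprK /weak_defect; congr (_ + _); last first.
    exact: (flow_pairing_initial H e0 e1 Kp tf).
  rewrite (_ : \int[mu]_(t in `[0, +oo[) _ = integral g).
    have [mg _] := bg; have [mg' _] := bg'.
    (* The function [g] vanishes outside [0, K], so it can differ from [g'] only at 0, at K and at
       the merge times. *)
    apply: (@integral_eq_off_finite _ _ _ [:: 0, K & merge_times d n]) => // t.
    rewrite !inE !negb_or => /and3P[t0 tK tE]; rewrite /g' tE andbT.
    case: ifPn => // nt; rewrite /g -[RHS](@integral0' R); apply: eq_Rintegral => x _.
    rewrite /weak_flow; case: asboolP => // -[_ /= /andP[h1 h2]].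
    by case/negP: nt; rewrite !lt_neqAle h1 h2 eq_sym t0 tK.
  rewrite Rintegral_mkcond; apply: eq_Rintegral => t _; rewrite patchE.
  case: ifPn => [|nt].
    rewrite inE /= in_itv /= andbT => t0.
    exact: (weak_flowE H e0 e1 tf p t0).
  rewrite /g -[LHS](@integral0' R); apply: eq_Rintegral => x _.
  rewrite /weak_flow; case: asboolP => // -[_ /= /andP[h1 h2]].
  by case/negP: nt; rewrite inE /= in_itv /= andbT.
have E : [set t : R | 0 < t < K] = [set` `]0, K[].
  by apply/seteqP; split => t /=; rewrite in_itv.
have [bI iI] := @integral_interval _ (fun t : R => 0 < t < K) 0 K K0 (or_intror (or_intror E)).
have -> : K * A + L * (2 * M * mb) * (N%:R * (N%:R * (4 * w))) =
    A * integral (fun t : R => (0 < t < K)%R%:R) + L * (2 * M * mb) * (N%:R * (N%:R * (4 * w))).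
  by rewrite iI subr0 [K * A]mulrC.
have M0 := M_ge0 H.
have B0 : 0 <= B := ltW (lt_le_trans (rhod_gt0 H 0) (rhod_le H 0)).
have w0 : 0 < w by rewrite mulr_gt0 // ltr_wpDl.
have mb0 : 0 <= mb by rewrite /mb !mulr_ge0.
have q0 : 0 <= M ^+ p * (1 + M) * L * w.
  by apply: mulr_ge0; [rewrite !mulr_ge0 ?exprn_ge0 ?addr_ge0|exact: ltW].
have A0 : 0 <= A.
  apply: mulr_ge0 => //; apply: addr_ge0; last exact: mulr_ge0.
  by apply: mulr_ge0; [rewrite !mulr_ge0 ?exprn_ge0 ?addr_ge0|exact: ltW].
have c0 : 0 <= L * (2 * M * mb) by rewrite !mulr_ge0.
apply: (@le_trans _ _ (integral (fun t : R => A * (0 < t < K)%R%:R + L * (2 * M * mb) *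
    (if regular t then rate_sum t else 0)))).
  apply: norm_integral_le; [exact: bmsB|by apply: bmsD; exact: bmsZ|].
  move=> t; rewrite /g'; case: ifP => [/andP[tK tE]|_]; last first.
    by rewrite subr0 normr0 mulr0 addr0 mulr_ge0.
  have tt : 0 <= t <= K by case/andP: tK => /ltW -> /ltW.
  rewrite tK mulr1 /g (weak_flow_slice H e0 e1 tf p tt) -mulrA.
  exact: (flow_pairing_le H e0 e1 K0 nN tK tE tf L0 fx_le ft_le fx_lip ft_lip p1).
rewrite integralD; [|exact: bmsZ|exact: bmsZ].
rewrite !integralZ //; apply: lerD => //.
exact: ler_wpM2l.
Qed.

End WeakDefectBound.

(** * The limit *)

Section SampledData.
Context {R : realType}.
Notation mu := (@lebesgue_measure R).
Notation integral f := (\int[mu]_(x in [set: R]) f x).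

Lemma uniformly_continuous_segment (z : R -> R) (a b eta : R) : continuous z -> 0 < eta ->
  \forall del \near (0 : R)^'+, forall x y, a <= x <= b -> `|y - x| <= del -> `|z y - z x| <= eta.
Proof.
move=> cz eta0.
have : near_covering [set` `[a, b]] by apply/compact_near_coveringP; exact: segment_compact.
move=> /(_ R (0 : R)^'+ (fun del x => forall y, `|y - x| <= del -> `|z y - z x| <= eta)) h.
have : \forall del \near (0 : R)^'+, [set` `[a, b]] `<=` [set x | forall y, `|y - x| <= del -> `|z y - z x| <= eta].
  apply: h => x _.
  have /cvgrPdist_le/(_ (eta / 2)) := cz x; rewrite divr_gt0 // => /(_ isT).
  move=> /nbhs_ballP[r /= r0 hr].
  exists (ball x (r / 2), [set del | del < r / 2]) => /=.
    split; first by apply: nbhsx_ballx; rewrite divr_gt0.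
    by apply: nbhs_right_lt; rewrite divr_gt0.
  move=> [x' del] /= [xx' dr] y yx'.
  have h1 : `|x - x'| < r / 2 by [].
  have b1 : ball x r x' by apply: lt_le_trans h1 _; rewrite ler_pdivrMr // ler_peMr ?ler1n // ltW.
  have b2 : ball x r y.
    rewrite /ball /= (_ : x - y = (x - x') + (x' - y)); last by ring.
    apply: le_lt_trans (ler_normD _ _) _; rewrite [r]splitr; apply: ltr_leD => //.
    by rewrite distrC; apply: le_trans yx' (ltW dr).
  have := hr _ b1; have := hr _ b2; rewrite /=.
  rewrite (_ : z y - z x' = (z x - z x') - (z x - z y)) => [g1 g2|]; last by ring.
  by apply: le_trans (ler_normB _ _) _; rewrite [eta]splitr; exact: lerD.
apply: filterS => del hd x y xab; apply: hd.
by rewrite /= in_itv.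
Qed.

Lemma within_continuous_max (r : R) (z : R -> R) : {within `[r, +oo[, continuous z} ->
  continuous (fun x => z (Num.max r x)).
Proof.
move=> cz; suff main (x : R) : {for x, continuous (fun x : R => z (Num.max r x))} by exact: main.
rewrite /prop_for.
have /continuous_within_itvcyP[ci cr] := cz.
have [xr|rx|xr] := ltgtP x r.
- have zr : (cst (z r) : R -> R) y @[y --> x] --> z r by exact: cvg_cst.
  rewrite /continuous_at max_l ?ltW //.
  have nx : \forall y \near x, y <= r by exact: lt_le_nbhsl.
  by apply: cvg_trans zr; apply: near_eq_cvg; apply: filterS nx => y yr; rewrite max_l.
- have zx : z y @[y --> x] --> z x by apply: ci; rewrite in_itv /= rx.
  rewrite /continuous_at max_r ?ltW //.
  have nx : \forall y \near x, r < y by exact: lt_nbhsr.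
  by apply: cvg_trans zx; apply: near_eq_cvg; apply: filterS nx => y /ltW yr; rewrite max_r.
- subst x; rewrite /continuous_at maxxx.
  apply/cvgrPdist_le => eta eta0.
  have /cvgrPdist_le/(_ eta eta0) := cr; rewrite near_withinE => h.
  apply: filterS h => y hy; have [yr|ry] := leP y r; first by rewrite subrr normr0 ltW.
  exact: hy.
Qed.

(** Right of r the value of S is that of z at a point at most C [del e] further right, so uniform
    continuity on the support of psi gives uniform closeness. Measurability is asked locally,
    through G, because S is given by a finite step function only on bounded sets. *)
Lemma sampled_distribution_cvg (r z0 c C : R) (z : R -> R) (del : R -> R) (S : R -> R -> R) :
  {within `[r, +oo[, continuous z} -> (forall x, r <= x -> `|z x| <= c) -> 0 <= C ->
  del e @[e --> (0 : R)^'+] --> 0 ->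
  (forall e (K : R), 0 < e < 1 -> exists2 G, measurable_fun [set: R] G &
     forall x, `|x| <= K -> S e x = G x) ->
  (forall e x, 0 < e < 1 -> x <= r -> S e x = z0) ->
  (forall e x, 0 < e < 1 -> r < x -> exists2 y, x <= y <= x + C * del e & S e x = z y) ->
  distribution_cvg S (glued_data r z0 z).
Proof.
move=> cz zc C0 cdel mS Sl Sr psi tpsi.
have [K K0 hK] := test_function_bounded tpsi.
have cpsi : continuous psi by have [/(_ [::])[]] := tpsi.
have bpsi : bms psi by apply: bms_continuous cpsi hK.
pose zm x := z (Num.max r x).
have czm : continuous zm := within_continuous_max cz.
have glE x : glued_data r z0 z x = if x <= r then z0 else zm x.
  by rewrite /glued_data /zm; case: ifPn => //; rewrite -ltNge => /ltW rx; rewrite max_r.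
have cap (h : R -> R) : (forall x, `|x| <= K -> `|h x| <= `|z0| + c) ->
    (exists2 G, measurable_fun [set: R] G & forall x, `|x| <= K -> h x = G x) ->
    bms (fun x => h x * psi x).
  move=> hb [G mG hG]; have [mpsi [K' [c' pb]]] := bpsi.
  have c'0 : 0 <= c' by apply: le_trans (pb 0).1.
  split.
    rewrite (_ : (fun x => _) = fun x => G x * psi x); first exact: measurable_funM.
    apply/funext => x; have [xK|xK] := leP `|x| K; first by rewrite hG.
    by rewrite hK ?mulr0.
  exists K, ((`|z0| + c) * c') => x; split; last by move=> xK; rewrite hK ?mulr0.
  have [xK|xK] := leP `|x| K; first by rewrite normrM; apply: ler_pM => //; [exact: hb|exact: (pb x).1].
  rewrite hK // mulr0 normr0 mulr_ge0 // addr_ge0 //.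
  exact: le_trans (normr_ge0 _) (zc r (lexx r)).
have c0 : 0 <= c by exact: le_trans (normr_ge0 _) (zc r (lexx r)).
have bgl : bms (fun x => glued_data r z0 z x * psi x).
  apply: cap.
    move=> x _; rewrite /glued_data; case: ifPn => [_|]; first by rewrite lerDl.
    by rewrite -ltNge => /ltW rx; apply: le_trans (zc x rx) _; rewrite lerDr.
  exists (glued_data r z0 z) => //; rewrite (_ : glued_data _ _ _ = fun x => if x <= r then z0 else zm x); last first.
    by apply/funext => x; exact: glE.
  apply: measurable_fun_ifT => //; last exact: continuous_measurable_fun.
  exact: measurable_fun_ler.
pose I := integral (fun x => `|psi x|).
have I0 : 0 <= I.
  by rewrite -(@integral0' R); apply: le_integral' => //; [exact: bms0|exact: bms_norm].
apply/cvgrPdist_le => eta eta0.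
have eta' : 0 < eta / (I + 1) by rewrite divr_gt0 // ltr_wpDl.
have uc := @uniformly_continuous_segment zm (- K) K _ czm eta'.
have cCd : C * del e @[e --> (0 : R)^'+] --> 0.
  rewrite -[X in _ --> X](mulr0 C); apply: cvgM => //; exact: cvg_cst.
have := uc; rewrite near_withinE => /nbhs_ballP[dd /= dd0 hd].
have /cvgrPdist_lt/(_ dd dd0) nC := cCd.
near=> e.
have e01 : 0 < e < 1.
  by apply/andP; split; near: e; [exact: nbhs_right_gt|exact: nbhs_right_lt].
have Cd : `|C * del e| < dd by near: e; apply: filterS nC => e; rewrite sub0r normrN.
have Sx x : `|x| <= K -> `|S e x - glued_data r z0 z x| <= eta / (I + 1).
  move=> xK; rewrite /glued_data; case: ifPn => [xr|].
    by rewrite (Sl _ _ e01 xr) subrr normr0 ltW.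
  rewrite -ltNge => rx; have [y /andP[xy yx] ->] := Sr e x e01 rx.
  have -> : z y - z x = zm y - zm x.
    by rewrite /zm !max_r //; [exact: ltW|apply: le_trans xy; exact: ltW].
  have [->|yx0] := eqVneq y x; first by rewrite subrr normr0 ltW.
  have xy' : x < y by rewrite lt_neqAle eq_sym yx0.
  apply: (hd (y - x)).
  - rewrite /ball /= sub0r normrN ger0_norm ?subr_ge0 //.
    apply: le_lt_trans Cd; apply: le_trans (ler_norm _); rewrite lerBlDl //.
  - by rewrite /= subr_gt0.
  - by rewrite -ler_norml.
  - by rewrite ger0_norm // subr_ge0.
have bS : bms (fun x => S e x * psi x).
  apply: cap; last exact: mS.
  move=> x _; have [xr|rx] := leP x r; first by rewrite (Sl _ _ e01 xr) lerDl.
  have [y /andP[xy _] ->] := Sr e x e01 rx; apply: le_trans (zc y _) _; last by rewrite lerDr.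
  by apply: le_trans xy; exact: ltW.
rewrite distrC -integralB //.
apply: (@le_trans _ _ (integral (fun x => eta / (I + 1) * `|psi x|))).
  apply: norm_integral_le; [exact: bmsB|by apply: bmsZ; exact: bms_norm|].
  move=> x; rewrite -mulrBl normrM.
  have [xK|xK] := leP `|x| K; first by apply: ler_wpM2r => //; exact: Sx.
  by rewrite hK // normr0 !mulr0.
rewrite integralZ; last exact: bms_norm.
rewrite -/I mulrAC ler_pdivrMr ?ltr_wpDl //; apply: ler_wpM2l; first exact: ltW.
by rewrite lerDl.
Unshelve. all: by end_near.
Qed.

End SampledData.

(** * Rates for the sampled data *)

Section Convergence.
Context {R : realType}.

Lemma initial_region (d : data R) (M B del : R) (H : regular_data d M B del) x :
  if x <= posd d 0 then region_index d x 0 = 0%N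
  else exists2 j, region_index d x 0 = j.+2 & posd d j < x <= posd d j.+1.
Proof.
have [h1 h2] := region_indexP H x (lexx 0).
move: h1 h2; case: (region_index d x 0) => [|[|j]] h1 h2.
- by move: h1; rewrite (front_initial H) /= => ->.
- have := h2 0%N isT; move: h1; rewrite !(front_initial H) /= => h1.
  by rewrite ltNge h1.
- have xj := h2 j.+1 (ltnSn _); rewrite (front_initial H) /= in xj.
  move: h1; rewrite (front_initial H) /= => h1.
  have xY : posd d 0 < x by apply: le_lt_trans (posd_le H (leq0n j)) xj.
  by rewrite leNgt xY /=; exists j => //; rewrite xj h1.
Qed.

Lemma no_initial_strip (d : data R) (M B del e : R) (H : regular_data d M B del) x :
  0 < e -> ~ in_some_strip d e x 0.
Proof.
by move=> e0 [a [b st]]; have [_ _ _ _ []] := in_class_stripP H e0 (lexx 0) st; rewrite ltxx.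
Qed.

Section Data.
Context (r rho0 u0 C : R) (rho u : R -> R) (Y : R -> nat -> R) (M B : R).
Hypotheses (C_ge1 : 1 <= C) (rho0_gt0 : 0 < rho0) (rho0_le : rho0 <= B) (u0_le : `|u0| <= M)
  (rho_gt0 : forall x, r <= x -> 0 < rho x) (rho_le : forall x, r <= x -> `|rho x| <= B)
  (u_le : forall x, r <= x -> `|u x| <= M)
  (u_decr : forall x y, r <= x -> x < y -> u y <= u x)
  (Y0 : forall e, 0 < e -> Y e 0%N = r)
  (Y_step : forall e i, 0 < e -> e `^ 3^-1 <= Y e i.+1 - Y e i <= C * e `^ 3^-1).

Let d e := sampled_data (Y e) rho0 u0 rho u.
Let del e : R := e `^ 3^-1.

Lemma Y_ge e i : 0 < e -> r <= Y e i.
Proof.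
move=> e0; elim: i => [|i IH]; first by rewrite Y0.
apply: le_trans IH _; rewrite -subr_ge0; have /andP[h _] := Y_step i e0.
exact: le_trans (powR_ge0 _ _) h.
Qed.

Lemma sampled_regular e : 0 < e -> regular_data (d e) M B (del e).
Proof.
move=> e0; have dp : 0 < del e by exact: powR_gt0.
split => //.
- by move=> i /=; have /andP[h _] := Y_step i e0; rewrite -lerBrDl.
- by case=> [|i] //=; exact/rho_gt0/Y_ge.
- by case=> [|i] //=; apply: le_trans (ler_norm _) _; exact/rho_le/Y_ge.
- by case=> [|i] //=; exact/u_le/Y_ge.
- move=> i /=; apply: u_decr; first exact: Y_ge.
  rewrite -subr_gt0; have /andP[h _] := Y_step i.+1 e0.
  exact: lt_le_trans dp h.
Qed.

Lemma del_cube e : 0 < e -> del e ^+ 3 = e.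
Proof.
move=> e0; rewrite -powR_mulrn ?powR_ge0 // /del -powRrM mulVf ?powRr1 ?ltW //.
Qed.

Lemma del_le1 e : 0 < e <= 1 -> del e <= 1.
Proof.
move=> /andP[e0 e1]; rewrite leNgt; apply/negP => d1.
have : 1 < del e ^+ 3 by rewrite exprn_egt1.
by rewrite del_cube // ltNge e1.
Qed.

(** Nodes are at least [del e] apart, and [del e] <= 1 lets the rounding constant 2 be absorbed into
    2 / [del e]. *)
Lemma front_count_le K e : 0 < e <= 1 ->
  (front_count (d e) M (del e) K)%:R <= (`|2 * K + 1 + M * K - r| + 2) / del e.
Proof.
move=> e01; have /andP[e0 _] := e01; have d1 := del_le1 e01.
have dp : 0 < del e by exact: powR_gt0.
rewrite /front_count /front_bound_index /= Y0 //.
set A := 2 * K + 1 + M * K - r.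
have h1 : (Num.truncn (A / del e))%:R <= `|A| / del e.
  have A0 : 0 <= `|A| / del e by rewrite divr_ge0 // ltW.
  have := A0; rewrite -truncn_le; apply: le_trans; rewrite ler_nat; apply: le_truncn.
  by rewrite ler_pM2r ?invr_gt0 // ler_norm.
have h2 : 2 <= 2 / del e by rewrite ler_pdivlMr // ler_piMr.
rewrite -addn2 natrD [leRHS]mulrDl; exact: lerD.
Qed.

Local Notation moment e p := (fun x t => rho_approx (d e) M (del e) e x t * u_approx (d e) M (del e) e x t ^+ p).

Lemma weak_defect_cvg p (phi : R * R -> R) : (p <= 1)%N -> test_function phi ->
  weak_defect (moment e p) (moment e p.+1) phi @[e --> (0 : R)^'+] --> (0 : R).
Proof.
move=> p1 /test_function_tame[K' K'0 tf'].
(* The bound of the support is enlarged so that phi vanishes at the final time K. *)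
pose K := K' + 1; have KK : K' < K by rewrite ltrDl ltr01.
have Kp : 0 < K := lt_trans K'0 KK.
have tf : tame K phi := tame_le (ltW KK) tf'.
have fK x : phi (x, K) = 0.
  by case: tf' => _; apply; rewrite /= (gtr0_norm Kp) KK orbT.
have [L1 L10 h1] := tame_bounded (tame_dx tf); have [L2 L20 h2] := tame_bounded (tame_dt tf).
have [L3 L30 h3] := tame_lipschitz (tame_dx tf); have [L4 L40 h4] := tame_lipschitz (tame_dt tf).
pose L := L1 + L2 + L3 + L4; have L0 : 0 <= L by rewrite !addr_ge0.
have fx_le z : `|dx phi z| <= L by apply: le_trans (h1 z) _; rewrite /L; lra.
have ft_le z : `|dt phi z| <= L by apply: le_trans (h2 z) _; rewrite /L; lra.
have fx_lip : lipschitz2 L (dx phi).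
  move=> x y t s; apply: le_trans (h3 x y t s) _; apply: ler_wpM2r; rewrite ?addr_ge0 // /L; lra.
have ft_lip : lipschitz2 L (dt phi).
  move=> x y t s; apply: le_trans (h4 x y t s) _; apply: ler_wpM2r; rewrite ?addr_ge0 // /L; lra.
have M0 : 0 <= M := le_trans (normr_ge0 _) u0_le.
have B0 : 0 <= B := ltW (lt_le_trans rho0_gt0 rho0_le).
pose mb := B * (2 * M * K); have mb0 : 0 <= mb by rewrite /mb !mulr_ge0 // ltW.
pose D := `|2 * K + 1 + M * K - r| + 2; have D0 : 0 <= D by rewrite addr_ge0.
pose c1 := (B + mb) * (M ^+ p * (1 + M) * L).
have c10 : 0 <= c1.
  by apply: mulr_ge0; [exact: addr_ge0|rewrite !mulr_ge0 ?exprn_ge0 ?addr_ge0].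
pose c2 := L * (2 * M * mb); have c20 : 0 <= c2 by rewrite /c2; do 2 apply: mulr_ge0 => //; apply: mulr_ge0.
(* With s = [del e], N s <= D and w = s^3 (K + 2). The first summand comes from the strips, where N
   w <= D (K + 2) s, the second from the pairs, where 4 N^2 w <= 4 D^2 (K + 2) s. *)
pose Q := K * c1 * (D * (K + 2)) + c2 * (4 * (D ^+ 2 * (K + 2))).
have bound e : 0 < e < 1 -> `|weak_defect (moment e p) (moment e p.+1) phi| <= Q * del e.
  move=> /andP[e0 e1]; have e01 : 0 < e <= 1 by rewrite e0 ltW.
  have H := sampled_regular e0.
  have [n nN] := front_count_class H K (front_count (d e) M (del e) K).
  have := weak_defect_le H e0 (ltW e1) Kp tf fK L0 fx_le ft_le fx_lip ft_lip nN p1.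
  move=> h; apply: le_trans h _.
  have NN := front_count_le K e01; set N := _%:R in NN *.
  have d1 := del_le1 e01; have dp : 0 < del e by exact: powR_gt0.
  have N0 : 0 <= N by exact: ler0n.
  have K2 : 0 < K + 2 by rewrite ltr_wpDl // ltW.
  rewrite (_ : e * (K + 2) = del e ^+ 3 * (K + 2)); last by rewrite del_cube.
  set s := del e in d1 dp NN *.
  have Nd : N * s <= D by move: NN; rewrite ler_pdivlMr.
  have Nd0 : 0 <= N * s by rewrite mulr_ge0 // ltW.
  have h5 : N * (s ^+ 3 * (K + 2)) <= D * (K + 2) * s.
    rewrite (_ : N * _ = (N * s) * (K + 2) * s * s); last by ring.
    rewrite -[leRHS]mulr1; apply: ler_pM => //; [|exact: ltW|].
      by rewrite mulr_ge0 ?mulr_ge0 // ltW.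
    by rewrite ler_pM2r // ler_pM2r.
  have h6 : N * (N * (4 * (s ^+ 3 * (K + 2)))) <= 4 * (D ^+ 2 * (K + 2)) * s.
    rewrite (_ : N * _ = 4 * ((N * s) ^+ 2 * (K + 2)) * s); last by ring.
    rewrite ler_pM2r // ler_pM2l // ler_pM2r // lerXn2r ?nnegrE //.
  rewrite /Q [leRHS]mulrDl; apply: lerD; last first.
    by rewrite -[leRHS]mulrA; exact: (ler_wpM2l c20 h6).
  rewrite [leLHS](_ : _ = K * c1 * (N * (s ^+ 3 * (K + 2)))); last by rewrite /c1 /mb; ring.
  rewrite -[leRHS]mulrA; apply: ler_wpM2l => //; rewrite mulr_ge0 // ltW //.
have cd : Q * del e @[e --> (0 : R)^'+] --> 0.
  rewrite -[X in _ --> X](mulr0 Q); apply: cvgM; first exact: cvg_cst.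
  by apply: powR_cvg0; rewrite invr_gt0.
apply/cvgrPdist_le => eta eta0.
have /cvgrPdist_le/(_ eta eta0) nd := cd.
near=> e; rewrite sub0r normrN.
have e01 : 0 < e < 1.
  by apply/andP; split; near: e; [exact: nbhs_right_gt|exact: nbhs_right_lt].
apply: le_trans (bound e e01) _; apply: le_trans (ler_norm _) _.
by near: e; apply: filterS nd => e; rewrite sub0r normrN.
Unshelve. all: by end_near.
Qed.

Lemma moment_locally_integrable p e : 0 < e <= 1 -> Defs.locally_integrable (moment e p).
Proof.
move=> /andP[e0 e1] K; have H := sampled_regular e0.
have E z : plane_box K z -> moment e p z.1 z.2 = flow (d e) M (del e) e K p z.1 z.2.
  by move=> [zK zt]; exact: (flowE H e0 e1 p zK zt).
apply: (@plane_box_integrable R (fun z => moment e p z.1 z.2) K (flow_cap (d e) M B (del e) e K p)).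
  apply: (@eq_measurable_fun _ _ _ _ _ (fun z => flow (d e) M (del e) e K p z.1 z.2)).
    by move=> z; rewrite inE => /E.
  by apply: measurable_funTS; exact: (measurable_flow H).
move=> z zK; rewrite E //; have [xK tt] := zK.
have K0 : 0 <= K by apply: le_trans xK.
exact: (flow_bound H e0 e1 K0).
Qed.

Lemma initial_sample e x : 0 < e -> r < x ->
  exists j, region_index (d e) x 0 = j.+2 /\ x <= Y e j.+1 <= x + C * del e.
Proof.
move=> e0 rx; have H := sampled_regular e0.
have := initial_region H x; rewrite /= Y0 // leNgt rx /= => -[j rj /andP[h1 h2]].
exists j; split => //; rewrite h2 /=; have /andP[_ h3] := Y_step j e0.
rewrite -lerBlDl; apply: le_trans h3; rewrite lerB // ltW //.
Qed.

End Data.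
End Convergence.

Lemma bounded_on {R : realType} (A : set R) (f : R -> R) : [bounded f x | x in A] ->
  exists c, forall x, A x -> `|f x| <= c.
Proof.
move=> [c0 [_ h]]; exists (c0 + 1) => x Ax.
by apply: (h (c0 + 1)) => //; rewrite ltrDl ltr01.
Qed.

Theorem theorem5p2 (R : realType) (r rho0 u0 C : R) (rho u : R -> R)
  (Y : R -> nat -> R)
  (rho_cont : {within `[r, +oo[, continuous rho})
  (rho_bnd : [bounded rho x | x in `[r, +oo[%classic])
  (u_cont : {within `[r, +oo[, continuous u})
  (u_bnd : [bounded u x | x in `[r, +oo[%classic])
  (rho_pos : forall x, r <= x -> 0 < rho x)
  (u_decr : forall x y, r <= x -> x < y -> u y <= u x)
  (rho0_pos : 0 < rho0)
  (C_ge1 : 1 <= C)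
  (Y_start : forall e, 0 < e -> Y e 0%N = r)
  (Y_step : forall e i, 0 < e ->
     e `^ 3^-1 <= Y e i.+1 - Y e i <= C * e `^ 3^-1) :
  exists2 e0 : R, 0 < e0 &
  exists (W : R -> set (wave R)) (rhoU uU : R -> R -> R -> R),
  [/\ forall e, 0 < e < e0 ->
        let d := sampled_data (Y e) rho0 u0 rho u in
        [/\ tracking_waves e d (W e),
            represents e d (W e) (rhoU e) (uU e) &
            admissible d (W e)],
      shadow_asymptotics W &
      approximate_solution rhoU uU
        (glued_data r rho0 rho) (glued_data r u0 u)].
Proof.
have [B1 rho_le] := bounded_on rho_bnd; have [M1 u_le] := bounded_on u_bnd.
pose B := Num.max rho0 B1; pose M := Num.max `|u0| M1.
have rI x : r <= x -> `[r, +oo[%classic x by rewrite /= in_itv /= andbT.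
have rho_leB x : r <= x -> `|rho x| <= B by move=> /rI/rho_le h; rewrite le_max h orbT.
have u_leM x : r <= x -> `|u x| <= M by move=> /rI/u_le h; rewrite le_max h orbT.
have rho0_le : rho0 <= B by rewrite le_max lexx.
have u0_le : `|u0| <= M by rewrite le_max lexx.
pose d e := sampled_data (Y e) rho0 u0 rho u; pose del (e : R) := e `^ 3^-1.
have H e : 0 < e -> regular_data (d e) M B (del e).
  exact: (sampled_regular rho0_pos rho0_le u0_le rho_pos rho_leB u_leM u_decr Y_start Y_step).
(* The bound e <= 1 keeps half-widths of strips at most t + 1 and the mesh [del e] at most 1. *)
exists 1 => //.
exists (fun e => class_waves (d e) e), (fun e => rho_approx (d e) M (del e) e),
  (fun e => u_approx (d e) M (del e) e); split.
- move=> e /andP[e0 e1]; split.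
  + exact: (class_waves_tracking (H e e0) e0).
  + exact: (class_waves_represents (H e e0) e0).
  + exact: (class_waves_admissible (H e e0)).
- exact: (@class_waves_asymptotics _ d M B del H).
pose moment p e x t := rho_approx (d e) M (del e) e x t * u_approx (d e) M (del e) e x t ^+ p.
have m0 : (fun e => rho_approx (d e) M (del e) e) = moment 0.
  by apply/funext => e; apply/funext => x; apply/funext => t; rewrite /moment expr0 mulr1.
have li p e : 0 < e <= 1 -> Defs.locally_integrable (moment p e).
  exact: (moment_locally_integrable rho0_pos rho0_le u0_le rho_pos rho_leB u_leM u_decr Y_start Y_step).
have wd p phi : (p <= 1)%N -> test_function phi ->
    weak_defect (moment p e) (moment p.+1 e) phi @[e --> (0 : R)^'+] --> (0 : R).
  exact: (weak_defect_cvg rho0_pos rho0_le u0_le rho_pos rho_leB u_leM u_decr Y_start Y_step).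
have cdel : del e @[e --> (0 : R)^'+] --> 0 by apply: powR_cvg0; rewrite invr_gt0.
have C0 : 0 <= C by exact: le_trans ler01 C_ge1.
have box (x K : R) : `|x| <= K -> 0 <= (0 : R) <= K.
  by move=> xK; rewrite lexx /=; apply: le_trans xK.
have Rl e x : 0 < e < 1 -> x <= r -> region_index (d e) x 0 = 0%N.
  move=> /andP[e0 _] xr; have := initial_region (H e e0) x.
  by rewrite /= Y_start // xr.
have Rr e x : 0 < e < 1 -> r < x -> exists j,
    region_index (d e) x 0 = j.+2 /\ x <= Y e j.+1 <= x + C * del e.
  move=> /andP[e0 _].
  exact: (initial_sample rho0_pos rho0_le u0_le rho_pos rho_leB u_leM u_decr Y_start Y_step).
have rho_in e x : 0 < e -> rho_approx (d e) M (del e) e x 0 =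
    density (d e) (region_of (region_index (d e) x 0)).
  move=> e0; rewrite /rho_approx; case: asboolP => // st.
  by case: (no_initial_strip (H e e0) e0 st).
have u_in e x : 0 < e < 1 -> u_approx (d e) M (del e) e x 0 =
    lvel (d e) (region_of (region_index (d e) x 0)).
  move=> e01; have /andP[e0 _] := e01; rewrite /u_approx; case: asboolP => st.
    by case: (no_initial_strip (H e e0) e0 st).
  have [xr|rx] := leP x r; first by rewrite (Rl e x e01 xr).
  by have [j [-> _]] := Rr e x e01 rx.
rewrite /approximate_solution; split.
- near=> e; have e01 : 0 < e <= 1.
    by apply/andP; split; near: e; [exact: nbhs_right_gt|exact: nbhs_right_le].
  split; [|exact: (li 1%N)|exact: (li 2%N)].
  by have := li 0%N e e01; rewrite -m0.
- by move=> phi tphi; have := wd 0%N phi isT tphi; rewrite -m0.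
- by move=> phi tphi; exact: (wd 1%N phi isT tphi).
- apply: (@sampled_distribution_cvg _ r rho0 B C rho del) => //.
  + move=> e K e01; have /andP[e0 e1] := e01.
    exists (fun x => step (d e) (front_count (d e) M (del e) K) (node_flux (d e) 0) x 0).
      have h := measurable_step (H e e0) (front_count (d e) M (del e) K) (node_flux (d e) 0).
      exact: (measurable_fun_pair1 (0 : R) h).
    move=> x xK; rewrite rho_in // (stepE (H e e0)) //.
      by rewrite /node_flux expr0 mulr1.
    exact: (region_index_le (H e e0) xK (box _ _ xK)).
  + by move=> e x e01 xr; have /andP[e0 _] := e01; rewrite rho_in // Rl.
  + move=> e x e01 rx; have /andP[e0 _] := e01; have [j [rj hj]] := Rr e x e01 rx.
    by exists (Y e j.+1) => //; rewrite rho_in // rj.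
- apply: (@sampled_distribution_cvg _ r u0 M C u del) => //.
  + move=> e K e01; have /andP[e0 e1] := e01.
    exists (fun x => step (d e) (front_count (d e) M (del e) K)
        (fun k => lvel (d e) (region_of k)) x 0).
      have h := measurable_step (H e e0) (front_count (d e) M (del e) K) (fun k => lvel (d e) (region_of k)).
      exact: (measurable_fun_pair1 (0 : R) h).
    move=> x xK; rewrite u_in // (stepE (H e e0)) //.
    exact: (region_index_le (H e e0) xK (box _ _ xK)).
  + by move=> e x e01 xr; rewrite u_in // Rl.
  + move=> e x e01 rx; have [j [rj hj]] := Rr e x e01 rx.
    by exists (Y e j.+1) => //; rewrite u_in // rj.
Unshelve. all: by end_near.
Qed.
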